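(* Let $M$ be a closed orientable smooth $n$-manifold, $\mathcal M$ the space of smooth Riemannian metrics on $M$, and $g_0\in\mathcal M$ fixed. Consider on $\mathcal M$ the weak Riemannian structure $$\langle a,b\rangle_g=\int_M \mathrm{tr}(g_0^{-1}a\,g_0^{-1}b)\,d\mu(g),\qquad a,b\in T_g\mathcal M=S_2 .$$ Then: 1) Its covariant derivative is $$D_ab=d_ab+\tfrac14\big(\mathrm{tr}(A)b+\mathrm{tr}(B)a\big)-\tfrac14\mathrm{tr}(A_0B_0)\,g_0G .$$ 2) Its curvature tensor is $$K(a,b)c=-\tfrac1{16}\Big(\big(4\mathrm{tr}(AC)+\mathrm{tr}(A)\mathrm{tr}(C)\big)b-\big(4\mathrm{tr}(BC)+\mathrm{tr}(B)\mathrm{tr}(C)\big)a\Big)-\tfrac1{16}\mathrm{tr}(A_0C_0)\,g_0\big(4B+\mathrm{tr}(B)\big)G$$ $$+\tfrac1{16}\mathrm{tr}(B_0C_0)\,g_0\big(4A+\mathrm{tr}(A)\big)G+\tfrac1{16}\mathrm{tr}(G^2)\big(\mathrm{tr}(A_0C_0)b-\mathrm{tr}(B_0C_0)a\big).$$ 3) The sectional curvature $K_\sigma$ in a plane section $\sigma$ given by orthonormal vectors $a,b\in T_g\mathcal M$ is equal to zero if $a,b$ are scalar tensors ($a=\alpha g$, $b=\beta g$); and in the case when $a,b$ are traceless ($\mathrm{tr}A=0$, $\mathrm{tr}B=0$) it is expressed by the formula $$K_\sigma=\int_M\Big(-\tfrac12\mathrm{tr}(AB)\mathrm{tr}(A_0B_0)+\tfrac14\big(\mathrm{tr}(A^2)\mathrm{tr}(B_0^2)+\mathrm{tr}(B^2)\mathrm{tr}(A_0^2)\big)-\tfrac1{16}\mathrm{tr}(G^2)\big(\mathrm{tr}(A_0^2)\mathrm{tr}(B_0^2)-(\mathrm{tr}(A_0B_0))^2\big)\Big)d\mu(g).$$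 4) Geodesics $g_t$ on $\mathcal M$ are solutions of the second-order differential equation $$\frac{d}{dt}\Big(\rho(g)\frac{dg}{dt}\Big)=k\,g_0G,$$ where $k=k(x)$ is a positive function on $M$ which does not depend on $t$ and is equal to one eighth of the length of the initial velocity of the geodesic $g_t(x)$ on $\mathcal M_x$, $x\in M$.
   Context: $S_2$ is the Fréchet space of smooth symmetric 2-forms on $M$; $\mathcal M$ is the open cone of positive definite ones, so $T_g\mathcal M=S_2$. $\mu(g)$ is the Riemannian volume form of $g$ and $\rho(g)$ is the positive function with $\mu(g)=\rho(g)\mu(g_0)$. For $a,b,c\in S_2$ and $g\in\mathcal M$ put $A=g^{-1}a$, $B=g^{-1}b$, $C=g^{-1}c$ (endomorphisms of $TM$ obtained by raising the first index with $g$), $A_0=g_0^{-1}a$, $B_0=g_0^{-1}b$, $C_0=g_0^{-1}c$, $G=g^{-1}g_0$; a scalar such as $\mathrm{tr}(A)$ added to an endomorphism means that multiple of the identity. A symmetric form composed with an endomorphism is a 2-form, e.g. $g_0G=g_0g^{-1}g_0$. In item 3, $\alpha,\beta$ are functions on $M$. For a vector field $b=b(g)$ on $\mathcal M$, $d_ab=\frac{d}{dt}|_{t=0}b(g+ta)$ is the usual directional derivative in $S_2$. The covariant derivative $D$ is the Riemannian (torsion-free, metric-compatible) connection of the weak Riemannian structure, and $K$ is its curvature tensor. $\mathcal M_x$ is the space of inner products on the tangent space $T_xM$, with the Riemannian metric $\langle a,b\rangle_{g,x}=\mathrm{tr}(g_0^{-1}ag_0^{-1}b)(x)\,\rho(g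)(x)$.
   Formalization: In item 4, k is one fourth of the squared length of the initial velocity on M_x, not one eighth of the length, which contradicts item 1; and k is nonnegative, being positive exactly at least where the initial velocity does not vanish. *)

(* Defs.v *)
From HB Require Import structures.
From mathcomp Require Import all_boot all_order all_algebra.
From mathcomp Require Import all_classical all_reals all_analysis.

Set Implicit Arguments.
Unset Strict Implicit.
Unset Printing Implicit Defensive.

Import Order.TTheory GRing.Theory Num.Theory.
Import numFieldNormedType.Exports.

Local Open Scope classical_set_scope.
Local Open Scope ring_scope.

(* No dimension is excluded, so partial derivatives are taken along lines t |-> x + t e_j: 'rV[R]_k has
   a library topology for every k, but a norm only for k > 0. *)

Section EuclideanCalculus.
Variables (R : realType) (k : nat).
Implicit Types (f : 'rV[R]_k -> R) (x : 'rV[R]_k) (s : seq 'I_k).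

Definition along f x (j : 'I_k) : R -> R := fun t => f (x + t *: delta_mx 0 j).

Definition partial (j : 'I_k) f : 'rV[R]_k -> R := fun x => derive1 (along f x j) 0.

Definition partials s f : 'rV[R]_k -> R := foldr partial f s.

Definition smooth_on (D : set 'rV[R]_k) f : Prop :=
  forall s x, D x ->
    {for x, continuous (partials s f)} /\
    forall j, derivable (along (partials s f) x j) 0 1.

End EuclideanCalculus.

(* Integral over R^n as an iterated one-dimensional Lebesgue integral; it is
   only applied below to compactly supported continuous functions. *)
Fixpoint euclidean_integral (R : realType) (n : nat) :
    ('rV[R]_n -> R) -> R :=
  match n with
  | 0 => fun f => f 0
  | m.+1 => fun f =>
      Rintegral lebesgue_measure setT (fun t : R =>
        euclidean_integral (fun v : 'rV[R]_m => f (row_mx t%:M v)))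
  end.

Record chart (R : realType) (n : nat) (M : topologicalType) := Chart {
  chart_dom : set M ;
  chart_map : M -> 'rV[R]_n ;
  chart_inv : 'rV[R]_n -> M ;
  chart_dom_open : open chart_dom ;
  chart_img_open : open (chart_map @` chart_dom) ;
  chart_invK : {in chart_dom, cancel chart_map chart_inv} ;
  chart_map_cont : {in chart_dom, continuous chart_map} ;
  chart_inv_cont : {in chart_map @` chart_dom, continuous chart_inv}
}.

Section Transition.
Variables (R : realType) (n : nat) (M : topologicalType).
Implicit Types c d : chart R n M.

Definition chart_img c : set 'rV[R]_n := chart_map c @` chart_dom c.

Definition overlap c d : set M := chart_dom c `&` chart_dom d.

Definition transition c d (j : 'I_n) : 'rV[R]_n -> R :=
  fun x => chart_map d (chart_inv c x) 0 j.

Definition compatible c d : Prop :=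
  forall j, smooth_on (chart_map c @` overlap c d) (transition c d j).

(* (jacobian_at c d p) j l = d y_j / d x_l, where x, y are the coordinates of
   c, d; the coordinate columns of a tangent vector at p satisfy v_d = J v_c. *)
Definition jacobian_at c d (p : M) : 'M[R]_n :=
  \matrix_(j, l) partial l (transition c d j) (chart_map c p).

End Transition.

(* [chart_at p] is a preferred chart around p, used to evaluate quantities
   whose value at p does not depend on the chart. *)
Record closed_manifold (R : realType) (n : nat) := ClosedManifold {
  points :> topologicalType ;
  points_hausdorff : hausdorff_space points ;
  points_compact : compact [set: points] ;
  chart_index : Type ;
  atlas : chart_index -> chart R n points ;
  chart_at : points -> chart_index ;
  chart_atP : forall p, chart_dom (atlas (chart_at p)) p ;
  atlas_compatible : forall i j, compatible (atlas i) (atlas j)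
}.

Definition orientable (R : realType) (n : nat) (M : closed_manifold R n) :
    Prop :=
  exists (J : Type) (o : J -> chart R n M),
    [/\ forall p, exists j, chart_dom (o j) p,
        forall j i, compatible (o j) (atlas i) /\ compatible (atlas i) (o j)
      & forall j l p, overlap (o j) (o l) p ->
          0 < \det (jacobian_at (o j) (o l) p)].

Section Tensors.
Variables (R : realType) (n : nat) (M : closed_manifold R n).

(* A tensor field of rank two is the family of its component matrices
   a i p in the charts i of the atlas, at the points p of their domains. *)
Definition tensor := chart_index M -> M -> 'M[R]_n.

Implicit Types (a b c g h v : tensor) (i : chart_index M) (p : M) (f : M -> R).

Definition dom i : set M := chart_dom (atlas i).
Definition img i : set 'rV[R]_n := chart_img (atlas i).

Definition component a i (j l : 'I_n) : 'rV[R]_n -> R :=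
  fun x => a i (chart_inv (atlas i) x) j l.

Definition smooth_function f : Prop :=
  forall i, smooth_on (img i) (f \o chart_inv (atlas i)).

(* The space S_2.  Components vanish off the chart domain, so that equality
   of tensors is equality of functions. *)
Record S2 a : Prop := {
  S2_off : forall i p, ~ dom i p -> a i p = 0 ;
  S2_sym : forall i p, (a i p)^T = a i p ;
  S2_transform : forall i j p, dom i p -> dom j p ->
    let J := jacobian_at (atlas i) (atlas j) p in
    a i p = J^T *m a j p *m J ;
  S2_smooth : forall i j l, smooth_on (img i) (component a i j l)
}.

Record metric g : Prop := {
  metric_S2 : S2 g ;
  metric_pos : forall i p, dom i p ->
    forall w : 'cV[R]_n, w != 0 -> 0 < (w^T *m g i p *m w) 0 0
}.

Definition scale_by f a : tensor := fun i p => f p *: a i p.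

(* The endomorphism h^-1 a. *)
Definition raise h a : tensor := fun i p => invmx (h i p) *m a i p.

(* The Frechet topology of S_2: the family F t tends to v as t -> 0, t != 0,
   in every seminorm a |-> sup over a compact set K of a coordinate domain of
   an iterated partial derivative of a component of a. *)
Definition cvg_S2 (F : R -> tensor) v : Prop :=
  forall i (K : set 'rV[R]_n), compact K -> K `<=` img i ->
  forall (s : seq 'I_n) (j l : 'I_n) (e : R), 0 < e ->
    \forall t \near 0^', forall x, K x ->
      `|partials s (component (F t - v) i j l) x| <= e.

Definition curve_deriv (g : R -> tensor) (t : R) : tensor :=
  xget 0 [set v | S2 v /\ cvg_S2 (fun e => e^-1 *: (g (t + e) - g t)) v].

(* d_a b at g *)
Definition dir_deriv (b : tensor -> tensor) a g : tensor :=
  curve_deriv (fun t => b (g + t *: a)) 0.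

(* A family of elements of S_2 with parameter in an open subset U of R^k is
   smooth when it is smooth jointly in the parameter and the point of M; for
   k = 1 these are the smooth curves in the Frechet space S_2. *)
Definition smooth_family (k : nat) (U : set 'rV[R]_k)
    (F : 'rV[R]_k -> tensor) : Prop :=
  (forall u, U u -> S2 (F u)) /\
  forall i j l, smooth_on
    [set w : 'rV[R]_(k + n) | U (lsubmx w) /\ img i (rsubmx w)]
    (fun w => component (F (lsubmx w)) i j l (rsubmx w)).

(* Maps on the open cone of metrics are smooth when they send smooth families
   to smooth families; for maps between Frechet spaces this is the same as
   having continuous directional derivatives of all orders. *)
Definition smooth_field (b : tensor -> tensor) : Prop :=
  forall k (U : set 'rV[R]_k) F, open U -> smooth_family U F ->
    (forall u, U u -> metric (F u)) -> smooth_family U (b \o F).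

Definition smooth_scalar (phi : tensor -> R) : Prop :=
  forall k (U : set 'rV[R]_k) F, open U -> smooth_family U F ->
    (forall u, U u -> metric (F u)) -> smooth_on U (phi \o F).

Definition bracket (a b : tensor -> tensor) : tensor -> tensor :=
  fun g => dir_deriv b (a g) g - dir_deriv a (b g) g.

End Tensors.

Arguments dom {R n M} i.
Arguments img {R n M} i.
Arguments component {R n M} a i j l.

Section Integration.
Variables (R : realType) (n : nat) (M : closed_manifold R n).
Implicit Types (g : tensor M) (f : M -> R) (p : M).

Record partition_of_unity := PartitionOfUnity {
  pu_size : nat ;
  pu_chart : 'I_pu_size -> chart_index M ;
  pu_fun : 'I_pu_size -> M -> R ;
  pu_smooth : forall m, smooth_function (pu_fun m) ;
  pu_ge0 : forall m p, 0 <= pu_fun m p ;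
  pu_sum : forall p, \sum_m pu_fun m p = 1 ;
  pu_supp : forall m,
    closure [set p | pu_fun m p != 0] `<=` dom (pu_chart m)
}.

Arguments pu_chart : clear implicits.
Arguments pu_fun : clear implicits.

(* mu(g) = vol_density g i dx_1 ... dx_n in the chart i. *)
Definition vol_density g (i : chart_index M) p : R := Num.sqrt (\det (g i p)).

(* The integral of f with respect to mu(g); as usual it does not depend on P. *)
Definition integral_vol (P : partition_of_unity) g f : R :=
  \sum_m euclidean_integral
    ((fun x => let p := chart_inv (atlas (pu_chart P m)) x in
        pu_fun P m p * f p * vol_density g (pu_chart P m) p)
       \_ (img (pu_chart P m))).

(* The positive function with mu(g) = rho(g) mu(g0). *)
Definition rho (g0 g : tensor M) p : R :=
  vol_density g (chart_at p) p / vol_density g0 (chart_at p) p.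

End Integration.

Section WeakRiemannianStructure.
Variables (R : realType) (n : nat) (M : closed_manifold R n).
Variables (P : partition_of_unity M) (g0 : tensor M).
Implicit Types (g : tensor M).

Definition tr0 (a b : tensor M) (p : M) : R :=
  \tr (raise g0 a (chart_at p) p *m raise g0 b (chart_at p) p).

Definition inner g (a b : tensor M) : R := integral_vol P g (tr0 a b).

(* The metric of the space of inner products on the tangent space at p. *)
Definition inner_at g (p : M) (a b : tensor M) : R := tr0 a b p * rho g0 g p.

Definition field := tensor M -> tensor M.

Implicit Types (a b c : field) (D : field -> field -> field).

Record riemannian_connection D : Prop := {
  conn_smooth : forall a b,
    smooth_field a -> smooth_field b -> smooth_field (D a b) ;
  conn_addl : forall a a' b g,
    smooth_field a -> smooth_field a' -> smooth_field b -> metric g ->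
    D (fun h => a h + a' h) b g = D a b g + D a' b g ;
  conn_scalel : forall (phi : tensor M -> R) a b g,
    smooth_scalar phi -> smooth_field a -> smooth_field b -> metric g ->
    D (fun h => phi h *: a h) b g = phi g *: D a b g ;
  conn_addr : forall a b b' g,
    smooth_field a -> smooth_field b -> smooth_field b' -> metric g ->
    D a (fun h => b h + b' h) g = D a b g + D a b' g ;
  conn_leibniz : forall (phi : tensor M -> R) a b g,
    smooth_scalar phi -> smooth_field a -> smooth_field b -> metric g ->
    D a (fun h => phi h *: b h) g =
      derive1 (fun t : R => phi (g + t *: a g)) 0 *: b g + phi g *: D a b g ;
  conn_torsion_free : forall a b g,
    smooth_field a -> smooth_field b -> metric g ->
    D a b g - D b a g = bracket a b g ;
  conn_metric : forall a b c g,
    smooth_field a -> smooth_field b -> smooth_field c -> metric g ->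
    is_derive (0 : R) (1 : R)
      (fun t : R => let h := g + t *: a g in inner h (b h) (c h))
      (inner g (D a b g) (c g) + inner g (b g) (D a c g))
}.

Definition curvature D a b c : field := fun g =>
  D a (D b c) g - D b (D a c) g - D (bracket a b) c g.

(* Sectional curvature of the plane spanned by a g and b g. *)
Definition sectional D a b g : R :=
  inner g (curvature D a b b g) (a g) /
  (inner g (a g) (a g) * inner g (b g) (b g) - inner g (a g) (b g) ^+ 2).

Definition smooth_curve (J : set R) (g : R -> tensor M) : Prop :=
  smooth_family [set u : 'rV[R]_1 | J (u 0 0)] (fun u => g (u 0 0)).

(* Covariant derivative at time t of a field v along a curve g.  The space of
   metrics is open in the vector space S_2, so constant fields extend tangent
   vectors and D of constant fields is the Christoffel form. *)
Definition covariant_deriv D (g v : R -> tensor M) (t : R) : tensor M :=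
  curve_deriv v t + D (cst (curve_deriv g t)) (cst (v t)) (g t).

Definition geodesic D (J : set R) (g : R -> tensor M) : Prop :=
  forall t, J t -> covariant_deriv D g (curve_deriv g) t = 0.

(* The factor k for a geodesic with initial point g and initial velocity v.  It
   is one fourth of the squared length of v at p, as substituting the geodesic
   equation into d/dt (rho dg/dt) shows; the published text has one eighth of
   the length, which is not homogeneous under t |-> s t. *)
Definition geodesic_factor g (v : tensor M) (p : M) : R :=
  4^-1 * inner_at g p v v.

End WeakRiemannianStructure.

(* Main.v *)
Require Import Defs.
From HB Require Import structures.
From mathcomp Require Import all_boot all_order all_algebra.
From mathcomp Require Import perm.
From mathcomp Require Import all_classical all_reals all_analysis.
From mathcomp Require Import ring lra.

Set Implicit Arguments.
Unset Strict Implicit.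
Unset Printing Implicit Defensive.

Import Order.TTheory GRing.Theory Num.Theory.
Import numFieldNormedType.Exports.

Local Open Scope classical_set_scope.
Local Open Scope ring_scope.

(** Fix a point of M. At that point the covariant derivative is d_a b plus a
    quadratic expression in a and b, the Christoffel form of the metric
    tr (g0^-1 a g0^-1 b) rho (g) on the space of inner products; nothing but the
    values of a, b, g and g0 at the point enters, because the structure on the
    space of metrics is the integral over M of these pointwise metrics. The
    Christoffel form is determined by two facts: rho has logarithmic derivative
    tr (g^-1 a) / 2 in direction a, and g0 g^-1 g0 is dual to the trace,
    tr (g0^-1 (g0 g^-1 g0) g0^-1 c) = tr (g^-1 c). They give the compatibility
    with the inner product at each point [christoffel_metric], and integration
    gives it on the space of metrics [has_deriv_inner].

    Uniqueness is the usual argument: the difference of two torsion-free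
    compatible connections is symmetric in two arguments and skew in two others,
    hence zero, because the inner product is definite [inner_pos] and each
    tangent vector extends to a constant field [riemannian_levi_civita].

    In the curvature the second derivatives of the third field cancel up to the
    term with the bracket [dir_commutator], and what is left is the curvature of the
    Christoffel form: the antisymmetrized derivative in the base point plus the
    commutator of the forms [levi_civita_curvature], a computation with matrices
    [christoffel_curvature]. The sectional curvatures follow by taking traces.

    For a curve g with velocity v and covariant acceleration W, the linear terms
    of the Christoffel form are absorbed by the factor rho, so that
      d/dt (rho v) = rho W + kappa g0 g^-1 g0,
    where kappa = rho tr ((g0^-1 v)^2) / 4 [momentum_deriv]; and by compatibility
    d/dt kappa = rho tr (g0^-1 v g0^-1 W) / 2 [has_deriv_energy]. If W = 0, then
    kappa keeps its initial value k and d/dt (rho v) = k g0 g^-1 g0. Conversely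
    this equation means rho W = (k - kappa) g0 g^-1 g0, from which
    rho (kappa - k) has derivative zero; it vanishes initially, hence always,
    and W = 0 [geodesic_momentum].

    The analysis behind this concerns smooth families of tensors. A directional
    derivative of a field is a parameter derivative of a smooth family
    [push_dir], and parameter derivatives are computed entry by entry because
    difference quotients converge in the topology of S_2 [cvg_S2_pderiv].
    Linearity of d_a c in a comes from a family with two parameters [dirD], and
    the chain rule for d_(b (g)) c from a lemma of Hadamard type
    [family_hadamard]. The iterated integrals are linear, positive and can be
    differentiated under the integral sign on continuous functions supported in
    a fixed box [euclidean_integral_basic]; such are the integrands, cut off by
    the partition of unity [cutoff_boxed]. *)

(** * Limits and derivatives of functions of one variable *)

Instance matrix_nbhs_filter (R : realType) (m n : nat) (x : 'M[R]_(m, n)) :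
  Filter (nbhs x).
Proof. exact: (@nbhs_filter 'M[R]_(m, n) x). Qed.

Section Lines.
Variable R : realType.

Lemma mx_cvg (m n : nat) (T : Type) (F : set_system T) (FF : Filter F)
    (f : T -> 'M[R]_(m, n)) (A : 'M[R]_(m, n)) :
  (forall i j, (fun t => f t i j) @ F --> A i j) -> f @ F --> A.
Proof.
move=> fA; apply/cvg_ballP => e e0.
suff : \forall x \near F, forall i j, ball (A i j) e (f x i j).
  by apply: filterS => x H; split.
apply: filter_forall => i; apply: filter_forall => j.
by move/cvg_ballP: (fA i j) => /(_ e e0).
Qed.

Lemma mx_coord_cvg (m n : nat) (T : Type) (F : set_system T) (FF : Filter F)
    (f : T -> 'M[R]_(m, n)) (A : 'M[R]_(m, n)) i j :
  f @ F --> A -> (fun t => f t i j) @ F --> A i j.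
Proof.
by move=> fA; exact: (cvg_comp f (fun M : 'M[R]_(m, n) => M i j) fA
  (@coord_continuous R m n i j A)).
Qed.

Lemma line_cvg (m n : nat) (T : Type) (F : set_system T) (FF : Filter F)
    (s : T -> R) (s0 : R) (f : T -> 'M[R]_(m, n)) (x v : 'M[R]_(m, n)) :
  s @ F --> s0 -> f @ F --> x -> (fun t => f t + s t *: v) @ F --> x + s0 *: v.
Proof.
move=> cs cf; apply: mx_cvg => i j; rewrite !mxE.
under eq_fun do rewrite !mxE.
apply: cvgD; first exact: mx_coord_cvg.
by apply: cvgM => //; exact: cvg_cst.
Qed.

Definition has_deriv (f : R -> R) (x d : R) : Prop := is_derive x (1 : R) f d.

Lemma has_deriv_near (f g : R -> R) (x d : R) :
  (\forall t \near x, f t = g t) -> has_deriv f x d -> has_deriv g x d.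
Proof.
move=> fg [df <-]; apply: DeriveDef.
  by apply: near_eq_derivable df => //; rewrite oner_eq0.
by apply/esym; apply: near_eq_derive => //; rewrite oner_eq0.
Qed.

Lemma has_derivP (f : R -> R) (x d : R) :
  has_deriv f x d <-> (fun h => h^-1 * (f (x + h) - f x)) @ 0^' --> d.
Proof.
have E : (fun h : R => h^-1 *: ((f \o shift x) (h *: (1 : R)) - f x)) =
         (fun h => h^-1 * (f (x + h) - f x)).
  apply/funext => h; rewrite /= /GRing.scale /=.
  by rewrite [h * 1]mulr1 (addrC h).
split=> [[df <-]|cf].
  by move: df; rewrite /derivable /derive E.
apply: DeriveDef; first by apply/cvg_ex; exists d; rewrite E.
by rewrite /derive E; apply/cvg_lim.
Qed.

Lemma has_deriv_uniq (f : R -> R) (x d d' : R) :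
  has_deriv f x d -> has_deriv f x d' -> d = d'.
Proof. by move=> [_ <-] [_ <-]. Qed.

Lemma has_deriv_shift (f : R -> R) (x d : R) :
  has_deriv f x d <-> has_deriv (fun h => f (x + h)) 0 d.
Proof.
split=> /has_derivP H; apply/has_derivP.
  by under eq_fun do rewrite add0r addr0.
by move: H; under eq_fun do rewrite add0r addr0.
Qed.

Lemma has_deriv_cont (f : R -> R) (x d : R) :
  has_deriv f x d -> {for x, continuous f}.
Proof.
by move=> [df _]; apply: differentiable_continuous; apply/derivable1_diffP.
Qed.

Lemma has_deriv_derivable (f : R -> R) (x d : R) :
  has_deriv f x d -> derivable f x 1.
Proof. by case. Qed.

Lemma derivable_has_deriv (f : R -> R) (x : R) :
  derivable f x 1 -> has_deriv f x (derive1 f x).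
Proof. by move=> df; apply: DeriveDef => //; rewrite derive1E. Qed.

Lemma has_deriv1 (f : R -> R) (x d : R) : has_deriv f x d -> derive1 f x = d.
Proof. by move=> [_ <-]; rewrite derive1E. Qed.

Lemma has_deriv_cst (c x : R) : has_deriv (fun=> c) x 0.
Proof. exact: is_derive_cst. Qed.

Lemma has_deriv_id (x : R) : has_deriv id x 1.
Proof. exact: is_derive_id. Qed.

Lemma has_derivD (f g : R -> R) (x d e : R) : has_deriv f x d ->
  has_deriv g x e -> has_deriv (fun t => f t + g t) x (d + e).
Proof. by move=> df dg; exact: is_deriveD. Qed.

Lemma has_derivN (f : R -> R) (x d : R) : has_deriv f x d ->
  has_deriv (fun t => - f t) x (- d).
Proof. by move=> df; exact: is_deriveN. Qed.

Lemma has_derivB (f g : R -> R) (x d e : R) : has_deriv f x d ->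
  has_deriv g x e -> has_deriv (fun t => f t - g t) x (d - e).
Proof. by move=> df dg; apply: has_derivD => //; exact: has_derivN. Qed.

Lemma has_derivM (f g : R -> R) (x d e : R) : has_deriv f x d ->
  has_deriv g x e -> has_deriv (fun t => f t * g t) x (d * g x + f x * e).
Proof.
move=> df dg; have := is_deriveM df dg.
by rewrite /GRing.scale /= addrC (mulrC (g x)).
Qed.

Lemma has_derivZ (f : R -> R) (c x d : R) : has_deriv f x d ->
  has_deriv (fun t => c * f t) x (c * d).
Proof. by move=> df; have := has_derivM (has_deriv_cst c x) df; rewrite mul0r add0r. Qed.

Lemma has_deriv_sum (I : Type) (r : seq I) (P : pred I) (f : I -> R -> R)
    (x : R) (d : I -> R) :
  (forall i, has_deriv (f i) x (d i)) ->
  has_deriv (fun t => \sum_(i <- r | P i) f i t) x (\sum_(i <- r | P i) d i).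
Proof.
move=> df; elim: r => [|i r IH].
  by rewrite big_nil; under eq_fun do rewrite big_nil; exact: has_deriv_cst.
rewrite big_cons; under eq_fun do rewrite big_cons.
by case: ifP => // _; apply: has_derivD.
Qed.

Lemma has_derivV (f : R -> R) (x d : R) : f x != 0 -> has_deriv f x d ->
  has_deriv (fun t => (f t)^-1) x (- (f x)^-2 * d).
Proof.
move=> fx [df <-]; apply: DeriveDef; first exact: derivableV.
by rewrite deriveV.
Qed.

Lemma has_deriv_comp (f g : R -> R) (x d e : R) : has_deriv f x d ->
  has_deriv g (f x) e -> has_deriv (fun t => g (f t)) x (e * d).
Proof. by move=> df dg; exact: (is_derive1_comp (f := g)). Qed.

Lemma has_deriv_sqrt (f : R -> R) (x d : R) : 0 < f x -> has_deriv f x d ->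
  has_deriv (fun t => Num.sqrt (f t)) x ((2 * Num.sqrt (f x))^-1 * d).
Proof. by move=> f0 df; apply: has_deriv_comp df _; exact: is_derive1_sqrt. Qed.

Lemma has_deriv_scale (f : R -> R) (c d : R) :
  has_deriv f 0 d -> has_deriv (fun t => f (t * c)) 0 (c * d).
Proof.
move=> fd; rewrite mulrC; apply: (@has_deriv_comp (fun t => t * c)).
  rewrite -[X in has_deriv _ _ X](_ : 1 * c + 0 * 0 = c); last by rewrite mul1r mul0r addr0.
  by apply: has_derivM; [exact: has_deriv_id|exact: has_deriv_cst].
by rewrite mul0r.
Qed.

(** Increments of both signs occur in difference quotients. *)
Lemma mvt0 (f f' : R -> R) (h : R) :
  (forall t, `|t| <= `|h| -> has_deriv f t (f' t)) ->
  exists2 c, `|c| <= `|h| & f h - f 0 = f' c * h.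
Proof.
move=> df.
have cf a b : (forall t, t \in `[a, b] -> `|t| <= `|h|) ->
    {within `[a, b], continuous f}.
  move=> H; apply: continuous_in_subspaceT => t /set_mem /= tab.
  by apply: has_deriv_cont (df _ _); apply: H.
have [h0|h0|h0] := ltgtP 0 h; last first.
- by exists 0; rewrite -h0 ?normr0// subrr mulr0.
- have ab t : t \in `[h, 0] -> `|t| <= `|h|.
    by rewrite in_itv /= => /andP[? ?]; rewrite !ler0_norm ?lerN2 // ltW.
  have [|c cI E] := @MVT _ f f' h 0 h0 _ (cf _ _ ab).
    by move=> t tI; apply: df; apply: ab; apply: subset_itv_oo_cc.
  exists c; first by apply: ab; apply: subset_itv_oo_cc.
  by apply: oppr_inj; rewrite opprB E; ring.
- have ab t : t \in `[0, h] -> `|t| <= `|h|.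
    by rewrite in_itv /= => /andP[? ?]; rewrite !ger0_norm // ltW.
  have [|c cI E] := @MVT _ f f' 0 h h0 _ (cf _ _ ab).
    by move=> t tI; apply: df; apply: ab; apply: subset_itv_oo_cc.
  exists c; first by apply: ab; apply: subset_itv_oo_cc.
  by rewrite E; ring.
Qed.

Lemma near0_norm_lt (r : R) : 0 < r -> \forall h \near (0 : R), `|h| < r.
Proof.
move=> r0; apply/nbhs_ballP; exists r => // h.
by rewrite /ball /= sub0r normrN.
Qed.

Lemma near_punct (P : R -> Prop) :
  (\forall h \near (0 : R), P h) -> \forall h \near 0^', P h.
Proof. by move=> H; apply: (@cvg_within _ (nbhs (0 : R))). Qed.

Lemma near_punct_neq0 : \forall h \near (0 : R)^', h != 0.
Proof. by rewrite near_withinE; near=> h. Unshelve. all: by end_near. Qed.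

Lemma punctI (P Q : R -> Prop) : (\forall h \near 0^', P h) ->
  (\forall h \near 0^', Q h) -> \forall h \near 0^', P h /\ Q h.
Proof. by move=> hP hQ; near=> h; split; near: h. Unshelve. all: by end_near. Qed.

Lemma punct_ex (P : R -> Prop) : (\forall h \near 0^', P h) -> exists h, P h.
Proof.
by move=> hP; near (0 : R)^' => h; exists h; near: h.
Unshelve. all: by end_near. Qed.

(** The derivative along the diagonal, by the mean value theorem in the first
    variable at the moving value t of the second one. *)
Lemma has_deriv_diag (F F1 : R -> R -> R) (d : R) :
  (\forall z \near ((0, 0) : R * R), has_deriv (F^~ z.2) z.1 (F1 z.1 z.2)) ->
  (fun z : R * R => F1 z.1 z.2) @ ((0, 0) : R * R) --> F1 0 0 ->
  has_deriv (F 0) 0 d ->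
  has_deriv (fun t => F t t) 0 (F1 0 0 + d).
Proof.
move=> dF cF1 /has_derivP dF0; apply/has_derivP.
have -> : (fun h : R => h^-1 * (F (0 + h) (0 + h) - F 0 0)) =
   (fun h => h^-1 * (F h h - F 0 h)) \+ (fun h => h^-1 * (F 0 (0 + h) - F 0 0)).
  by apply/funext => h /=; rewrite !add0r; ring.
apply: cvgD => //; apply/cvgrPdist_le => /= e e0.
move: dF => /nbhs_ballP[r1 /= r10 H1].
move/cvgrPdist_le : cF1 => /(_ e e0) /nbhs_ballP[r2 /= r20 H2].
have r12 : 0 < Num.min r1 r2 by rewrite lt_min r10.
have N1 := near_punct (near0_norm_lt r12).
have N2 := near_punct_neq0.
near=> h.
have h0 : h != 0 by near: h.
have : `|h| < Num.min r1 r2 by near: h.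
rewrite lt_min => /andP[hr1 hr2].
have [c ch ->] : exists2 c, `|c| <= `|h| & F h h - F 0 h = F1 c h * h.
  apply: (@mvt0 (F^~ h) (F1^~ h)) => t th; apply: (H1 (t, h)).
  by split; rewrite /ball /= sub0r normrN //; apply: le_lt_trans hr1.
rewrite mulrC mulfK //; apply: (H2 (c, h)).
by split; rewrite /ball /= sub0r normrN //; apply: le_lt_trans hr2.
Unshelve. all: by end_near. Qed.

(** The estimate near each point of K extends to all of K by compactness. *)
Lemma unif_near (T X : topologicalType) (K : set X) (h : T -> X -> R) (t0 : T) :
  compact K ->
  (forall x, K x -> (fun z : T * X => h z.1 z.2) @ (t0, x) --> h t0 x) ->
  forall e, 0 < e ->
    \forall t \near t0, forall x, K x -> `|h t x - h t0 x| <= e.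
Proof.
move=> /compact_near_coveringP cK ch e e0.
apply: (cK T (nbhs t0) (fun t x => `|h t x - h t0 x| <= e)) => x Kx.
have e20 : 0 < e / 2 by rewrite divr_gt0.
move/cvgrPdist_le : (ch x Kx) => /(_ _ e20) [[A B] /= [A0 Bx] AB].
exists (B, A) => //= -[y t] /= [By At].
have h1 := AB (t, y) (conj At By).
have h2 := AB (t0, y) (conj (nbhs_singleton A0) By).
rewrite /= in h1 h2.
have -> : h t y - h t0 y = (h t0 x - h t0 y) - (h t0 x - h t y) by ring.
by rewrite (splitr e); apply: le_trans (ler_normB _ _) _; rewrite lerD.
Qed.

End Lines.

(** * Smooth functions on open sets of row vectors *)

Section Smoothness.
Variable R : realType.

Section Cm.
Variable k : nat.
Implicit Types (f g : 'rV[R]_k -> R) (D : set 'rV[R]_k).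

(** The class C^m on D; smoothness is C^m for every m, and closure properties
    of smoothness go by induction on m. *)
Fixpoint Cm (m : nat) D f : Prop :=
  (forall x : 'rV[R]_k, D x -> f y @[y --> x] --> f x) /\
  (if m is m'.+1 then
     forall j, (forall x, D x -> derivable (along f x j) 0 1) /\
       Cm m' D (partial j f)
   else True).

Lemma Cm_cont m D f : Cm m D f -> forall x : 'rV[R]_k, D x -> f y @[y --> x] --> f x.
Proof. by case: m => [|m] []. Qed.

Lemma CmS m D f : Cm m.+1 D f <->
  (forall x : 'rV[R]_k, D x -> f y @[y --> x] --> f x) /\
  forall j, (forall x, D x -> derivable (along f x j) 0 1) /\ Cm m D (partial j f).
Proof. by []. Qed.

Lemma Cm_pred m D f : Cm m.+1 D f -> Cm m D f.
Proof.
elim: m f => [|m IH] f [cf df]; split=> // j.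
by split; [exact: (df j).1|apply: IH; exact: (df j).2].
Qed.

Lemma smooth_partial D f j : smooth_on D f -> smooth_on D (partial j f).
Proof.
by move=> sf s x Dx; have := sf (rcons s j) x Dx; rewrite /partials foldr_rcons.
Qed.

Lemma smooth_onP D f : smooth_on D f <-> forall m, Cm m D f.
Proof.
split=> [sf m|sf s].
  elim: m f sf => [|m IH] f sf; (split; first by move=> x Dx; exact: (sf [::] x Dx).1) => //.
  move=> j; split; first by move=> x Dx; exact: (sf [::] x Dx).2.
  exact/IH/smooth_partial.
elim/last_ind: s f sf => [|s j IH] f sf x Dx.
  split; first exact: Cm_cont (sf 0) x Dx.
  by move=> j; have [_ /(_ j) [H _]] := sf 1; exact: H.
rewrite /partials foldr_rcons; apply: IH => // m.
by have [_ /(_ j) []] := sf m.+1.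
Qed.

Lemma smooth_cont D f x : smooth_on D f -> D x -> {for x, continuous f}.
Proof. by move=> sf Dx; exact: (sf [::] x Dx).1. Qed.

Lemma along0 f x j : along f x j 0 = f x.
Proof. by rewrite /along scale0r addr0. Qed.

Lemma along_deriv D f x j t : smooth_on D f -> D (x + t *: delta_mx 0 j) ->
  has_deriv (along f x j) t (partial j f (x + t *: delta_mx 0 j)).
Proof.
move=> sf Dx; apply/has_deriv_shift.
have -> : (fun h => along f x j (t + h)) = along f (x + t *: delta_mx 0 j) j.
  by apply/funext => h; rewrite /along scalerDl addrA.
by apply: derivable_has_deriv; exact: (sf [::] _ Dx).2.
Qed.

Lemma along_deriv0 D f x j : smooth_on D f -> D x ->
  has_deriv (along f x j) 0 (partial j f x).
Proof. by move=> sf Dx; apply: derivable_has_deriv; exact: (sf [::] _ Dx).2. Qed.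

Lemma along_cvg x j : (fun t : R => x + t *: (delta_mx 0 j : 'rV[R]_k)) @ (0 : R) --> x.
Proof.
rewrite -[X in _ --> X](_ : x + (0 : R) *: delta_mx 0 j = x); last by rewrite scale0r addr0.
by apply: line_cvg => //; exact: cvg_cst.
Qed.

Lemma along_near (P : 'rV[R]_k -> Prop) (x : 'rV[R]_k) j : (\forall y \near x, P y) ->
  \forall t \near (0 : R), P (x + t *: delta_mx 0 j).
Proof. by move=> Px; move: (@along_cvg x j) => /(_ _ Px). Qed.

Lemma partial_near f g (x : 'rV[R]_k) j : (\forall y \near x, f y = g y) ->
  partial j f x = partial j g x /\
  (derivable (along f x j) 0 1 -> derivable (along g x j) 0 1).
Proof.
move=> /(along_near j) fg; split; last by apply: near_eq_derivable; rewrite ?oner_eq0.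
by rewrite /partial !derive1E; apply: near_eq_derive; rewrite ?oner_eq0.
Qed.

Lemma near_open (D : set 'rV[R]_k) (P : 'rV[R]_k -> Prop) (x : 'rV[R]_k) :
  open D -> (forall y, D y -> P y) -> D x -> \forall y \near x, P y.
Proof. by move=> oD DP Dx; apply: filterS (open_nbhs_nbhs (conj oD Dx)) => y /DP. Qed.

Lemma cvg_eq_open f g D (x : 'rV[R]_k) : open D -> (forall x, D x -> f x = g x) ->
  D x -> f y @[y --> x] --> f x -> g y @[y --> x] --> g x.
Proof.
move=> oD fg Dx; rewrite -(fg x Dx); apply: cvg_trans.
by apply: near_eq_cvg; exact: (near_open oD fg Dx).
Qed.

Lemma Cm_eq m D f g : open D -> (forall x, D x -> f x = g x) ->
  Cm m D f -> Cm m D g.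
Proof.
move=> oD; elim: m f g => [|m IH] f g fg.
  by move=> [cf _]; split=> // x Dx; exact: (cvg_eq_open oD fg Dx (cf x Dx)).
move=> /CmS[cf df]; apply/CmS; split=> [x Dx|j].
  exact: (cvg_eq_open oD fg Dx (cf x Dx)).
have N x (Dx : D x) := partial_near j (near_open oD fg Dx).
split; first by move=> x Dx; apply: (N x Dx).2; exact: (df j).1.
by apply: IH (df j).2 => x Dx; exact: (N x Dx).1.
Qed.

Lemma Cm_step m D f : open D ->
  (forall x : 'rV[R]_k, D x -> f y @[y --> x] --> f x) ->
  (forall j, exists2 f' : 'rV[R]_k -> R,
     (forall x, D x -> has_deriv (along f x j) 0 (f' x)) & Cm m D f') ->
  Cm m.+1 D f.
Proof.
move=> oD cf df; apply/CmS; split=> // j; have [f' df' Cf'] := df j.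
split=> [x /df' /has_deriv_derivable //|]; apply: (Cm_eq oD) Cf' => x /df' /has_deriv1.
by [].
Qed.

Lemma Cm_deriv m D f j x : Cm m.+1 D f -> D x ->
  has_deriv (along f x j) 0 (partial j f x).
Proof. by move=> /CmS[_ /(_ j)[df _]] /df /derivable_has_deriv. Qed.

Lemma Cm_partial m D f j : Cm m.+1 D f -> Cm m D (partial j f).
Proof. by move=> /CmS[_ /(_ j)[]]. Qed.

Lemma Cm_cst m D (c : R) : open D -> Cm m D (fun=> c).
Proof.
move=> oD; elim: m c => [|m IH] c.
  by split=> // x _; exact: cvg_cst.
apply: Cm_step => // [x _|j]; first exact: cvg_cst.
by exists (fun=> 0) => // x _; exact: has_deriv_cst.
Qed.

Lemma CmD m D f g : open D -> Cm m D f -> Cm m D g ->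
  Cm m D (fun x => f x + g x).
Proof.
move=> oD; elim: m f g => [|m IH] f g cf cg.
  by split=> // x Dx; apply: cvgD; [exact: (Cm_cont cf Dx)|exact: (Cm_cont cg Dx)].
apply: Cm_step => // [x Dx|j].
  by apply: cvgD; [exact: (Cm_cont cf Dx)|exact: (Cm_cont cg Dx)].
exists (fun x => partial j f x + partial j g x).
  by move=> x Dx; apply: has_derivD; [exact: Cm_deriv cf Dx|exact: Cm_deriv cg Dx].
by apply: IH; exact: Cm_partial.
Qed.

Lemma CmM m D f g : open D -> Cm m D f -> Cm m D g ->
  Cm m D (fun x => f x * g x).
Proof.
move=> oD; elim: m f g => [|m IH] f g cf cg.
  by split=> // x Dx; apply: cvgM; [exact: (Cm_cont cf Dx)|exact: (Cm_cont cg Dx)].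
apply: Cm_step => // [x Dx|j].
  by apply: cvgM; [exact: (Cm_cont cf Dx)|exact: (Cm_cont cg Dx)].
exists (fun x => partial j f x * g x + f x * partial j g x).
  move=> x Dx; rewrite -{1}(along0 f x j) -{1}(along0 g x j).
  by apply: has_derivM; [exact: Cm_deriv cf Dx|exact: Cm_deriv cg Dx].
by apply: CmD => //; apply: IH => //; do ?[exact: Cm_partial|exact: Cm_pred].
Qed.

Lemma CmV m D f : open D -> (forall x, D x -> f x != 0) -> Cm m D f ->
  Cm m D (fun x => (f x)^-1).
Proof.
move=> oD f0; elim: m f f0 => [|m IH] f f0 cf.
  by split=> // x Dx; apply: cvgV; [exact: f0|exact: (Cm_cont cf Dx)].
apply: Cm_step => // [x Dx|j].
  by apply: cvgV; [exact: f0|exact: (Cm_cont cf Dx)].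
exists (fun x => (-1) * ((f x)^-1 * (f x)^-1) * partial j f x).
  move=> x Dx.
  have -> : -1 * ((f x)^-1 * (f x)^-1) = - (along f x j 0)^-2.
    by rewrite along0 mulN1r expr2 invfM.
  by apply: (@has_derivV _ (along f x j)); [rewrite along0 f0|exact: Cm_deriv cf Dx].
have Hi := IH _ f0 (Cm_pred cf).
apply: CmM => //; last exact: Cm_partial.
by apply: CmM => //; [exact: Cm_cst|exact: CmM].
Qed.

Lemma Cm_sqrt m D f : open D -> (forall x, D x -> 0 < f x) -> Cm m D f ->
  Cm m D (fun x => Num.sqrt (f x)).
Proof.
have cs (x : 'rV[R]_k) (g : 'rV[R]_k -> R) : g y @[y --> x] --> g x ->
    Num.sqrt (g y) @[y --> x] --> Num.sqrt (g x).
  by move=> cg; apply: (cvg_comp g (Num.sqrt : R -> R) cg (sqrt_continuous (x := g x))).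
move=> oD f0; elim: m f f0 => [|m IH] f f0 cf.
  by split=> // x Dx; apply: cs; exact: (Cm_cont cf Dx).
apply: Cm_step => // [x Dx|j]; first by apply: cs; exact: (Cm_cont cf Dx).
exists (fun x => (2 * Num.sqrt (f x))^-1 * partial j f x).
  move=> x Dx; rewrite -{1}(along0 f x j).
  by apply: (@has_deriv_sqrt _ (along f x j)); [rewrite along0 f0|exact: Cm_deriv cf Dx].
apply: CmM => //; last exact: Cm_partial.
apply: CmV => //; first by move=> x Dx; rewrite mulf_neq0 // gt_eqF // sqrtr_gt0 f0.
by apply: CmM => //; [exact: Cm_cst|apply: IH => //; exact: Cm_pred].
Qed.

Lemma smooth_partials D f s : smooth_on D f -> smooth_on D (partials s f).
Proof.
move=> sf; elim: s => [//|j s IH] s' x Dx.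
exact: (smooth_partial j IH).
Qed.

Lemma smooth_sub D D' f : D' `<=` D -> smooth_on D f -> smooth_on D' f.
Proof. by move=> sub sf s x /sub; exact: sf. Qed.

Lemma smooth_eq D f g : open D -> (forall x, D x -> f x = g x) ->
  smooth_on D f -> smooth_on D g.
Proof. by move=> oD fg /smooth_onP sf; apply/smooth_onP => m; apply: Cm_eq (sf m). Qed.

Lemma smooth_cst D c : open D -> smooth_on D (fun=> c).
Proof. by move=> oD; apply/smooth_onP => m; exact: Cm_cst. Qed.

Lemma smoothD D f g : open D -> smooth_on D f -> smooth_on D g ->
  smooth_on D (fun x => f x + g x).
Proof. by move=> oD /smooth_onP sf /smooth_onP sg; apply/smooth_onP => m; exact: CmD. Qed.

Lemma smoothM D f g : open D -> smooth_on D f -> smooth_on D g ->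
  smooth_on D (fun x => f x * g x).
Proof. by move=> oD /smooth_onP sf /smooth_onP sg; apply/smooth_onP => m; exact: CmM. Qed.

Lemma smoothV D f : open D -> (forall x, D x -> f x != 0) -> smooth_on D f ->
  smooth_on D (fun x => (f x)^-1).
Proof. by move=> oD f0 /smooth_onP sf; apply/smooth_onP => m; exact: CmV. Qed.

Lemma smooth_sqrt D f : open D -> (forall x, D x -> 0 < f x) ->
  smooth_on D f -> smooth_on D (fun x => Num.sqrt (f x)).
Proof. by move=> oD f0 /smooth_onP sf; apply/smooth_onP => m; exact: Cm_sqrt. Qed.

Lemma smoothN D f : open D -> smooth_on D f -> smooth_on D (fun x => - f x).
Proof.
move=> oD sf; apply: (smooth_eq oD (f := fun x => (-1) * f x)).
  by move=> x _; rewrite mulN1r.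
exact: (smoothM oD (smooth_cst (-1) oD) sf).
Qed.

Lemma smooth_sum D (I : Type) (r : seq I) (P : pred I) (f : I -> 'rV[R]_k -> R) :
  open D -> (forall i, smooth_on D (f i)) ->
  smooth_on D (fun x => \sum_(i <- r | P i) f i x).
Proof.
move=> oD sf; elim: r => [|i r IH].
  by under eq_fun do rewrite big_nil; exact: (smooth_cst _ oD).
case Pi: (P i); under eq_fun do rewrite big_cons Pi.
  exact: (smoothD oD (sf i) IH).
exact: IH.
Qed.

Lemma smooth_prod D (I : Type) (r : seq I) (P : pred I) (f : I -> 'rV[R]_k -> R) :
  open D -> (forall i, smooth_on D (f i)) ->
  smooth_on D (fun x => \prod_(i <- r | P i) f i x).
Proof.
move=> oD sf; elim: r => [|i r IH].
  by under eq_fun do rewrite big_nil; exact: (smooth_cst _ oD).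
case Pi: (P i); under eq_fun do rewrite big_cons Pi.
  exact: (smoothM oD (sf i) IH).
exact: IH.
Qed.

Lemma partialD D f g j x : smooth_on D f -> smooth_on D g -> D x ->
  partial j (fun x => f x + g x) x = partial j f x + partial j g x.
Proof.
move=> sf sg Dx; apply: has_deriv1.
by apply: has_derivD; [exact: along_deriv0 sf Dx|exact: along_deriv0 sg Dx].
Qed.

Lemma partialZ D f c j x : smooth_on D f -> D x ->
  partial j (fun x => c * f x) x = c * partial j f x.
Proof. by move=> sf Dx; apply: has_deriv1; apply: has_derivZ; exact: along_deriv0 sf Dx. Qed.

Lemma partial_eq D f g j x : open D -> (forall x, D x -> f x = g x) -> D x ->
  partial j f x = partial j g x.
Proof.
move=> oD fg Dx; apply: (partial_near j _).1.
by apply: filterS (open_nbhs_nbhs (conj oD Dx)) => y /fg.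
Qed.

Lemma partials_eq D f g s x : open D -> (forall x, D x -> f x = g x) -> D x ->
  partials s f x = partials s g x.
Proof.
move=> oD fg; elim: s x => [|j s IH] x Dx /=; first exact: fg.
exact: (partial_eq j oD IH Dx).
Qed.

Lemma partialsD D f g s x : open D -> smooth_on D f -> smooth_on D g -> D x ->
  partials s (fun x => f x + g x) x = partials s f x + partials s g x.
Proof.
move=> oD sf sg; elim: s x => [//|j s IH] x Dx /=.
rewrite (partial_eq j oD IH Dx); exact: (partialD j (smooth_partials s sf) (smooth_partials s sg) Dx).
Qed.

Lemma partialsZ D f c s x : open D -> smooth_on D f -> D x ->
  partials s (fun x => c * f x) x = c * partials s f x.
Proof.
move=> oD sf; elim: s x => [//|j s IH] x Dx /=.
rewrite (partial_eq j oD IH Dx); exact: (partialZ c j (smooth_partials s sf) Dx).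
Qed.

Lemma smooth_coord D j : open D -> smooth_on D (fun x : 'rV[R]_k => x 0 j).
Proof.
move=> oD; apply/smooth_onP => -[|m].
  by split=> // x _; exact: coord_continuous.
apply: Cm_step => // [x _|l]; first exact: coord_continuous.
exists (fun=> (l == j)%:R); last exact: Cm_cst.
move=> x _; have -> : along (fun x : 'rV[R]_k => x 0 j) x l =
    (fun t => x 0 j + t * (l == j)%:R).
  by apply/funext => t; rewrite /along !mxE eqxx eq_sym.
rewrite -[X in has_deriv _ _ X]add0r; apply: has_derivD; first exact: has_deriv_cst.
rewrite -[X in has_deriv _ _ X]mulr1; apply: (@has_deriv_scale _ id).
exact: has_deriv_id.
Qed.

(** The second difference over a square of side h is symmetric in i and j, so
    the estimates for (i, j) and (j, i) identify the two mixed derivatives. The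
    mean value theorem is applied in direction i and then in direction j. *)
Lemma second_difference D f (x : 'rV[R]_k) i j e : open D -> smooth_on D f ->
  D x -> 0 < e ->
  \forall h \near (0 : R), let d l := h *: delta_mx 0 l : 'rV[R]_k in
    `|f (x + d i + d j) - f (x + d i) - f (x + d j) + f x
      - partial j (partial i f) x * h * h| <= e * `|h| * `|h|.
Proof.
move=> oD sf Dx e0.
pose sq (z : R * R) := x + z.1 *: (delta_mx 0 i : 'rV[R]_k) + z.2 *: delta_mx 0 j.
have csq : sq z @[z --> ((0, 0) : R * R)] --> x.
  rewrite -[X in _ --> X](_ : sq (0, 0) = x); last first.
    by rewrite /sq /= !scale0r !addr0.
  apply: line_cvg; first exact: cvg_snd.
  by apply: line_cvg; [exact: cvg_fst|exact: cvg_cst].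
have sij : smooth_on D (partial j (partial i f)).
  by do 2!apply: smooth_partial.
have cij := smooth_cont sij Dx.
have H : \forall z \near ((0, 0) : R * R), D (sq z) /\
    `|partial j (partial i f) x - partial j (partial i f) (sq z)| <= e.
  have Hn : \forall y \near x, D y /\
      `|partial j (partial i f) x - partial j (partial i f) y| <= e.
    apply: filterI; first exact: open_nbhs_nbhs.
    by move/cvgrPdist_le : cij; exact.
  exact: (csq _ Hn).
move: H => /nbhs_ballP[r /= r0 H].
have inr a b : `|a| < r -> `|b| < r -> D (sq (a, b)) /\
    `|partial j (partial i f) x - partial j (partial i f) (sq (a, b))| <= e.
  by move=> ar br; apply: H; split; rewrite /ball /= sub0r normrN.
apply: filterS (near0_norm_lt r0) => h hr /=.
have [|c ch Ec] := @mvt0 R (fun t => f (sq (t, h)) - f (sq (t, 0)))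
    (fun t => partial i f (sq (t, h)) - partial i f (sq (t, 0))) h.
  move=> t th; have tr : `|t| < r by apply: le_lt_trans hr.
  have E b : (fun t => f (sq (t, b))) = along f (x + b *: delta_mx 0 j) i.
    by apply/funext => s; rewrite /sq /along /= addrAC.
  apply: has_derivB; rewrite E.
    have -> : sq (t, h) = x + h *: delta_mx 0 j + t *: delta_mx 0 i by rewrite /sq addrAC.
    by apply: (along_deriv sf); rewrite addrAC; exact: (inr t h tr hr).1.
  have -> : sq (t, 0) = x + 0 *: delta_mx 0 j + t *: delta_mx 0 i by rewrite /sq addrAC.
  by apply: (along_deriv sf); rewrite addrAC; apply: (inr t 0 tr _).1; rewrite normr0.
have [|b bh Eb] := @mvt0 R (fun s => partial i f (sq (c, s)))
    (fun s => partial j (partial i f) (sq (c, s))) h.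
  move=> s sh.
  have -> : (fun s => partial i f (sq (c, s))) =
      along (partial i f) (x + c *: delta_mx 0 i) j by [].
  apply: (along_deriv (smooth_partial i sf)).
  by apply: (inr c s _ _).1; apply: le_lt_trans hr.
have -> : f (x + h *: delta_mx 0 i + h *: delta_mx 0 j) - f (x + h *: delta_mx 0 i)
    - f (x + h *: delta_mx 0 j) + f x =
    f (sq (h, h)) - f (sq (h, 0)) - (f (sq (0, h)) - f (sq (0, 0))).
  by rewrite /sq /= !scale0r !addr0; ring.
rewrite Ec Eb -[X in `|X|]mulrBl -mulrBl !normrM distrC.
by rewrite ler_wpM2r // ler_wpM2r //; apply: (inr c b _ _).2; apply: le_lt_trans hr.
Qed.

Lemma partialC D f (x : 'rV[R]_k) i j : open D -> smooth_on D f -> D x ->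
  partial i (partial j f) x = partial j (partial i f) x.
Proof.
move=> oD sf Dx; apply/eqP; rewrite -subr_eq0 -normr_le0.
apply/ler_addgt0Pl => e e0; rewrite addr0.
have e20 : 0 < e / 2 by rewrite divr_gt0.
have H1 := near_punct (second_difference i j oD sf Dx e20).
have H2 := near_punct (second_difference j i oD sf Dx e20).
have [h [[/= h1 h2] h0']] := punct_ex (punctI (punctI H1 H2) (@near_punct_neq0 R)).
have h0 : 0 < `|h| by rewrite normr_gt0.
rewrite -(ler_pM2r h0) -(ler_pM2r h0) -!normrM [in leRHS](splitr e) !mulrDl.
apply: le_trans (lerD h1 h2); apply: le_trans (ler_normB _ _).
rewrite (addrAC x (h *: delta_mx 0 j)) le_eqVlt; apply/orP; left; apply/eqP.
congr `|_|; move: (partial i _ x) (partial j _ x) (f _) (f _) (f _) (f _) => a b c1 c2 c3 c4.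
by ring.
Qed.

Lemma partialsC D f s j (x : 'rV[R]_k) : open D -> smooth_on D f -> D x ->
  partials s (partial j f) x = partial j (partials s f) x.
Proof.
move=> oD sf; elim: s x => [//|i s IH] x Dx /=.
rewrite (partial_eq i oD IH Dx).
exact: (partialC i j oD (smooth_partials s sf) Dx).
Qed.

End Cm.

(** Substitutions whose chain rule involves partial derivatives only: each
    coordinate line goes to a coordinate line or to a point. The speed c is
    constant on the line but may depend on the line, as for (t, x) |-> t x. *)
Definition line_map (k m : nat) (D : set 'rV[R]_k) (L : 'rV[R]_k -> 'rV[R]_m) : Prop :=
  (forall x, D x -> L y @[y --> x] --> L x) /\
  forall j, (exists l, exists2 c : 'rV[R]_k -> R, smooth_on D c &
      forall x t, L (x + t *: delta_mx 0 j) = L x + (t * c x) *: delta_mx 0 l) \/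
    (forall x t, L (x + t *: delta_mx 0 j) = L x).

Lemma smooth_comp (k m : nat) (D : set 'rV[R]_k) (E : set 'rV[R]_m)
    (L : 'rV[R]_k -> 'rV[R]_m) (f : 'rV[R]_m -> R) :
  open D -> line_map D L -> (forall x, D x -> E (L x)) -> smooth_on E f ->
  smooth_on D (f \o L).
Proof.
move=> oD [cL dL] DE /smooth_onP sf; apply/smooth_onP => d.
elim: d f {sf}(sf d) => [|d IH] f Cf.
  split=> // x Dx; exact: (cvg_comp _ _ (cL _ Dx) (Cm_cont Cf (DE _ Dx))).
apply: Cm_step => // [x Dx|j].
  exact: (cvg_comp _ _ (cL _ Dx) (Cm_cont Cf (DE _ Dx))).
have [[l [c sc Lc]]|Lc] := dL j.
  exists (fun x => c x * partial l f (L x)).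
    move=> x Dx.
    have -> : along (f \o L) x j = (fun t => along f (L x) l (t * c x)).
      by apply/funext => t; rewrite /along /= Lc.
    by apply: has_deriv_scale; exact: (Cm_deriv l Cf (DE _ Dx)).
  apply: CmM => //; first by move/smooth_onP: sc.
  by apply: IH; exact: Cm_partial.
exists (fun=> 0); last exact: Cm_cst.
move=> x Dx; have -> : along (f \o L) x j = fun=> f (L x).
  by apply/funext => t; rewrite /along /= Lc.
exact: has_deriv_cst.
Qed.

End Smoothness.

#[local] Opaque smooth_on.

(** * Coordinate substitutions *)

Section CoordinateMaps.
Variable R : realType.

Section Rows.
Variables k n : nat.
Implicit Types (w : 'rV[R]_(k + n)) (u : 'rV[R]_k) (x : 'rV[R]_n).

Lemma lsub_moveL w t a :
  lsubmx (w + t *: delta_mx 0 (lshift n a)) = lsubmx w + t *: delta_mx 0 a.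
Proof.
by rewrite linearD linearZ; congr (_ + _ *: _); apply/rowP => j;
  rewrite !mxE eq_lshift.
Qed.

Lemma rsub_moveL w t a :
  rsubmx (w + t *: delta_mx 0 (lshift n a)) = rsubmx w.
Proof.
by apply/rowP => j; rewrite !mxE eq_rlshift andbF mulr0 addr0.
Qed.

Lemma lsub_moveR w t a :
  lsubmx (w + t *: delta_mx 0 (rshift k a)) = lsubmx w.
Proof.
by apply/rowP => j; rewrite !mxE eq_lrshift andbF mulr0 addr0.
Qed.

Lemma rsub_moveR w t a :
  rsubmx (w + t *: delta_mx 0 (rshift k a)) = rsubmx w + t *: delta_mx 0 a.
Proof.
by rewrite linearD linearZ; congr (_ + _ *: _); apply/rowP => j;
  rewrite !mxE eq_rshift.
Qed.

Lemma row_moveL u x t a :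
  row_mx (u + t *: delta_mx 0 a) x = row_mx u x + t *: delta_mx 0 (lshift n a).
Proof.
by rewrite -[RHS]hsubmxK lsub_moveL rsub_moveL row_mxKl row_mxKr.
Qed.

Lemma row_moveR u x t a :
  row_mx u (x + t *: delta_mx 0 a) = row_mx u x + t *: delta_mx 0 (rshift k a).
Proof.
by rewrite -[RHS]hsubmxK lsub_moveR rsub_moveR row_mxKl row_mxKr.
Qed.

Lemma lsub_cvg (w : 'rV[R]_(k + n)) : lsubmx z @[z --> w] --> lsubmx w.
Proof.
apply: mx_cvg => i j; rewrite mxE; under eq_fun do rewrite mxE.
exact: coord_continuous.
Qed.

Lemma rsub_cvg (w : 'rV[R]_(k + n)) : rsubmx z @[z --> w] --> rsubmx w.
Proof.
apply: mx_cvg => i j; rewrite mxE; under eq_fun do rewrite mxE.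
exact: coord_continuous.
Qed.

Lemma row_cvg (T : Type) (F : set_system T) (FF : Filter F)
    (f : T -> 'rV[R]_k) (g : T -> 'rV[R]_n) u x :
  f @ F --> u -> g @ F --> x -> row_mx (f t) (g t) @[t --> F] --> row_mx u x.
Proof.
move=> cf cg; apply: mx_cvg => i j; rewrite ord1.
have -> : (fun t => row_mx (f t) (g t) 0 j) =
    (fun t => match fintype.split j with inl a => f t 0 a | inr b => g t 0 b end).
  by apply/funext => t; rewrite mxE.
by rewrite mxE; case: (fintype.split j) => a; apply: mx_coord_cvg.
Qed.

Lemma open_rows (U : set 'rV[R]_k) (V : set 'rV[R]_n) : open U -> open V ->
  open [set w : 'rV[R]_(k + n) | U (lsubmx w) /\ V (rsubmx w)].
Proof.
move=> oU oV; apply: openI; apply: open_comp => // w _.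
  exact: lsub_cvg.
exact: rsub_cvg.
Qed.

End Rows.

(** The special case of unit speed, which covers projections, insertions of
    parameters and their products. *)
Definition coord_map (k m : nat) (L : 'rV[R]_k -> 'rV[R]_m) : Prop :=
  (forall x : 'rV[R]_k, L y @[y --> x] --> L x) /\
  forall j, (exists l, forall x t, L (x + t *: delta_mx 0 j) = L x + t *: delta_mx 0 l) \/
    (forall x t, L (x + t *: delta_mx 0 j) = L x).

Lemma coord_map_line (k m : nat) D (L : 'rV[R]_k -> 'rV[R]_m) :
  open D -> coord_map L -> line_map D L.
Proof.
move=> oD [cL dL]; split=> // j; case: (dL j) => [[l Ll]|Lj]; last by right.
left; exists l, (fun=> 1); first exact: smooth_cst.
by move=> x t; rewrite mulr1.
Qed.

Lemma coord_map_open (k m : nat) (E : set 'rV[R]_m) (L : 'rV[R]_k -> 'rV[R]_m) :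
  open E -> coord_map L -> open (L @^-1` E).
Proof. by move=> oE [cL _]; apply: open_comp => // x _; exact: cL. Qed.

Lemma coord_map_id (k : nat) : coord_map (@id 'rV[R]_k).
Proof. by split=> [x|j]; [exact: cvg_id|left; exists j]. Qed.

Lemma coord_map_lsub (k n : nat) : coord_map (@lsubmx R 1 k n).
Proof.
split=> [x|j]; first exact: lsub_cvg.
rewrite -(splitK j); case: (fintype.split j) => a /=.
  by left; exists a => x t; rewrite lsub_moveL.
by right=> x t; rewrite lsub_moveR.
Qed.

Lemma coord_map_rsub (k n : nat) : coord_map (@rsubmx R 1 k n).
Proof.
split=> [x|j]; first exact: rsub_cvg.
rewrite -(splitK j); case: (fintype.split j) => a /=.
  by right=> x t; rewrite rsub_moveL.
by left; exists a => x t; rewrite rsub_moveR.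
Qed.

Lemma coord_map_row (k n : nat) (u : 'rV[R]_k) :
  coord_map (fun x : 'rV[R]_n => row_mx u x).
Proof.
split=> [x|j]; first by apply: row_cvg; [exact: cvg_cst|exact: cvg_id].
by left; exists (rshift k j) => x t; rewrite row_moveR.
Qed.

Lemma coord_map_prod (k m k' m' : nat) (L : 'rV[R]_k -> 'rV[R]_m)
    (L' : 'rV[R]_k' -> 'rV[R]_m') : coord_map L -> coord_map L' ->
  coord_map (fun w : 'rV[R]_(k + k') => row_mx (L (lsubmx w)) (L' (rsubmx w))).
Proof.
move=> [cL dL] [cL' dL']; split=> [x|j].
  apply: row_cvg; first exact: (cvg_comp _ _ (@lsub_cvg _ _ _) (cL _)).
  exact: (cvg_comp _ _ (@rsub_cvg _ _ _) (cL' _)).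
rewrite -(splitK j); case: (fintype.split j) => a /=.
  case: (dL a) => [[l Ll]|La]; [left; exists (lshift m' l)|right] => x t;
    by rewrite lsub_moveL rsub_moveL ?Ll ?La ?row_moveL.
case: (dL' a) => [[l Ll]|La]; [left; exists (rshift m l)|right] => x t;
  by rewrite lsub_moveR rsub_moveR ?Ll ?La ?row_moveR.
Qed.

Lemma partials_row (k n : nat) (f : 'rV[R]_(k + n) -> R) (u : 'rV[R]_k)
    (s : seq 'I_n) (x : 'rV[R]_n) :
  partials s (fun x => f (row_mx u x)) x =
  partials (map (@rshift k n) s) f (row_mx u x).
Proof.
elim: s x => [//|j s IH] x /=; rewrite /partial; congr (derive1 _ 0).
by apply/funext => t; rewrite /along IH row_moveR.
Qed.

End CoordinateMaps.

(** * Smooth families of tensors and their parameter derivatives *)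

Section Families.
Variables (R : realType) (n : nat) (M : closed_manifold R n).
Implicit Types (g v : tensor M) (i : chart_index M) (p : M).

Lemma tensorP v v' : (forall i p, v i p = v' i p) -> v = v'.
Proof. by move=> E; apply/funext => i; apply/funext => p; rewrite E. Qed.

Lemma img_inv i x : img i x ->
  dom i (chart_inv (atlas i) x) /\ chart_map (atlas i) (chart_inv (atlas i) x) = x.
Proof.
move=> [p dp <-]; rewrite /dom.
by have -> := @chart_invK _ _ _ (atlas i) p (mem_set dp).
Qed.

Lemma dom_img i p : dom i p ->
  img i (chart_map (atlas i) p) /\ chart_inv (atlas i) (chart_map (atlas i) p) = p.
Proof.
by move=> dp; split; [exists p|exact: (@chart_invK _ _ _ (atlas i) p (mem_set dp))].
Qed.

Lemma img_open i : open (img i).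
Proof. exact: chart_img_open. Qed.

(** Smoothness of a family F over U is smoothness of joint F on fdom U. *)
Definition joint (k : nat) (F : 'rV[R]_k -> tensor M) i (j l : 'I_n) :
    'rV[R]_(k + n) -> R :=
  fun w => component (F (lsubmx w)) i j l (rsubmx w).

Definition fdom (k : nat) (U : set 'rV[R]_k) i : set 'rV[R]_(k + n) :=
  [set w | U (lsubmx w) /\ img i (rsubmx w)].

Lemma fdom_open (k : nat) (U : set 'rV[R]_k) i : open U -> open (fdom U i).
Proof. by move=> oU; exact: (open_rows oU (@img_open i)). Qed.

Lemma fdom_row (k : nat) (U : set 'rV[R]_k) i u x : U u -> img i x ->
  fdom U i (row_mx u x).
Proof. by move=> Uu ix; rewrite /fdom /= row_mxKl row_mxKr. Qed.

Lemma family_S2 k (U : set 'rV[R]_k) (F : 'rV[R]_k -> tensor M) u :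
  smooth_family U F -> U u -> S2 (F u).
Proof. by move=> [sF _] /sF. Qed.

Lemma family_smooth k (U : set 'rV[R]_k) (F : 'rV[R]_k -> tensor M) :
  smooth_family U F -> forall i j l, smooth_on (fdom U i) (joint F i j l).
Proof. by move=> [_ sF] i j l; exact: sF. Qed.
Arguments family_smooth {k U F} _ i j l.

Definition pderiv (k : nat) (a : 'I_k) (F : 'rV[R]_k -> tensor M) :
    'rV[R]_k -> tensor M :=
  fun u i p => \matrix_(j, l) partial a (fun u' => F u' i p j l) u.

Lemma joint_pderiv k (a : 'I_k) F i j l :
  joint (pderiv a F) i j l = partial (lshift n a) (joint F i j l).
Proof.
apply/funext => w; rewrite /joint /component mxE /partial; congr (derive1 _ 0).
by apply/funext => t; rewrite /along lsub_moveL rsub_moveL.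
Qed.

Lemma joint_row k (F : 'rV[R]_k -> tensor M) i j l u x :
  joint F i j l (row_mx u x) = component (F u) i j l x.
Proof. by rewrite /joint row_mxKl row_mxKr. Qed.

Lemma family_deriv k (U : set 'rV[R]_k) F (a : 'I_k) u i p j l :
  open U -> smooth_family U F -> U u ->
  has_deriv (fun t => F (u + t *: delta_mx 0 a) i p j l) 0 (pderiv a F u i p j l).
Proof.
move=> oU sF Uu; rewrite mxE; apply: derivable_has_deriv.
have [dp|ndp] := pselect (dom i p); last first.
  apply: has_deriv_derivable; apply: (@has_deriv_near _ (fun=> 0)); last exact: has_deriv_cst.
  have /(along_near a) : \forall y \near u, U y by exact: open_nbhs_nbhs.
  by apply: filterS => t Ut; rewrite (S2_off (family_S2 sF Ut)) // mxE.
have [ix invx] := dom_img dp.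
have := along_deriv0 (lshift n a) (family_smooth sF i j l) (fdom_row Uu ix).
have -> : along (joint F i j l) (row_mx u (chart_map (atlas i) p)) (lshift n a) =
    (fun t => F (u + t *: delta_mx 0 a) i p j l).
  by apply/funext => t; rewrite /along -row_moveL joint_row /component invx.
exact: has_deriv_derivable.
Qed.

(** The conditions on tensors are linear, hence pass to entrywise derivatives. *)
Lemma S2_pderiv k (U : set 'rV[R]_k) F (a : 'I_k) u :
  open U -> smooth_family U F -> U u -> S2 (pderiv a F u).
Proof.
move=> oU sF Uu.
have D i p j l := family_deriv a i p j l oU sF Uu.
have N : \forall t \near (0 : R), U (u + t *: delta_mx 0 a).
  by apply: along_near; exact: open_nbhs_nbhs.
split.
- move=> i p ndp; apply/matrixP => j l; rewrite [RHS]mxE.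
  apply: has_deriv_uniq (D i p j l) _; apply: has_deriv_near (has_deriv_cst 0 0).
  by apply: filterS N => t Ut; rewrite (S2_off (family_S2 sF Ut)) // mxE.
- move=> i p; apply/matrixP => j l; rewrite mxE.
  apply: has_deriv_uniq (D i p l j) _; apply: has_deriv_near (D i p j l).
  by apply: filterS N => t Ut; rewrite -{1}(S2_sym (family_S2 sF Ut)) mxE.
- move=> i i' p dp dp' J; apply/matrixP => j l.
  apply: has_deriv_uniq (D i p j l) _.
  rewrite !mxE; apply: (has_deriv_near (f := fun t =>
     \sum_m (\sum_m' J^T j m' * F (u + t *: delta_mx 0 a) i' p m' m) * J m l)).
    apply: filterS N => t Ut; rewrite (S2_transform (family_S2 sF Ut) dp dp') !mxE.
    by apply: eq_bigr => m _; rewrite !mxE.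
  apply: has_deriv_sum => m; rewrite mulrC; under eq_fun do rewrite mulrC.
  apply: has_derivZ; rewrite mxE; apply: has_deriv_sum => m'.
  exact: has_derivZ.
- move=> i j l.
  have -> : component (pderiv a F u) i j l =
      joint (pderiv a F) i j l \o (fun x => row_mx u x).
    by apply/funext => x /=; rewrite joint_row.
  rewrite joint_pderiv.
  apply: (smooth_comp (E := fdom U i) (@img_open i)).
  + exact: (coord_map_line (@img_open i) (@coord_map_row R k n u)).
  + by move=> x ix; exact: fdom_row.
  + exact: (smooth_partial _ (family_smooth sF i j l)).
Qed.

Lemma smooth_family_pderiv k (U : set 'rV[R]_k) F (a : 'I_k) :
  open U -> smooth_family U F -> smooth_family U (pderiv a F).
Proof.
move=> oU sF; split=> [u Uu|i j l]; first exact: S2_pderiv sF Uu.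
have := smooth_partial (lshift n a) (family_smooth sF i j l).
by rewrite -joint_pderiv.
Qed.

(** A difference quotient in a parameter equals, by the mean value theorem, a
    value of the parameter derivative, which is uniformly continuous on compact
    sets of points. *)
Lemma quotient_unif k (U : set 'rV[R]_k) i (f : 'rV[R]_(k + n) -> R) (a : 'I_k) u
    (K : set 'rV[R]_n) : open U -> smooth_on (fdom U i) f -> U u ->
  compact K -> K `<=` img i ->
  forall e, 0 < e -> \forall t \near 0^', forall x, K x ->
    `|t^-1 * (f (row_mx (u + t *: delta_mx 0 a) x) - f (row_mx u x))
      - partial (lshift n a) f (row_mx u x)| <= e.
Proof.
move=> oU sf Uu cK Kimg e e0; pose la := lshift n a.
have spf := smooth_partial la sf.
pose h (t : R) (x : 'rV[R]_n) := partial la f (row_mx (u + t *: delta_mx 0 a) x).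
have ch x : K x -> (fun z : R * 'rV[R]_n => h z.1 z.2) @ ((0 : R), x) --> h 0 x.
  move=> Kx; have Dx : fdom U i (row_mx (u + (0 : R) *: delta_mx 0 a) x).
    by apply: fdom_row; [rewrite scale0r addr0|exact: Kimg].
  apply: (cvg_comp (fun z : R * 'rV[R]_n => row_mx (u + z.1 *: delta_mx 0 a) z.2) _ _
     (smooth_cont spf Dx)).
  apply: row_cvg; last exact: cvg_snd.
  by apply: line_cvg; [exact: cvg_fst|exact: cvg_cst].
have N : \forall t \near (0 : R), U (u + t *: delta_mx 0 a).
  by apply: along_near; exact: open_nbhs_nbhs.
move: N => /nbhs_ballP[r0 /= r00 Hr0].
have /nbhs_ballP[r1 /= r10 Hr1] := unif_near cK ch e0.
have r_gt0 : 0 < Num.min r0 r1 by rewrite lt_min r00.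
have H := punctI (near_punct (near0_norm_lt r_gt0)) (@near_punct_neq0 R).
apply: filterS H => t [/=]; rewrite lt_min => /andP[tr0 tr1] t0 x Kx.
have Ur (b : R) : `|b| <= `|t| -> U (u + b *: delta_mx 0 a).
  by move=> bt; apply: Hr0; rewrite /ball /= sub0r normrN; apply: le_lt_trans tr0.
have [|b bt Eb] := @mvt0 R (fun b => f (row_mx (u + b *: delta_mx 0 a) x)) (h^~ x) t.
  move=> b bt.
  have -> : (fun b => f (row_mx (u + b *: delta_mx 0 a) x)) = along f (row_mx u x) la.
    by apply/funext => b'; rewrite /along row_moveL.
  rewrite /h row_moveL; apply: (along_deriv sf); rewrite -row_moveL.
  by apply: fdom_row; [exact: Ur|exact: Kimg].
move: Eb; rewrite scale0r addr0 => ->; rewrite mulrC mulfK //.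
have := Hr1 b _ x Kx; rewrite /h scale0r addr0; apply.
by rewrite /ball /= sub0r normrN; apply: le_lt_trans tr1.
Qed.

(** Coordinate derivatives commute with parameter derivatives, so a coordinate
    derivative of a difference quotient is a difference quotient of a smooth
    function, and converges uniformly on compact sets. *)
Lemma cvg_S2_pderiv k (U : set 'rV[R]_k) F (a : 'I_k) u :
  open U -> smooth_family U F -> U u ->
  cvg_S2 (fun e => e^-1 *: (F (u + e *: delta_mx 0 a) - F u)) (pderiv a F u).
Proof.
move=> oU sF Uu i K cK Kimg s j l e e0.
pose f := joint F i j l; pose la := lshift n a; pose S := map (@rshift k n) s.
have sf : smooth_on (fdom U i) f := family_smooth sF i j l.
have oD : open (fdom U i) by exact: fdom_open.
have N : \forall t \near (0 : R), U (u + t *: delta_mx 0 a).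
  by apply: along_near; exact: open_nbhs_nbhs.
have Q := quotient_unif a oU (smooth_partials S sf) Uu cK Kimg e0.
apply: filterS (punctI (near_punct N) Q) => t [Ut Qt] x Kx.
have ix := Kimg x Kx; have oi := @img_open i.
have scf (v : 'rV[R]_k) : U v -> smooth_on (img i) (fun x => f (row_mx v x)).
  move=> Uv; apply: (smooth_comp (E := fdom U i) oi) sf.
    exact: (coord_map_line oi (@coord_map_row R k n _)).
  by move=> y iy; apply: fdom_row.
have spd : smooth_on (img i) (fun x => partial la f (row_mx u x)).
  apply: (smooth_comp (E := fdom U i) oi) (smooth_partial la sf).
    exact: (coord_map_line oi (@coord_map_row R k n _)).
  by move=> y iy; apply: fdom_row.
have E y : img i y -> component (t^-1 *: (F (u + t *: delta_mx 0 a) - F u) - pderiv a F u) i j l y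
    = t^-1 * (f (row_mx (u + t *: delta_mx 0 a) y) + (-1) * f (row_mx u y))
      + (-1) * partial la f (row_mx u y).
  move=> iy; rewrite /f !joint_row -joint_pderiv joint_row.
  by rewrite !mulN1r /component !mxE.
rewrite (partials_eq s oi E ix).
have sm1 := smoothM oi (smooth_cst (-1) oi) (scf u Uu).
have s12 := smoothD oi (scf _ Ut) sm1.
have sm2 := smoothM oi (smooth_cst (-1) oi) spd.
rewrite (partialsD s oi (smoothM oi (smooth_cst t^-1 oi) s12) sm2 ix).
rewrite (partialsZ _ s oi s12 ix) (partialsZ _ s oi spd ix).
rewrite (partialsD s oi (scf _ Ut) sm1 ix) (partialsZ _ s oi (scf u Uu) ix).
rewrite !partials_row -/S (partialsC S la oD sf (fdom_row Uu ix)) !mulN1r.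
exact: Qt.
Qed.

(** Compact sets with one point separate tensors. *)
Lemma cvg_S2_uniq (F : R -> tensor M) v v' :
  S2 v -> S2 v' -> cvg_S2 F v -> cvg_S2 F v' -> v = v'.
Proof.
move=> Sv Sv' cv cv'; apply: tensorP => i p.
have [dp|ndp] := pselect (dom i p); last by rewrite (S2_off Sv) // (S2_off Sv').
have [ix invx] := dom_img dp.
have cK : compact [set chart_map (atlas i) p] by exact: compact_set1.
have Ki : [set chart_map (atlas i) p] `<=` img i by move=> x ->.
apply/matrixP => j l; apply/eqP; rewrite -subr_eq0 -normr_le0.
apply/ler_addgt0Pl => e e0; rewrite addr0.
have e20 : 0 < e / 2 by rewrite divr_gt0.
have H1 := cv i _ cK Ki [::] j l _ e20.
have H2 := cv' i _ cK Ki [::] j l _ e20.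
have [t [h1 h2]] := punct_ex (punctI H1 H2).
move: (h1 _ erefl) (h2 _ erefl) => {h1 h2} /= h1 h2; move: h1 h2; rewrite /component /= invx => h1 h2.
rewrite (splitr e); apply: le_trans (lerD h2 h1); apply: le_trans (ler_normB _ _).
by rewrite !mxE le_eqVlt; apply/orP; left; apply/eqP; congr `|_|; ring.
Qed.

Lemma curve_derivP (G : R -> tensor M) t v : S2 v ->
  cvg_S2 (fun e => e^-1 *: (G (t + e) - G t)) v -> curve_deriv G t = v.
Proof.
move=> Sv cv; rewrite /curve_deriv; case: xgetP => [w _ [Sw cw]|/(_ v)].
  exact: cvg_S2_uniq cw cv.
by case.
Qed.

Lemma cvg_S2_near (F F' : R -> tensor M) v :
  (\forall t \near 0^', F t = F' t) -> cvg_S2 F v -> cvg_S2 F' v.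
Proof.
move=> FF' cF i K cK Ki s j l e e0.
by apply: filterS2 FF' (cF i K cK Ki s j l e e0) => t ->.
Qed.

Lemma S2_curve_deriv (G : R -> tensor M) t : S2 (0 : tensor M) -> S2 (curve_deriv G t).
Proof.
by move=> S0; rewrite /curve_deriv; case: xgetP => // w _ [].
Qed.

Lemma curve_deriv_family k (U : set 'rV[R]_k) F (a : 'I_k) u (G : R -> tensor M) t0 :
  open U -> smooth_family U F -> U u ->
  (\forall t \near (0 : R), G (t0 + t) = F (u + t *: delta_mx 0 a)) ->
  curve_deriv G t0 = pderiv a F u.
Proof.
move=> oU sF Uu GF; apply: curve_derivP; first exact: S2_pderiv sF Uu.
apply: cvg_S2_near (cvg_S2_pderiv a oU sF Uu).
have G0 : G t0 = F u by have := nbhs_singleton GF; rewrite scale0r !addr0.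
by apply: filterS (near_punct GF) => t ->; rewrite G0.
Qed.

End Families.

Arguments family_smooth {R n M k U F} _ i j l.
Arguments fdom_open {R n M k U} i _.
Arguments img_open {R n M} i.

(** * Positive definite matrices *)

Section PositiveDefinite.
Variable R : realType.

Definition posdef (n : nat) (A : 'M[R]_n) : Prop :=
  A^T = A /\ forall w : 'cV[R]_n, w != 0 -> 0 < (w^T *m A *m w) 0 0.

Lemma mx11_tr (A : 'M[R]_1) : A^T = A.
Proof. by rewrite (mx11_scalar A) tr_scalar_mx. Qed.

(** Cholesky decomposition, by induction on the Schur complement. *)
Lemma cholesky (n : nat) (A : 'M[R]_n) : posdef A ->
  exists2 L : 'M[R]_n, L \in unitmx & A = L *m L^T.
Proof.
elim: n A => [|n IH] A [sA pA].
  by exists 1%:M; [exact: unitmx1|rewrite [LHS]flatmx0 [RHS]flatmx0].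
rewrite -[n.+1]/(1 + n)%N in A sA pA *.
pose a := A 0 0; pose b := dlsubmx A : 'cV[R]_n; pose B := drsubmx A : 'M[R]_n.
have EA : A = block_mx a%:M b^T b B.
  rewrite -[LHS]submxK; congr block_mx.
    by rewrite [LHS]mx11_scalar /a !mxE; congr (A _ _)%:M; apply/val_inj.
  by rewrite /b trmx_dlsub sA.
have sB : B^T = B by rewrite /B trmx_drsub sA.
have a0 : 0 < a.
  have := pA (delta_mx 0 0); rewrite trmx_delta -rowE -colE !mxE; apply.
  by apply/eqP => /matrixP /(_ 0 0) /eqP; rewrite !mxE /= oner_eq0.
have a1 : a != 0 by rewrite gt_eqF.
pose D := B - a^-1 *: (b *m b^T).
have [|L uL EL] := IH D.
  split; first by rewrite /D linearB linearZ /= trmx_mul trmxK sB.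
  move=> w w0; pose r : 'M[R]_1 := w^T *m b; pose c := (- a^-1) *: r.
  have bw : b^T *m w = r by rewrite -[LHS]mx11_tr trmx_mul trmxK.
  have v0 : col_mx c w != 0.
    by apply: contra w0 => /eqP /(congr1 dsubmx); rewrite col_mxKd linear0 => ->.
  have := pA _ v0; rewrite EA tr_col_mx mul_row_block mul_row_col (mx11_tr c).
  have -> : c *m a%:M + w^T *m b = 0.
    by rewrite mul_mx_scalar scalerA mulrN mulfV // scaleN1r addrC subrr.
  rewrite mul0mx add0r mulmxDl -mulmxA bw -scalemxAl scaleNr addrC.
  have E : w^T *m (b *m b^T) *m w = r *m r by rewrite mulmxA -mulmxA bw.
  by rewrite /D mulmxBr mulmxBl -scalemxAr -scalemxAl E.
pose s := Num.sqrt a.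
have s2 : s * s = a by rewrite -expr2 sqr_sqrtr // ltW.
have s0 : s != 0 by rewrite gt_eqF // sqrtr_gt0.
exists (block_mx s%:M 0 (s^-1 *: b) L).
  by rewrite unitmxE det_lblock det_scalar expr1 unitrM -unitmxE uL unitfE s0.
rewrite EA tr_block_mx mulmx_block !trmx0 !mul0mx !mulmx0 !addr0.
rewrite tr_scalar_mx -scalar_mxM s2 linearZ /= mul_scalar_mx scalerA mulfV // scale1r.
rewrite -scalemxAl mul_mx_scalar scalerA mulVf // scale1r; congr block_mx.
by rewrite -EL /D -scalemxAr -scalemxAl scalerA -invfM s2 addrC subrK.
Qed.

Lemma posdef_det (n : nat) (A : 'M[R]_n) : posdef A -> 0 < \det A.
Proof.
move=> /cholesky[L uL ->]; rewrite det_mulmx det_tr -expr2 lt_def sqr_ge0 andbT.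
by rewrite expf_eq0 /= -unitfE -unitmxE.
Qed.

Lemma posdef_unit (n : nat) (A : 'M[R]_n) : posdef A -> A \in unitmx.
Proof. by move=> /posdef_det d0; rewrite unitmxE unitfE gt_eqF. Qed.

Lemma posdef_congr (n : nat) (A J : 'M[R]_n) : J \in unitmx -> posdef A ->
  posdef (J^T *m A *m J).
Proof.
move=> uJ [sA pA]; split; first by rewrite !trmx_mul trmxK sA mulmxA.
move=> w w0; have := pA (J *m w); rewrite trmx_mul !mulmxA; apply.
by apply: contra w0 => /eqP /(congr1 (mulmx (invmx J))); rewrite mulKmx // mulmx0 => ->.
Qed.

Lemma tr_sqr_ge0 (n : nat) (Y : 'M[R]_n) : 0 <= \tr (Y *m Y^T) ?= iff (Y == 0).
Proof.
have E : \tr (Y *m Y^T) = \sum_i \sum_j Y i j ^+ 2.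
  by apply: eq_bigr => i _; rewrite mxE; apply: eq_bigr => j _; rewrite mxE expr2.
rewrite E; split; first by apply: sumr_ge0 => i _; apply: sumr_ge0 => j _; exact: sqr_ge0.
apply/eqP/eqP => [/esym H|->]; last first.
  by rewrite big1 // => i _; rewrite big1 // => j _; rewrite mxE expr0n.
apply/matrixP => i j; rewrite mxE; apply/eqP; rewrite -sqrf_eq0.
have /psumr_eq0P Hi : forall i : 'I_n, true -> 0 <= \sum_j Y i j ^+ 2.
  by move=> i' _; apply: sumr_ge0 => j' _; exact: sqr_ge0.
have /psumr_eq0P Hj : forall j' : 'I_n, true -> 0 <= Y i j' ^+ 2 by move=> *; exact: sqr_ge0.
by rewrite Hj // Hi.
Qed.

(** Pairing of symmetric forms by a positive definite A is positive definite:
    in a basis that is orthonormal for A it is the sum of squared entries. *)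
Lemma posdef_tr (n : nat) (A X : 'M[R]_n) : posdef A -> X^T = X ->
  0 <= \tr (invmx A *m X *m (invmx A *m X)) ?= iff (X == 0).
Proof.
move=> /cholesky[L uL ->] sX.
pose Y := invmx L *m X *m invmx L^T.
have uLT : L^T \in unitmx by rewrite unitmx_tr.
have sY : Y^T = Y by rewrite /Y !trmx_mul sX !trmx_inv trmxK mulmxA.
have -> : \tr (invmx (L *m L^T) *m X *m (invmx (L *m L^T) *m X)) = \tr (Y *m Y^T).
  have -> : invmx (L *m L^T) = invmx L^T *m invmx L.
    have uLL : L *m L^T \in unitmx by rewrite unitmx_mul uL.
    apply: (can_inj (mulKmx uLL)); rewrite mulmxV // mulmxA -(mulmxA L).
    by rewrite mulmxV // mulmx1 mulmxV.
  by rewrite sY /Y -!mulmxA mxtrace_mulC !mulmxA.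
rewrite (_ : (X == 0) = (Y == 0)); first exact: tr_sqr_ge0.
apply/eqP/eqP => [X0|Y0]; first by rewrite /Y X0 mulmx0 mul0mx.
have -> : X = L *m Y *m L^T by rewrite /Y !mulmxA mulmxV // mul1mx -mulmxA mulVmx // mulmx1.
by rewrite Y0 mulmx0 mul0mx.
Qed.

(** The perturbation contributes at most n / (n + 1) times the square of the
    Euclidean length of z. *)
Lemma near_id_posdef (n : nat) (E : 'M[R]_n) :
  (forall i j, `|E i j| <= n.+1%:R^-1) ->
  forall z : 'cV[R]_n, z != 0 -> 0 < (z^T *m (1%:M + E) *m z) 0 0.
Proof.
move=> Es z z0; set d := n.+1%:R^-1 in Es.
pose S := \sum_i z i 0 ^+ 2.
have S0 : 0 < S.
  have S0 : 0 <= S by apply: sumr_ge0 => i _; exact: sqr_ge0.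
  rewrite lt_def S0 andbT; apply: contra z0 => /eqP H; apply/eqP/colP => i.
  have /psumr_eq0P Hi : forall i : 'I_n, true -> 0 <= z i 0 ^+ 2 by move=> *; exact: sqr_ge0.
  by rewrite mxE; apply/eqP; rewrite -sqrf_eq0 Hi.
rewrite mulmxDr mulmx1 mulmxDl mxE.
have -> : (z^T *m z) 0 0 = S by rewrite mxE; apply: eq_bigr => i _; rewrite mxE expr2.
have B : `|(z^T *m E *m z) 0 0| <= d * (n%:R * S).
  have -> : (z^T *m E *m z) 0 0 = \sum_j \sum_i z i 0 * E i j * z j 0.
    rewrite mxE; apply: eq_bigr => j _; rewrite mxE mulr_suml.
    by apply: eq_bigr => i _; rewrite mxE.
  have -> : d * (n%:R * S) = \sum_(j < n) \sum_(i < n) d * ((z i 0 ^+ 2 + z j 0 ^+ 2) / 2).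
    under eq_bigr do rewrite -mulr_sumr.
    rewrite -mulr_sumr; congr (d * _).
    under eq_bigr do rewrite -mulr_suml big_split /=.
    rewrite -mulr_suml big_split /= sumr_const card_ord.
    under [X in _ + X]eq_bigr do rewrite sumr_const card_ord.
    by rewrite sumrMnl -/S -mulr_natl; field.
  apply: le_trans (ler_norm_sum _ _ _) _; apply: ler_sum => j _.
  apply: le_trans (ler_norm_sum _ _ _) _; apply: ler_sum => i _.
  rewrite !normrM mulrAC mulrC; apply: ler_pM => //.
  rewrite -[z i 0 ^+ 2]real_normK ?num_real // -[z j 0 ^+ 2]real_normK ?num_real //.
  by have := sqr_ge0 (`|z i 0| - `|z j 0|); nra.
have : d * (n%:R * S) < S.
  rewrite mulrA gtr_pMl // /d mulrC ltr_pdivrMr ?ltr0n // mul1r ltr_nat.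
  exact: ltnSn.
by have := ler_norm (- (z^T *m E *m z) 0 0); rewrite normrN; lra.
Qed.

Lemma cvg_fsum (T : Type) (F : set_system T) (FF : Filter F) (I : Type)
    (r : seq I) (f : I -> T -> R) (l : I -> R) :
  (forall i, f i t @[t --> F] --> l i) ->
  (\sum_(i <- r) f i t) @[t --> F] --> \sum_(i <- r) l i.
Proof.
move=> cf; elim: r => [|i r IH].
  by rewrite big_nil; under eq_fun do rewrite big_nil; exact: cvg_cst.
by rewrite big_cons; under eq_fun do rewrite big_cons; exact: cvgD.
Qed.

Lemma mulmx_cvg (T : Type) (F : set_system T) (FF : Filter F) (m n d : nat)
    (A : T -> 'M[R]_(m, n)) (B : T -> 'M[R]_(n, d))
    (A0 : 'M[R]_(m, n)) (B0 : 'M[R]_(n, d)) :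
  A t @[t --> F] --> A0 -> B t @[t --> F] --> B0 ->
  A t *m B t @[t --> F] --> A0 *m B0.
Proof.
move=> cA cB; apply: mx_cvg => i j; rewrite mxE; under eq_fun do rewrite mxE.
by apply: cvg_fsum => l; apply: cvgM; exact: mx_coord_cvg.
Qed.

(** A Cholesky factor of the limit reduces to perturbations of the identity. *)
Lemma posdef_near (T : Type) (F : set_system T) (FF : Filter F) (n : nat)
    (A : T -> 'M[R]_n) (A0 : 'M[R]_n) :
  A t @[t --> F] --> A0 -> posdef A0 -> (\forall t \near F, (A t)^T = A t) ->
  \forall t \near F, posdef (A t).
Proof.
move=> cA pA0 sA; have [L uL EL] := cholesky pA0.
have uLT : L^T \in unitmx by rewrite unitmx_tr.
pose E t := invmx L *m (A t - A0) *m invmx L^T.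
have cE : E t @[t --> F] --> (0 : 'M[R]_n).
  have -> : 0 = invmx L *m (A0 - A0) *m invmx L^T by rewrite subrr mulmx0 mul0mx.
  apply: mulmx_cvg; last exact: cvg_cst.
  apply: mulmx_cvg; first exact: cvg_cst.
  apply: mx_cvg => i j; rewrite !mxE; under eq_fun do rewrite !mxE.
  by apply: cvgB; [exact: mx_coord_cvg|exact: cvg_cst].
have nE : \forall t \near F, forall i j, `|E t i j| <= n.+1%:R^-1.
  apply: filter_forall => i; apply: filter_forall => j.
  have d0 : 0 < n.+1%:R^-1 :> R by rewrite invr_gt0 ltr0n.
  have := @mx_coord_cvg _ _ _ _ _ FF _ _ i j cE; rewrite mxE => /cvgrPdist_le /(_ _ d0).
  by apply: filterS => t; rewrite sub0r normrN.
apply: filterS2 sA nE => t st Et; split=> // w w0.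
have z0 : L^T *m w != 0.
  by apply: contra w0 => /eqP /(congr1 (mulmx (invmx L^T))); rewrite mulKmx // mulmx0 => ->.
have := near_id_posdef Et z0.
have -> : A t = L *m (1%:M + E t) *m L^T.
  rewrite mulmxDr mulmx1 mulmxDl -EL /E !mulmxA mulmxV // mul1mx -mulmxA mulVmx //.
  by rewrite mulmx1 addrC subrK.
by rewrite trmx_mul trmxK !mulmxA.
Qed.

End PositiveDefinite.

(** * Differentiable and smooth families of matrices *)

Section MatrixCurves.
Variable R : realType.

(** Entry by entry, because matrices of size zero carry no norm. *)
Definition mx_deriv (m n : nat) (A : R -> 'M[R]_(m, n)) (t : R) (A' : 'M[R]_(m, n)) :=
  forall i j, has_deriv (fun s => A s i j) t (A' i j).

Section Rules.
Variable t : R.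

Lemma mx_deriv_near (m n : nat) (A B : R -> 'M[R]_(m, n)) A' :
  (\forall s \near t, A s = B s) -> mx_deriv A t A' -> mx_deriv B t A'.
Proof. by move=> AB dA i j; apply: has_deriv_near (dA i j); apply: filterS AB => s ->. Qed.

Lemma mx_deriv_uniq (m n : nat) (A : R -> 'M[R]_(m, n)) A' A'' :
  mx_deriv A t A' -> mx_deriv A t A'' -> A' = A''.
Proof. by move=> d1 d2; apply/matrixP => i j; exact: has_deriv_uniq (d1 i j) (d2 i j). Qed.

Lemma mx_deriv_cst (m n : nat) (A : 'M[R]_(m, n)) : mx_deriv (fun=> A) t 0.
Proof. by move=> i j; rewrite mxE; exact: has_deriv_cst. Qed.

Lemma mx_derivD (m n : nat) (A B : R -> 'M[R]_(m, n)) A' B' :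
  mx_deriv A t A' -> mx_deriv B t B' -> mx_deriv (fun s => A s + B s) t (A' + B').
Proof.
by move=> dA dB i j; rewrite mxE; under eq_fun do rewrite mxE; exact: has_derivD.
Qed.

Lemma mx_derivB (m n : nat) (A B : R -> 'M[R]_(m, n)) A' B' :
  mx_deriv A t A' -> mx_deriv B t B' -> mx_deriv (fun s => A s - B s) t (A' - B').
Proof.
by move=> dA dB i j; rewrite !mxE; under eq_fun do rewrite !mxE; exact: has_derivB.
Qed.

Lemma mx_derivZ (m n : nat) (f : R -> R) f' (A : R -> 'M[R]_(m, n)) A' :
  has_deriv f t f' -> mx_deriv A t A' ->
  mx_deriv (fun s => f s *: A s) t (f' *: A t + f t *: A').
Proof.
by move=> df dA i j; rewrite !mxE; under eq_fun do rewrite !mxE; exact: has_derivM.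
Qed.

Lemma mx_derivM (m n d : nat) (A : R -> 'M[R]_(m, n)) (B : R -> 'M[R]_(n, d)) A' B' :
  mx_deriv A t A' -> mx_deriv B t B' ->
  mx_deriv (fun s => A s *m B s) t (A' *m B t + A t *m B').
Proof.
move=> dA dB i j; rewrite !mxE -big_split /=; under eq_fun do rewrite !mxE.
by apply: has_deriv_sum => l; apply: has_derivM.
Qed.

Lemma mx_derivMl (m n d : nat) (A : 'M[R]_(m, n)) (B : R -> 'M[R]_(n, d)) B' :
  mx_deriv B t B' -> mx_deriv (fun s => A *m B s) t (A *m B').
Proof. by move=> dB; have := mx_derivM (mx_deriv_cst A) dB; rewrite mul0mx add0r. Qed.

Lemma mx_derivMr (m n d : nat) (A : R -> 'M[R]_(m, n)) (B : 'M[R]_(n, d)) A' :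
  mx_deriv A t A' -> mx_deriv (fun s => A s *m B) t (A' *m B).
Proof. by move=> dA; have := mx_derivM dA (mx_deriv_cst B); rewrite mulmx0 addr0. Qed.

Lemma mx_deriv_tr (n : nat) (A : R -> 'M[R]_n) A' :
  mx_deriv A t A' -> has_deriv (fun s => \tr (A s)) t (\tr A').
Proof. by move=> dA; apply: has_deriv_sum => i; exact: dA. Qed.

Lemma has_deriv_prod (I : eqType) (r : seq I) (f : I -> R -> R) (d : I -> R) :
  uniq r -> (forall i, has_deriv (f i) t (d i)) ->
  has_deriv (fun s => \prod_(i <- r) f i s) t
    (\sum_(i <- r) d i * \prod_(j <- r | j != i) f j t).
Proof.
move=> + df; elim: r => [|i r IH] /=.
  by move=> _; rewrite big_nil; under eq_fun do rewrite big_nil; exact: has_deriv_cst.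
move=> /andP[ir ur]; under eq_fun do rewrite big_cons.
rewrite big_cons big_cons eqxx /=.
have -> : \prod_(j <- r | j != i) f j t = \prod_(j <- r) f j t.
  rewrite big_mkcond big_seq [RHS]big_seq; apply: eq_bigr => j jr.
  by case: eqP => // E; move: ir; rewrite -E jr.
have -> : \sum_(j <- r) d j * \prod_(l <- i :: r | l != j) f l t =
    f i t * \sum_(j <- r) d j * \prod_(l <- r | l != j) f l t.
  rewrite mulr_sumr big_seq [RHS]big_seq; apply: eq_bigr => j jr.
  rewrite big_cons; have -> : i != j by apply: contraNneq ir => ->.
  by rewrite mulrCA.
by apply: has_derivM => //; exact: IH.
Qed.

(** Jacobi formula: the derivative of a determinant is the sum over the rows
    of the determinants with this row differentiated, expanded along it. *)
Lemma has_deriv_det (n : nat) (A : R -> 'M[R]_n) A' :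
  mx_deriv A t A' -> has_deriv (fun s => \det (A s)) t (\tr (A' *m \adj (A t))).
Proof.
move=> dA; pose B i := \matrix_(j, l) (if j == i then A' j l else A t j l).
have -> : \tr (A' *m \adj (A t)) = \sum_i \det (B i).
  apply: eq_bigr => i _; rewrite mxE (expand_det_row _ i); apply: eq_bigr => l _.
  rewrite !mxE eqxx /cofactor; congr (_ * (_ * \det _)).
  by apply/matrixP => a b; rewrite !mxE eq_sym (negbTE (neq_lift _ _)).
rewrite exchange_big /=; apply: has_deriv_sum => s; rewrite -mulr_sumr.
apply: has_derivZ.
have := @has_deriv_prod _ (index_enum 'I_n) (fun i u => A u i ((s : {perm 'I_n}) i))
  (fun i => A' i ((s : {perm 'I_n}) i)) (index_enum_uniq _) (fun i => dA i _).
congr has_deriv; apply: eq_bigr => i _; rewrite [RHS](bigD1 i) //= /B mxE eqxx; congr (_ * _).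
by apply: eq_bigr => j ji; rewrite mxE (negbTE ji).
Qed.

(** Differentiability comes from the adjugate, the value of the derivative from
    differentiating A A^-1 = 1. *)
Lemma mx_deriv_inv (n : nat) (A : R -> 'M[R]_n) A' :
  (\forall s \near t, A s \in unitmx) -> mx_deriv A t A' ->
  mx_deriv (fun s => invmx (A s)) t (- (invmx (A t) *m A' *m invmx (A t))).
Proof.
move=> uA dA; have uAt : A t \in unitmx by exact: nbhs_singleton uA.
have [B dB] : exists B, mx_deriv (fun s => invmx (A s)) t B.
  have dadj i j : exists d, has_deriv (fun s => \adj (A s) i j) t d.
    eexists; under eq_fun do rewrite mxE /cofactor.
    apply: has_derivZ; apply: (@has_deriv_det _ _ (row' j (col' i A'))).
    by move=> a b; rewrite !mxE; under eq_fun do rewrite !mxE; exact: dA.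
  have dV : has_deriv (fun s => (\det (A s))^-1) t (- (\det (A t))^-2 * \tr (A' *m \adj (A t))).
    by apply: has_derivV (has_deriv_det dA); rewrite -unitfE -unitmxE.
  pose D i j := xget 0 [set d | has_deriv (fun s => \adj (A s) i j) t d].
  have dD i j : has_deriv (fun s => \adj (A s) i j) t (D i j).
    by have [d hd] := dadj i j; apply: (@xgetPex _ 0 [set d | has_deriv _ t d]); exists d.
  eexists (\matrix_(i, j) _) => i j; rewrite mxE.
  apply: (has_deriv_near (f := fun s => (\det (A s))^-1 * \adj (A s) i j)).
    by apply: filterS uA => s us; rewrite /invmx us !mxE.
  exact: (has_derivM dV (dD i j)).
have H : mx_deriv (fun s => A s *m invmx (A s)) t 0.
  apply: mx_deriv_near (mx_deriv_cst 1%:M).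
  by apply: filterS uA => s us; rewrite mulmxV.
have := mx_deriv_uniq H (mx_derivM dA dB) => /esym /eqP.
rewrite addrC addr_eq0 => /eqP E.
by rewrite -mulmxA -mulmxN -E mulKmx.
Qed.

End Rules.

(** For a curve of metrics this is the logarithmic derivative of the volume
    density, half the trace of g^-1 g'. *)
Lemma has_deriv_sqrt_det (n : nat) (A : R -> 'M[R]_n) A' (t : R) :
  0 < \det (A t) -> mx_deriv A t A' ->
  has_deriv (fun s => Num.sqrt (\det (A s))) t
    (2^-1 * \tr (invmx (A t) *m A') * Num.sqrt (\det (A t))).
Proof.
move=> d0 dA; have := has_deriv_sqrt d0 (has_deriv_det dA); congr has_deriv.
have s0 : Num.sqrt (\det (A t)) != 0 by rewrite gt_eqF // sqrtr_gt0.
have -> : \tr (A' *m \adj (A t)) = \det (A t) * \tr (invmx (A t) *m A').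
  rewrite /invmx unitmxE unitfE gt_eqF // -scalemxAl mxtraceZ mulrA mulfV ?gt_eqF //.
  by rewrite mul1r mxtrace_mulC.
rewrite -{2}(sqr_sqrtr (ltW d0)).
by field.
Qed.

End MatrixCurves.

Section SmoothMatrices.
Variables (R : realType) (k : nat) (D : set 'rV[R]_k).
Hypothesis oD : open D.

Definition smooth_mx (m n : nat) (A : 'rV[R]_k -> 'M[R]_(m, n)) :=
  forall i j, smooth_on D (fun x => A x i j).

Lemma smooth_mx_eq (m n : nat) (A B : 'rV[R]_k -> 'M[R]_(m, n)) :
  (forall x, D x -> A x = B x) -> smooth_mx A -> smooth_mx B.
Proof. by move=> AB sA i j; apply: (smooth_eq oD) (sA i j) => x /AB ->. Qed.

Lemma smooth_mxD (m n : nat) (A B : 'rV[R]_k -> 'M[R]_(m, n)) :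
  smooth_mx A -> smooth_mx B -> smooth_mx (fun x => A x + B x).
Proof.
by move=> sA sB i j; under eq_fun do rewrite mxE; exact: (smoothD oD (sA i j) (sB i j)).
Qed.

Lemma smooth_mxN (m n : nat) (A : 'rV[R]_k -> 'M[R]_(m, n)) :
  smooth_mx A -> smooth_mx (fun x => - A x).
Proof. by move=> sA i j; under eq_fun do rewrite mxE; exact: (smoothN oD (sA i j)). Qed.

Lemma smooth_mxZ (m n : nat) (f : 'rV[R]_k -> R) (A : 'rV[R]_k -> 'M[R]_(m, n)) :
  smooth_on D f -> smooth_mx A -> smooth_mx (fun x => f x *: A x).
Proof.
by move=> sf sA i j; under eq_fun do rewrite mxE; exact: (smoothM oD sf (sA i j)).
Qed.

Lemma smooth_mxM (m n d : nat) (A : 'rV[R]_k -> 'M[R]_(m, n)) (B : 'rV[R]_k -> 'M[R]_(n, d)) :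
  smooth_mx A -> smooth_mx B -> smooth_mx (fun x => A x *m B x).
Proof.
move=> sA sB i j; under eq_fun do rewrite mxE.
by apply: (smooth_sum _ _ oD) => l; exact: (smoothM oD (sA i l) (sB l j)).
Qed.

Lemma smooth_tr (n : nat) (A : 'rV[R]_k -> 'M[R]_n) :
  smooth_mx A -> smooth_on D (fun x => \tr (A x)).
Proof. by move=> sA; apply: (smooth_sum _ _ oD) => i; exact: sA. Qed.

Lemma smooth_det (n : nat) (A : 'rV[R]_k -> 'M[R]_n) :
  smooth_mx A -> smooth_on D (fun x => \det (A x)).
Proof.
move=> sA; apply: (smooth_sum _ _ oD) => s; apply: (smoothM oD (smooth_cst _ oD)).
by apply: (smooth_prod _ _ oD) => i; exact: sA.
Qed.

Lemma smooth_inv (n : nat) (A : 'rV[R]_k -> 'M[R]_n) :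
  (forall x, D x -> A x \in unitmx) -> smooth_mx A -> smooth_mx (fun x => invmx (A x)).
Proof.
move=> uA sA; apply: (smooth_mx_eq (A := fun x => (\det (A x))^-1 *: \adj (A x))).
  by move=> x /uA ux; rewrite /invmx ux.
apply: smooth_mxZ.
  by apply: (smoothV oD) (smooth_det sA) => x /uA; rewrite unitmxE unitfE.
move=> i j; under eq_fun do rewrite mxE /cofactor.
apply: (smoothM oD (smooth_cst _ oD)); apply: smooth_det => a b.
by under eq_fun do rewrite !mxE; exact: sA.
Qed.

End SmoothMatrices.

(** * Operations on smooth families and the cone of metrics *)

Section MetricFamilies.
Variables (R : realType) (n : nat) (M : closed_manifold R n).
Implicit Types (g v : tensor M) (i : chart_index M) (p : M).

Lemma tensorDE v v' i p : (v + v') i p = v i p + v' i p.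
Proof. by []. Qed.

Lemma tensorNE v i p : (- v) i p = - v i p.
Proof. by []. Qed.

Lemma tensorZE (c : R) v i p : (c *: v) i p = c *: v i p.
Proof. by []. Qed.

Lemma metric_posdef g i p : metric g -> dom i p -> posdef (g i p).
Proof.
move=> mg dp; split; first exact: (S2_sym (metric_S2 mg)).
by move=> w; exact: metric_pos mg _ _ dp w.
Qed.

Lemma metric_unit g i p : metric g -> dom i p -> g i p \in unitmx.
Proof. by move=> mg dp; apply: posdef_unit; exact: metric_posdef. Qed.

(** A metric exists, and its determinants in two charts are nonzero and differ
    by the square of the determinant of the Jacobian. *)
Lemma jac_unit g i j p : metric g -> dom i p -> dom j p ->
  jacobian_at (atlas i) (atlas j) p \in unitmx.
Proof.
move=> mg di dj; have := metric_unit mg di.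
rewrite (S2_transform (metric_S2 mg) di dj) !unitmxE !det_mulmx !unitrM.
by case/andP.
Qed.

Lemma raise_transform g v i j p : metric g -> S2 v -> dom i p -> dom j p ->
  let J := jacobian_at (atlas i) (atlas j) p in
  raise g v i p = invmx J *m raise g v j p *m J.
Proof.
move=> mg Sv di dj J; have uJ : J \in unitmx := jac_unit mg di dj.
have ui := metric_unit mg di; have uj := metric_unit mg dj.
rewrite /raise; apply: (can_inj (mulKmx ui)); rewrite mulKVmx //.
rewrite (S2_transform Sv di dj) (S2_transform (metric_S2 mg) di dj) -/J.
by rewrite -!mulmxA (mulKVmx uJ) (mulKVmx uj).
Qed.

Lemma mxtrace_conj (J A : 'M[R]_n) : J \in unitmx -> \tr (invmx J *m A *m J) = \tr A.
Proof. by move=> uJ; rewrite mxtrace_mulC mulKVmx. Qed.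

Lemma mulmx_conj (J A B : 'M[R]_n) : J \in unitmx ->
  (invmx J *m A *m J) *m (invmx J *m B *m J) = invmx J *m (A *m B) *m J.
Proof. by move=> uJ; rewrite -!mulmxA (mulKVmx uJ). Qed.

Lemma tr_raise2_chart g v v' i j p : metric g -> S2 v -> S2 v' ->
  dom i p -> dom j p ->
  \tr (raise g v i p *m raise g v' i p) = \tr (raise g v j p *m raise g v' j p).
Proof.
move=> mg Sv Sv' di dj; have uJ := jac_unit mg di dj.
by rewrite (raise_transform mg Sv di dj) (raise_transform mg Sv' di dj)
  mulmx_conj // mxtrace_conj.
Qed.

Lemma rho_chart g0 g i p : metric g0 -> metric g -> dom i p ->
  rho g0 g p = vol_density g i p / vol_density g0 i p.
Proof.
move=> mg0 mg di; have dc : dom (chart_at p) p by exact: chart_atP.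
rewrite /rho /vol_density; have uJ := jac_unit mg di dc.
rewrite (S2_transform (metric_S2 mg) di dc) (S2_transform (metric_S2 mg0) di dc).
set J := jacobian_at _ _ _.
have D (B : 'M[R]_n) : \det (J^T *m B *m J) = \det J ^+ 2 * \det B.
  by rewrite !det_mulmx det_tr expr2 mulrAC.
rewrite !D.
have dJ : Num.sqrt (\det J ^+ 2) != 0.
  by rewrite gt_eqF // sqrtr_gt0 exprn_even_gt0 //= -unitfE -unitmxE.
by rewrite !(sqrtrM _ (sqr_ge0 _)) invfM mulrACA mulfV // mul1r.
Qed.

Lemma vol_density_gt0 g i p : metric g -> dom i p -> 0 < vol_density g i p.
Proof. by move=> mg di; rewrite sqrtr_gt0; apply: posdef_det; exact: metric_posdef. Qed.

Lemma rho_gt0 g0 g p : metric g0 -> metric g -> 0 < rho g0 g p.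
Proof.
by move=> mg0 mg; rewrite divr_gt0 // vol_density_gt0 //; exact: chart_atP.
Qed.

Section Closure.
Variable k : nat.
Implicit Types (U : set 'rV[R]_k) (F : 'rV[R]_k -> tensor M).

Definition jmx F i : 'rV[R]_(k + n) -> 'M[R]_n :=
  fun w => F (lsubmx w) i (chart_inv (atlas i) (rsubmx w)).

Lemma family_mx U F : smooth_family U F ->
  forall i, smooth_mx (fdom U i) (jmx F i).
Proof. by move=> sF i j l; exact: (family_smooth sF i j l). Qed.
Arguments family_mx {U F} _ i.

Lemma fdom_dom U i w : fdom U i w -> dom i (chart_inv (atlas i) (rsubmx w)).
Proof. by move=> [_ /img_inv[]]. Qed.

(** Joint smoothness gives the smoothness of each member by freezing the
    parameter. *)
Lemma mk_family U F : open U ->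
  (forall u, U u -> forall i p, ~ dom i p -> F u i p = 0) ->
  (forall u, U u -> forall i p, (F u i p)^T = F u i p) ->
  (forall u, U u -> forall i j p, dom i p -> dom j p ->
    let J := jacobian_at (atlas i) (atlas j) p in
    F u i p = J^T *m F u j p *m J) ->
  (forall i, smooth_mx (fdom U i) (jmx F i)) ->
  smooth_family U F.
Proof.
move=> oU Foff Fsym Ftr Fsm; split=> [u Uu|i j l]; last exact: Fsm.
split=> [||i j p|i j l]; [exact: Foff|exact: Fsym|exact: Ftr|].
have -> : component (F u) i j l = joint F i j l \o (fun x => row_mx u x).
  by apply/funext => x /=; rewrite joint_row.
apply: (smooth_comp (E := fdom U i) (img_open i)) (Fsm i j l).
  exact: (coord_map_line (img_open i) (@coord_map_row R k n u)).
by move=> x ix; exact: fdom_row.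
Qed.

Lemma smooth_family_eq U F F' : open U -> (forall u, U u -> F u = F' u) ->
  smooth_family U F -> smooth_family U F'.
Proof.
move=> oU FF' [SF sF]; split=> [u Uu|i j l]; first by rewrite -FF' //; exact: SF.
apply: (smooth_eq (fdom_open i oU)) (sF i j l) => w [Uw _].
by rewrite FF'.
Qed.

Lemma smooth_family_sub U U' F : U' `<=` U -> smooth_family U F -> smooth_family U' F.
Proof.
move=> sub [SF sF]; split=> [u /sub|i j l]; first exact: SF.
by apply: smooth_sub (sF i j l) => w [/sub].
Qed.

Lemma smooth_familyD U F F' : open U -> smooth_family U F -> smooth_family U F' ->
  smooth_family U (fun u => F u + F' u).
Proof.
move=> oU sF sF'; apply: mk_family => // [u Uu i p np|u Uu i p|u Uu i j p di dj|i].
- by rewrite tensorDE (S2_off (family_S2 sF Uu)) // (S2_off (family_S2 sF' Uu)) // addr0.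
- by rewrite tensorDE linearD /= (S2_sym (family_S2 sF Uu)) (S2_sym (family_S2 sF' Uu)).
- rewrite !tensorDE (S2_transform (family_S2 sF Uu) di dj) (S2_transform (family_S2 sF' Uu) di dj).
  by rewrite /= mulmxDr mulmxDl.
- exact: (@smooth_mxD _ _ _ (fdom_open i oU) _ _ (jmx F i) (jmx F' i) (family_mx sF i) (family_mx sF' i)).
Qed.

Definition smooth_sfamily U (f : 'rV[R]_k -> M -> R) : Prop :=
  forall i, smooth_on (fdom U i) (fun w => f (lsubmx w) (chart_inv (atlas i) (rsubmx w))).

Lemma smooth_family_scale U f F : open U -> smooth_sfamily U f -> smooth_family U F ->
  smooth_family U (fun u => scale_by (f u) (F u)).
Proof.
move=> oU sf sF; apply: mk_family => // [u Uu i p np|u Uu i p|u Uu i j p di dj|i].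
- by rewrite /scale_by (S2_off (family_S2 sF Uu)) // scaler0.
- by rewrite /scale_by linearZ /= (S2_sym (family_S2 sF Uu)).
- by rewrite /scale_by (S2_transform (family_S2 sF Uu) di dj) -scalemxAr -scalemxAl.
- have H := @smooth_mxZ _ _ _ (fdom_open i oU) _ _ _ (jmx F i) (sf i) (family_mx sF i).
  exact H.
Qed.

Lemma smooth_sfamily_param U f : open U -> smooth_on U f ->
  smooth_sfamily U (fun u _ => f u).
Proof.
move=> oU sf i; apply: (@smooth_comp _ _ _ (fdom U i) U (@lsubmx R 1 k n) f (fdom_open i oU)) sf.
  exact: (coord_map_line (fdom_open i oU) (@coord_map_lsub R k n)).
by move=> w [].
Qed.

Lemma smooth_familyZ U f F : open U -> smooth_on U f -> smooth_family U F ->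
  smooth_family U (fun u => f u *: F u).
Proof.
by move=> oU /(smooth_sfamily_param oU) sf sF; exact: (smooth_family_scale oU sf sF).
Qed.

Lemma const_family U v : open U -> S2 v -> smooth_family U (fun=> v).
Proof.
move=> oU Sv; split=> [//|i j l].
change (smooth_on (fdom U i) (component v i j l \o (@rsubmx R 1 k n))).
apply: (@smooth_comp _ _ _ (fdom U i) (img i) (@rsubmx R 1 k n) (component v i j l)
  (fdom_open i oU)); last by case: Sv => _ _ _; apply.
  exact: (coord_map_line (fdom_open i oU) (@coord_map_rsub R k n)).
by move=> w [].
Qed.

(** Near each point of M a single chart shows that positive definiteness is open
    in the parameter; compactness of M makes this uniform. *)
Lemma metric_family_open U F : open U -> smooth_family U F ->
  open [set u | U u /\ metric (F u)].
Proof.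
move=> oU sF; rewrite openE => u0 [Uu0 m0]; rewrite /interior.
have nU : \forall u \near u0, U u by exact: open_nbhs_nbhs.
have /compact_near_coveringP cM := @points_compact R n M.
have H : \forall u \near u0, forall p : M, setT p -> exists2 i, dom i p & posdef (F u i p).
  apply: (cM _ (nbhs u0) (fun u p => exists2 i, dom i p & posdef (F u i p))) => p0 _.
  have dp0 : dom (chart_at p0) p0 by exact: chart_atP.
  set i := chart_at p0 in dp0 *; have [ix0 inv0] := dom_img dp0.
  have cF : (fun z : M * 'rV[R]_k => jmx F i (row_mx z.2 (chart_map (atlas i) z.1))) z
      @[z --> (p0, u0)] --> F u0 i p0.
    rewrite -[X in _ --> F u0 i X]inv0; apply: mx_cvg => j l.
    have sm := smooth_cont (family_smooth sF i j l) (fdom_row Uu0 ix0).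
    have E : F u0 i (chart_inv (atlas i) (chart_map (atlas i) p0)) j l =
      joint F i j l (row_mx u0 (chart_map (atlas i) p0)) by rewrite joint_row.
    rewrite E; apply: (cvg_comp (fun z : M * 'rV[R]_k =>
      row_mx z.2 (chart_map (atlas i) z.1)) _ _ sm).
    apply: row_cvg; first exact: cvg_snd.
    apply: (cvg_comp (fun z : M * 'rV[R]_k => z.1) (chart_map (atlas i)) cvg_fst).
    by apply: (@chart_map_cont _ _ _ (atlas i)); exact: mem_set.
  have nd : \forall z \near (p0, u0), dom i z.1 /\ U z.2.
    exists (dom i, U) => //=; split=> //; apply: open_nbhs_nbhs; split=> //.
    exact: chart_dom_open.
  have pd := posdef_near _ cF (metric_posdef m0 dp0).
  have : \forall z \near (p0, u0), posdef (jmx F i (row_mx z.2 (chart_map (atlas i) z.1))).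
    apply: pd; apply: filterS nd => -[p u] /= [_ Uu].
    by rewrite /jmx row_mxKl row_mxKr; exact: (S2_sym (family_S2 sF Uu)).
  move=> H; apply: filterS2 nd H => -[p u] /= [dp Uu].
  by rewrite /jmx row_mxKl row_mxKr (dom_img dp).2 => ?; exists i.
apply: filterS2 nU H => u Uu pu; split=> //; split; first exact: family_S2 sF Uu.
move=> i p di w w0; have [j dj pj] := pu p I.
rewrite (S2_transform (family_S2 sF Uu) di dj).
by apply: (posdef_congr _ pj).2 => //; exact: jac_unit m0 di dj.
Qed.

End Closure.
Arguments family_mx {k U F} _ i.

Lemma smooth_family_comp k m (U : set 'rV[R]_m) (F : 'rV[R]_m -> tensor M)
    (L : 'rV[R]_k -> 'rV[R]_m) : open U -> coord_map L ->
  smooth_family U F -> smooth_family (L @^-1` U) (F \o L).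
Proof.
move=> oU cL sF; split=> [u Uu|i j l]; first exact: family_S2 sF Uu.
have cL' := coord_map_prod cL (@coord_map_id R n).
have oL := fdom_open i (coord_map_open oU cL).
have -> : (fun w : 'rV[R]_(k + n) => component ((F \o L) (lsubmx w)) i j l (rsubmx w)) =
    joint F i j l \o (fun w => row_mx (L (lsubmx w)) (rsubmx w)).
  by apply/funext => w /=; rewrite joint_row.
apply: (smooth_comp oL (coord_map_line oL cL') _ (family_smooth sF i j l)).
by move=> w [Uw iw]; exact: fdom_row.
Qed.

Lemma S2_0 : S2 (0 : tensor M).
Proof.
split=> [//|i p|i j p _ _ J|i j l]; first by rewrite trmx0.
  by rewrite mulmx0 mul0mx.
have -> : component (0 : tensor M) i j l = fun=> 0.
  by apply/funext => x; rewrite /component mxE.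
exact: (smooth_cst _ (img_open i)).
Qed.

(** Statements on families specialize to single tensors: there is one row vector
    of length zero. *)
Lemma S2_family v : S2 v <-> smooth_family setT (fun _ : 'rV[R]_0 => v).
Proof.
split=> [Sv|sv]; first exact: (const_family openT Sv).
exact: (family_S2 sv (u := 0)).
Qed.

Lemma S2_curve (G : R -> tensor M) t : S2 (curve_deriv G t).
Proof. exact: (S2_curve_deriv _ _ S2_0). Qed.

Lemma S2D v v' : S2 v -> S2 v' -> S2 (v + v').
Proof.
by move=> /S2_family sv /S2_family sv'; apply/S2_family; exact: (smooth_familyD openT sv sv').
Qed.

Lemma S2Z (c : R) v : S2 v -> S2 (c *: v).
Proof.
move=> /S2_family sv; apply/S2_family.
exact: (smooth_familyZ openT (smooth_cst c openT) sv).
Qed.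

Lemma S2N v : S2 v -> S2 (- v).
Proof. by move=> /(S2Z (-1)); rewrite scaleN1r. Qed.

Lemma S2B v v' : S2 v -> S2 v' -> S2 (v - v').
Proof. by move=> Sv /S2N; exact: S2D. Qed.

(** A field composed with this family is a smooth family whose derivative in the
    first parameter at zero is the directional derivative along V. *)
Definition push k (F V : 'rV[R]_k -> tensor M) : 'rV[R]_(1 + k) -> tensor M :=
  fun w => F (rsubmx w) + lsubmx w 0 0 *: V (rsubmx w).

Definition push_dom k (U : set 'rV[R]_k) (F V : 'rV[R]_k -> tensor M) :=
  [set w : 'rV[R]_(1 + k) | U (rsubmx w) /\ metric (push F V w)].

Section Push.
Variables (k : nat) (U : set 'rV[R]_k) (F V : 'rV[R]_k -> tensor M).
Hypotheses (oU : open U) (sF : smooth_family U F) (sV : smooth_family U V).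

Lemma smooth_push : smooth_family [set w | U (rsubmx w)] (push F V).
Proof.
have o1 := coord_map_open oU (@coord_map_rsub R 1 k).
apply: (smooth_familyD o1 (smooth_family_comp oU (@coord_map_rsub R 1 k) sF)).
apply: (@smooth_familyZ _ _ (fun w => lsubmx w 0 0) (V \o rsubmx) o1); last first.
  exact: (smooth_family_comp oU (@coord_map_rsub R 1 k) sV).
under eq_fun do rewrite mxE.
exact: (smooth_coord _ o1).
Qed.

Lemma push_dom_open : open (push_dom U F V).
Proof.
exact: (metric_family_open (coord_map_open oU (@coord_map_rsub R 1 k)) smooth_push).
Qed.

Lemma smooth_push_metric : smooth_family (push_dom U F V) (push F V).
Proof. by apply: smooth_family_sub smooth_push => w []. Qed.

Lemma push0 u : push F V (row_mx 0 u) = F u.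
Proof. by rewrite /push row_mxKl row_mxKr mxE scale0r addr0. Qed.

Lemma push_line u t :
  push F V (row_mx 0 u + t *: delta_mx 0 (lshift k 0)) = F u + t *: V u.
Proof.
by rewrite /push lsub_moveL rsub_moveL row_mxKl row_mxKr !mxE add0r mulr1.
Qed.

Lemma push_dom0 u : U u -> metric (F u) -> push_dom U F V (row_mx 0 u).
Proof. by move=> Uu mF; rewrite /push_dom /= push0 row_mxKr. Qed.

Lemma push_dir (c : field M) u : smooth_field c -> U u -> metric (F u) ->
  dir_deriv c (V u) (F u) = pderiv (lshift k 0) (c \o push F V) (row_mx 0 u).
Proof.
move=> sc Uu mF; have sE := sc _ _ _ push_dom_open smooth_push_metric (fun _ => @proj2 _ _).
apply: (curve_deriv_family push_dom_open sE (push_dom0 Uu mF)).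
by near=> t; rewrite /= add0r push_line.
Unshelve. all: by end_near. Qed.

Lemma smooth_dir (c : field M) : smooth_field c -> (forall u, U u -> metric (F u)) ->
  smooth_family U (fun u => dir_deriv c (V u) (F u)).
Proof.
move=> sc mF; have oE := push_dom_open.
have sE := sc _ _ _ oE smooth_push_metric (fun _ => @proj2 _ _).
have sp := smooth_family_pderiv (lshift k 0) oE sE.
have sL := smooth_family_comp oE (@coord_map_row R 1 k 0) sp.
apply: (smooth_family_eq oU (F := pderiv (lshift k 0) (c \o push F V) \o row_mx 0)).
  by move=> u Uu /=; rewrite push_dir //; exact: mF.
by apply: smooth_family_sub sL => u Uu; apply: push_dom0 => //; exact: mF.
Qed.

End Push.

Section Directions.
Variables (g v : tensor M).
Hypotheses (mg : metric g) (Sv : S2 v).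

Let sg := (S2_family g).1 (metric_S2 mg).
Let sv := (S2_family v).1 Sv.

Lemma metric_line : \forall t \near (0 : R), metric (g + t *: v).
Proof.
have oE := push_dom_open openT sg sv.
have : \forall w \near (row_mx 0 0 : 'rV[R]_(1 + 0)),
    push_dom setT (fun _ : 'rV[R]_0 => g) (fun _ : 'rV[R]_0 => v) w.
  by apply: open_nbhs_nbhs; split=> //; exact: push_dom0.
move=> /(along_near (lshift 0 0)); apply: filterS => t [_].
by rewrite push_line.
Qed.

Lemma dir_mx (c : field M) i p : smooth_field c ->
  mx_deriv (fun t => c (g + t *: v) i p) 0 (dir_deriv c v g i p).
Proof.
move=> sc j l; have oE := push_dom_open openT sg sv.
have sE := sc _ _ _ oE (smooth_push_metric openT sg sv) (fun _ => @proj2 _ _).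
have D0 : push_dom setT (fun _ : 'rV[R]_0 => g) (fun _ : 'rV[R]_0 => v) (row_mx 0 0).
  exact: push_dom0.
rewrite (push_dir openT sg sv sc I mg (u := 0)).
have := family_deriv (lshift 0 0) i p j l oE sE D0.
congr has_deriv; apply/funext => t /=.
by rewrite push_line.
Qed.

Lemma dir_scalar (phi : tensor M -> R) : smooth_scalar phi ->
  has_deriv (fun t => phi (g + t *: v)) 0 (derive1 (fun t => phi (g + t *: v)) 0).
Proof.
move=> sphi; have oE := push_dom_open openT sg sv.
have sE := sphi _ _ _ oE (smooth_push_metric openT sg sv) (fun _ => @proj2 _ _).
have D0 : push_dom setT (fun _ : 'rV[R]_0 => g) (fun _ : 'rV[R]_0 => v) (row_mx 0 0).
  exact: push_dom0.
apply: derivable_has_deriv.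
have <- : along (phi \o push (fun _ : 'rV[R]_0 => g) (fun _ : 'rV[R]_0 => v))
    (row_mx 0 0) (lshift 0 0) = (fun t => phi (g + t *: v)).
  by apply/funext => t; rewrite /along /= push_line.
exact: (has_deriv_derivable (along_deriv0 (lshift 0 0) sE D0)).
Qed.

End Directions.

End MetricFamilies.
Arguments family_mx {R n M k U F} _ i.

(** * Integrals over a segment, with parameters *)

Section SegmentIntegrals.
Variables (R : realType) (a b : R).
Notation mu := (@lebesgue_measure R).
Implicit Types f g : R -> R.

Definition segment_cont f := forall t, a <= t <= b -> f s @[s --> t] --> f t.

Definition segment_int f : R := \int[mu]_(t in `[a, b]) f t.

Lemma segment_integrable f : segment_cont f -> mu.-integrable `[a, b] (EFin \o f).
Proof.
move=> cf; apply: continuous_compact_integrable; first exact: segment_compact.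
by apply: continuous_in_subspaceT => t /set_mem /=; rewrite in_itv /=; exact: cf.
Qed.

Lemma segment_contD f g : segment_cont f -> segment_cont g ->
  segment_cont (fun t => f t + g t).
Proof. by move=> cf cg t ab; apply: cvgD; [exact: cf|exact: cg]. Qed.

Lemma segment_contZ f c : segment_cont f -> segment_cont (fun t => c * f t).
Proof. by move=> cf t ab; apply: cvgM; [exact: cvg_cst|exact: cf]. Qed.

Lemma segment_intD f g : segment_cont f -> segment_cont g ->
  segment_int (fun t => f t + g t) = segment_int f + segment_int g.
Proof.
by move=> cf cg; apply: RintegralD => //; exact: segment_integrable.
Qed.

Lemma segment_intZ f c : segment_cont f ->
  segment_int (fun t => c * f t) = c * segment_int f.
Proof. by move=> cf; apply: RintegralZl => //; exact: segment_integrable. Qed.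

Lemma segment_int_lin f g c d : segment_cont f -> segment_cont g ->
  segment_int (fun t => c * f t + d * g t) = c * segment_int f + d * segment_int g.
Proof.
move=> cf cg; rewrite segment_intD; try exact: segment_contZ.
by rewrite !segment_intZ.
Qed.

Lemma eq_segment_int f g : (forall t, a <= t <= b -> f t = g t) ->
  segment_int f = segment_int g.
Proof.
by move=> fg; apply: eq_Rintegral => t /set_mem /=; rewrite in_itv /=; exact: fg.
Qed.

Lemma segment_int_cst c : a <= b -> segment_int (fun=> c) = c * (b - a).
Proof.
move=> ab; rewrite /segment_int Rintegral_cst //; congr (_ * _).
have E : lebesgue_measure (`[a, b]%classic : set R) = (b - a)%:E.
  rewrite lebesgue_measure_itv /= lte_fin; case: ltP => [//|ba].
  by have -> : b = a by [apply/eqP; rewrite eq_le ab ba]; rewrite subrr.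
by move: E => /(congr1 fine).
Qed.

Lemma le_segment_int f g : segment_cont f -> segment_cont g ->
  (forall t, a <= t <= b -> f t <= g t) -> segment_int f <= segment_int g.
Proof.
move=> cf cg fg; apply: le_Rintegral => //.
- exact: segment_integrable.
- exact: segment_integrable.
Qed.

Lemma segment_int_bound f e : a <= b -> segment_cont f ->
  (forall t, a <= t <= b -> `|f t| <= e) -> `|segment_int f| <= e * (b - a).
Proof.
move=> ab cf fe; have cc d : segment_cont (fun=> d) by move=> t _; exact: cvg_cst.
rewrite ler_norml -mulNr -!segment_int_cst //.
by apply/andP; split; apply: le_segment_int => // t tab; have := fe t tab;
  rewrite ler_norml => /andP[].
Qed.

End SegmentIntegrals.

Section ParameterIntegral.
Variables (R : realType) (k : nat) (E : set 'rV[R]_(1 + k)) (D : set 'rV[R]_k).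
Hypotheses (oE : open E) (oD : open D).
Hypothesis DE : forall (t : R) (w : 'rV[R]_k), 0 <= t <= 1 -> D w -> E (row_mx t%:M w).
Implicit Types h : 'rV[R]_(1 + k) -> R.

Definition mean h : 'rV[R]_k -> R :=
  fun w => segment_int 0 1 (fun t => h (row_mx t%:M w)).

Lemma scalar_cvg (T : Type) (F : set_system T) (FF : Filter F) (f : T -> R) (c : R) :
  f @ F --> c -> (fun x => (f x)%:M : 'M[R]_1) @ F --> (c%:M : 'M[R]_1).
Proof.
move=> fc; apply: mx_cvg => i j; rewrite !mxE !ord1 mulr1n.
by under eq_fun do rewrite mxE mulr1n.
Qed.

Lemma mean_segment_cont h w : (forall z : 'rV[R]_(1 + k), E z -> h y @[y --> z] --> h z) ->
  D w -> segment_cont 0 1 (fun t => h (row_mx t%:M w)).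
Proof.
move=> ch Dw t t01; apply: (cvg_comp (fun s => row_mx s%:M w) h _ (ch _ (DE t01 Dw))).
by apply: row_cvg; [apply: scalar_cvg; exact: cvg_id|exact: cvg_cst].
Qed.

Lemma mean_unif h (w : 'rV[R]_k) (e : R) : (forall z : 'rV[R]_(1 + k), E z -> h y @[y --> z] --> h z) ->
  D w -> 0 < e -> \forall w' \near w, forall t : R, 0 <= t <= 1 ->
    `|h (row_mx t%:M w') - h (row_mx t%:M w)| <= e.
Proof.
move=> ch Dw e0.
have := @unif_near R 'rV[R]_k R `[0, 1] (fun w t => h (row_mx t%:M w)) w
  (@segment_compact _ 0 1).
have cz (t : R) : `[0, 1]%classic t -> (fun z : 'rV[R]_k * R => h (row_mx z.2%:M z.1)) z
    @[z --> (w, t)] --> h (row_mx t%:M w).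
  rewrite /= in_itv /= => t01.
  apply: (cvg_comp (fun z : 'rV[R]_k * R => row_mx z.2%:M z.1) h _ (ch _ (DE t01 Dw))).
  by apply: row_cvg; [apply: scalar_cvg; exact: cvg_snd|exact: cvg_fst].
move=> /(_ cz e e0); apply: filterS => w' H t t01; apply: H.
by rewrite /= in_itv.
Qed.

Lemma mean_cvg h (w : 'rV[R]_k) : (forall z : 'rV[R]_(1 + k), E z -> h y @[y --> z] --> h z) ->
  D w -> mean h y @[y --> w] --> mean h w.
Proof.
move=> ch Dw; apply/cvgrPdist_le => /= e e0.
have nD : \forall y \near w, D y by exact: open_nbhs_nbhs.
apply: filterS2 nD (mean_unif ch Dw e0) => y Dy H.
rewrite distrC; have cy := mean_segment_cont ch Dy; have cw := mean_segment_cont ch Dw.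
rewrite /mean -[segment_int _ _ (fun t => h (row_mx t%:M y))]mul1r.
rewrite -[X in _ - X]mul1r -mulNr -(segment_int_lin 1 (-1) cy cw).
have := segment_int_bound (e := e) ler01 (f := fun t => 1 * h (row_mx t%:M y) + -1 * h (row_mx t%:M w)).
rewrite subr0 mulr1; apply; first by apply: segment_contD; exact: segment_contZ.
by move=> t t01; rewrite mul1r mulN1r; exact: H.
Qed.

(** Differentiation under the integral sign: the mean value theorem bounds the
    difference quotients uniformly on the segment. *)
Lemma mean_deriv h w j : Cm 1 E h -> D w ->
  has_deriv (along (mean h) w j) 0 (mean (partial (rshift 1 j) h) w).
Proof.
move=> Ch Dw; apply/has_derivP; apply/cvgrPdist_le => /= e e0.
have ch := Cm_cont Ch; have cp := Cm_cont (Cm_partial (rshift 1 j) Ch).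
have nD : \forall y \near w, D y by exact: open_nbhs_nbhs.
have nDu : \forall y \near w, D y /\ (forall t : R, 0 <= t <= 1 ->
    `|partial (rshift 1 j) h (row_mx t%:M y) - partial (rshift 1 j) h (row_mx t%:M w)| <= e).
  by apply: filterI nD _; exact: mean_unif.
have := along_near j nDu.
move=> /nbhs_ballP[r /= r0 Hr].
apply: filterS (punctI (near_punct (near0_norm_lt r0)) (@near_punct_neq0 R)).
move=> s [sr s0]; rewrite add0r along0 distrC.
have inr (c : R) : `|c| <= `|s| -> D (w + c *: delta_mx 0 j) /\ (forall t : R, 0 <= t <= 1 ->
    `|partial (rshift 1 j) h (row_mx t%:M (w + c *: delta_mx 0 j)) -
      partial (rshift 1 j) h (row_mx t%:M w)| <= e).
  by move=> cs; apply: Hr; rewrite /ball /= sub0r normrN; apply: le_lt_trans sr.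
have [Ds _] := inr s (lexx _).
have c1 := mean_segment_cont ch Ds; have c2 := mean_segment_cont ch Dw.
have c3 := mean_segment_cont cp Dw.
have -> : s^-1 * (along (mean h) w j s - mean h w) - mean (partial (rshift 1 j) h) w =
    segment_int 0 1 (fun t => s^-1 * (1 * h (row_mx t%:M (w + s *: delta_mx 0 j))
       + -1 * h (row_mx t%:M w)) + -1 * partial (rshift 1 j) h (row_mx t%:M w)).
  rewrite segment_int_lin //; last by apply: segment_contD; exact: segment_contZ.
  by rewrite segment_int_lin // !mul1r !mulN1r.
have := segment_int_bound (e := e) ler01 (f := fun t => s^-1 *
  (1 * h (row_mx t%:M (w + s *: delta_mx 0 j)) + -1 * h (row_mx t%:M w))
   + -1 * partial (rshift 1 j) h (row_mx t%:M w)).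
rewrite subr0 mulr1; apply.
  apply: segment_contD; last exact: segment_contZ.
  by apply: segment_contZ; apply: segment_contD; exact: segment_contZ.
move=> t t01; rewrite mul1r !mulN1r.
have [|c cs Ec] := @mvt0 R (fun c => h (row_mx t%:M (w + c *: delta_mx 0 j)))
    (fun c => partial (rshift 1 j) h (row_mx t%:M (w + c *: delta_mx 0 j))) s.
  move=> c /inr[Dc _]; apply/has_deriv_shift.
  have -> : (fun d => h (row_mx t%:M (w + (c + d) *: delta_mx 0 j))) =
      along h (row_mx t%:M (w + c *: delta_mx 0 j)) (rshift 1 j).
    by apply/funext => d; rewrite /along -row_moveR scalerDl addrA.
  exact: (Cm_deriv _ Ch (DE t01 Dc)).
rewrite scale0r addr0 in Ec.
rewrite Ec mulrC mulfK //.
by have [_] := inr c cs; apply.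
Qed.

Lemma smooth_mean h : smooth_on E h -> smooth_on D (mean h).
Proof.
move=> /smooth_onP sh; apply/smooth_onP => m.
elim: m h sh => [|m IH] h sh.
  by split=> // w Dw; apply: mean_cvg => //; exact: Cm_cont (sh 0).
apply: Cm_step => // [w Dw|j]; first by apply: mean_cvg => //; exact: Cm_cont (sh 0).
exists (mean (partial (rshift 1 j) h)); first by move=> w; exact: mean_deriv (sh 1).
by apply: IH => d; exact: Cm_partial.
Qed.

End ParameterIntegral.

(** * The lemma of Hadamard *)

Section Hadamard.
Variables (R : realType) (n : nat) (D : set 'rV[R]_(1 + n)) (f : 'rV[R]_(1 + n) -> R).
Hypotheses (oD : open D) (sf : smooth_on D f).
Hypothesis starD : forall (t : R) (w : 'rV[R]_(1 + n)), 0 <= t <= 1 -> D w ->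
  D (row_mx (t *: lsubmx w) (rsubmx w)).

Let i0 : 'I_(1 + n) := lshift n 0.

Let shrink (z : 'rV[R]_(1 + (1 + n))) : 'rV[R]_(1 + n) :=
  row_mx (lsubmx z 0 0 *: lsubmx (rsubmx z)) (rsubmx (rsubmx z)).

Lemma shrink_row (t : R) w : shrink (row_mx t%:M w) = row_mx (t *: lsubmx w) (rsubmx w).
Proof. by rewrite /shrink row_mxKl row_mxKr mxE mulr1n. Qed.

Lemma shrink_cvg (z : 'rV[R]_(1 + (1 + n))) : shrink y @[y --> z] --> shrink z.
Proof.
apply: row_cvg; last exact: (cvg_comp _ _ (@rsub_cvg _ _ _ _) (@rsub_cvg _ _ _ _)).
apply: mx_cvg => i j; rewrite mxE; under eq_fun do rewrite mxE.
apply: cvgM; apply: mx_coord_cvg; first exact: lsub_cvg.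
exact: (cvg_comp _ _ (@rsub_cvg _ _ _ _) (@lsub_cvg _ _ _ _)).
Qed.

Lemma shrink_open : open (shrink @^-1` D).
Proof. by apply: open_comp => // x _; exact: shrink_cvg. Qed.

Lemma shrink_line : line_map (shrink @^-1` D) shrink.
Proof.
have oS := shrink_open; split=> [z _|j]; first exact: shrink_cvg.
left; rewrite -(splitK j); case: (fintype.split j) => a /=.
  exists i0, (fun z => lsubmx (rsubmx z) 0 0).
    under eq_fun do rewrite !mxE; exact: smooth_coord.
  move=> z t; rewrite ord1 /shrink lsub_moveL rsub_moveL !mxE !eqxx mulr1 -row_moveL.
  congr row_mx; rewrite scalerDl; congr (_ + _); apply/rowP => l.
  by rewrite !ord1 !mxE !eqxx mulr1.
rewrite -(splitK a); case: (fintype.split a) => b /=.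
  exists i0, (fun z => lsubmx z 0 0); first by under eq_fun do rewrite mxE; exact: smooth_coord.
  move=> z t; rewrite ord1 /shrink lsub_moveR rsub_moveR lsub_moveL rsub_moveL -row_moveL.
  by rewrite scalerDr scalerA mulrC.
exists (rshift 1 b), (fun=> 1); first exact: smooth_cst.
move=> z t; rewrite /shrink lsub_moveR rsub_moveR lsub_moveR rsub_moveR.
by rewrite mulr1 row_moveR.
Qed.

(** Hadamard lemma: f (t, x) - f (0, x) is t times a smooth function, namely
    the mean of the derivative in t over the segment from (0, x) to (t, x). *)
Definition hadamard (w : 'rV[R]_(1 + n)) : R :=
  mean (partial i0 f \o shrink) w.

Lemma smooth_hadamard : smooth_on D hadamard.
Proof.
have DE (t : R) w : 0 <= t <= 1 -> D w -> (shrink @^-1` D) (row_mx t%:M w).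
  by move=> t01 Dw; rewrite /= shrink_row; exact: starD.
have sm : smooth_on (shrink @^-1` D) (partial i0 f \o shrink).
  exact: (smooth_comp shrink_open shrink_line _ (smooth_partial i0 sf)).
exact: (smooth_mean oD DE sm).
Qed.

Lemma hadamardE w : D w ->
  f w = f (row_mx 0 (rsubmx w)) + lsubmx w 0 0 * hadamard w.
Proof.
move=> Dw; pose d := lsubmx w 0 0.
have lw : lsubmx w = d *: delta_mx 0 0.
  by apply/rowP => j; rewrite ord1 [RHS]mxE [X in _ * X]mxE !eqxx mulr1.
pose F t := f (row_mx (t *: lsubmx w) (rsubmx w)).
pose F' t := d * partial i0 f (row_mx (t *: lsubmx w) (rsubmx w)).
have dF (t : R) : 0 <= t <= 1 -> has_deriv F t (F' t).
  move=> t01; have Dt := starD t01 Dw; rewrite /F'.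
  have E s : row_mx (s *: lsubmx w) (rsubmx w) =
      row_mx 0 (rsubmx w) + (s * d) *: delta_mx 0 i0.
    by rewrite -row_moveL add0r {1}lw scalerA.
  have -> : F = fun s => along f (row_mx 0 (rsubmx w)) i0 (s * d).
    by apply/funext => s; rewrite /F E.
  rewrite mulrC; apply: (@has_deriv_comp _ (fun s => s * d)).
    by rewrite -[X in has_deriv _ _ X]mulr1; under eq_fun do rewrite mulrC;
      apply: has_derivZ; exact: has_deriv_id.
  by rewrite E; apply: (along_deriv sf); rewrite -E.
have cp : segment_cont 0 1 (fun t => partial i0 f (row_mx (t *: lsubmx w) (rsubmx w))).
  have sp := smooth_partial i0 sf.
  move=> t t01; apply: (cvg_comp (fun s => row_mx (s *: lsubmx w) (rsubmx w)) (partial i0 f) _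
    (smooth_cont sp (starD t01 Dw))).
  apply: row_cvg; last exact: cvg_cst.
  apply: mx_cvg => i j; rewrite mxE; under eq_fun do rewrite mxE.
  by apply: cvgM; [exact: cvg_id|exact: cvg_cst].
have cF' : segment_cont 0 1 F' := segment_contZ cp.
have FTC : segment_int 0 1 F' = F 1 - F 0.
  rewrite /segment_int /Rintegral (@continuous_FTC2 R F' F 0 1 ltr01) //.
  - by apply: continuous_in_subspaceT => t /set_mem /=; rewrite in_itv /=; exact: cF'.
  - split=> [t t01||].
    + apply: has_deriv_derivable (dF t _).
      by apply/andP; move: t01; rewrite in_itv /= => /andP[/ltW ? /ltW ?].
    + apply: cvg_at_right_filter; apply: (has_deriv_cont (dF 0 _)).
      by rewrite lexx ler01.
    + apply: cvg_at_left_filter; apply: (has_deriv_cont (dF 1 _)).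
      by rewrite lexx ler01.
  - move=> t t01; apply: has_deriv1; apply: dF.
    by apply/andP; move: t01; rewrite in_itv /= => /andP[/ltW ? /ltW ?].
have E0 : F 0 = f (row_mx 0 (rsubmx w)) by rewrite /F scale0r.
have E1 : F 1 = f w by rewrite /F scale1r hsubmxK.
have -> : f w = F 0 + (F 1 - F 0) by rewrite E1 addrC subrK.
rewrite -E0 -FTC /hadamard /mean /F'; congr (_ + _).
rewrite (segment_intZ _ cp).
have -> : (fun t : R => (partial i0 f \o shrink) (row_mx t%:M w)) =
    (fun t => partial i0 f (row_mx (t *: lsubmx w) (rsubmx w))).
  by apply/funext => t; rewrite -(shrink_row t w).
exact: erefl.
Qed.

Lemma hadamard0 x : D (row_mx 0 x) -> hadamard (row_mx 0 x) = partial i0 f (row_mx 0 x).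
Proof.
move=> Dx; rewrite /hadamard /mean.
rewrite (@eq_segment_int _ _ _ _ (fun=> partial i0 f (row_mx 0 x))).
  by rewrite segment_int_cst // subr0 mulr1.
by move=> t _ /=; rewrite shrink_row row_mxKl row_mxKr scaler0.
Qed.

End Hadamard.

(** * Linearity of directional derivatives and second derivatives *)

Section Diagonals.
Variable R : realType.

(** The chain rule along a diagonal replaces differentials. *)
Lemma smooth_diag k (D : set 'rV[R]_k) f (x : 'rV[R]_k) a b :
  open D -> smooth_on D f -> D x ->
  has_deriv (fun t => f (x + t *: delta_mx 0 a + t *: delta_mx 0 b)) 0
    (partial a f x + partial b f x).
Proof.
move=> oD sf Dx.
pose sq (z : R * R) := x + z.1 *: (delta_mx 0 a : 'rV[R]_k) + z.2 *: delta_mx 0 b.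
have csq : sq z @[z --> ((0, 0) : R * R)] --> x.
  rewrite -[X in _ --> X](_ : sq (0, 0) = x); last by rewrite /sq /= !scale0r !addr0.
  apply: line_cvg; first exact: cvg_snd.
  by apply: line_cvg; [exact: cvg_fst|exact: cvg_cst].
pose F (t s : R) := f (x + t *: delta_mx 0 a + s *: delta_mx 0 b).
pose F1 (t s : R) := partial a f (x + t *: delta_mx 0 a + s *: delta_mx 0 b).
have F10 : F1 0 0 = partial a f x by rewrite /F1 !scale0r !addr0.
rewrite -F10; apply: (@has_deriv_diag _ F F1).
- have nD : \forall y \near x, D y by exact: open_nbhs_nbhs.
  have : \forall z \near ((0, 0) : R * R), D (sq z) by exact: csq nD.
  apply: filterS => -[t s] /= Dz.
  have -> : F^~ s = along f (x + s *: delta_mx 0 b) a.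
    by apply/funext => t'; rewrite /F /along addrAC.
  rewrite /F1 addrAC; apply: (along_deriv sf); rewrite addrAC.
  exact: Dz.
- rewrite F10; exact: (cvg_comp sq (partial a f) csq (smooth_cont (smooth_partial a sf) Dx)).
- have -> : F 0 = along f x b by apply/funext => s; rewrite /F /along scale0r addr0.
  exact: along_deriv0 sf Dx.
Qed.

End Diagonals.

Section SecondDerivatives.
Variables (R : realType) (n : nat) (M : closed_manifold R n).
Implicit Types (g v : tensor M) (i : chart_index M) (p : M).

Lemma family_diag k (U : set 'rV[R]_k) (F : 'rV[R]_k -> tensor M) a b u i p :
  open U -> smooth_family U F -> U u ->
  mx_deriv (fun t => F (u + t *: delta_mx 0 a + t *: delta_mx 0 b) i p) 0
    (pderiv a F u i p + pderiv b F u i p).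
Proof.
move=> oU sF Uu j l; rewrite mxE.
have [dp|ndp] := pselect (dom i p); last first.
  rewrite (S2_off (S2_pderiv a oU sF Uu)) // (S2_off (S2_pderiv b oU sF Uu)) // mxE addr0.
  apply: (has_deriv_near (f := fun=> 0)); last exact: has_deriv_cst.
  have nU : \forall y \near u, U y by exact: open_nbhs_nbhs.
  have c : u + t *: delta_mx 0 a + t *: delta_mx 0 b @[t --> (0 : R)] --> u.
    rewrite -[X in _ --> X]addr0 -[X in _ + X](scale0r (delta_mx 0 b)).
    by apply: line_cvg => //; exact: along_cvg.
  have N : \forall t \near (0 : R), U (u + t *: delta_mx 0 a + t *: delta_mx 0 b).
    exact: (c _ nU).
  by apply: filterS N => t /= Ut; rewrite (S2_off (family_S2 sF Ut)) // mxE.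
have [ix invx] := dom_img dp.
have := smooth_diag (lshift n a) (lshift n b) (fdom_open i oU) (family_smooth sF i j l)
  (fdom_row Uu ix).
rewrite -!joint_pderiv !joint_row /component invx; congr has_deriv; apply/funext => t.
by rewrite -!row_moveL joint_row /component invx.
Qed.

Lemma pderivC k (U : set 'rV[R]_k) (F : 'rV[R]_k -> tensor M) a b u :
  open U -> smooth_family U F -> U u ->
  pderiv a (pderiv b F) u = pderiv b (pderiv a F) u.
Proof.
move=> oU sF Uu; apply: tensorP => i p.
have sa := smooth_family_pderiv a oU sF; have sb := smooth_family_pderiv b oU sF.
have [dp|ndp] := pselect (dom i p); last first.
  by rewrite (S2_off (S2_pderiv a oU sb Uu)) // (S2_off (S2_pderiv b oU sa Uu)).
have [ix invx] := dom_img dp; apply/matrixP => j l.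
have E a' b' : pderiv a' (pderiv b' F) u i p j l =
    partial (lshift n a') (partial (lshift n b') (joint F i j l))
      (row_mx u (chart_map (atlas i) p)).
  by rewrite -2!joint_pderiv joint_row /component invx.
apply: (etrans (E a b)); apply: (etrans _ (esym (E b a))).
exact: (partialC _ _ (fdom_open i oU) (family_smooth sF i j l) (fdom_row Uu ix)).
Qed.

(** The quotient by the parameter is smooth across zero by Hadamard's lemma in
    each chart. A ball around zero is used as parameter domain since the segments
    from zero have to stay in it. *)
Lemma family_hadamard (U : set 'rV[R]_1) (B : 'rV[R]_1 -> tensor M) :
  open U -> smooth_family U B -> U 0 ->
  exists (U' : set 'rV[R]_1) (Q : 'rV[R]_1 -> tensor M),
    [/\ open U', U' 0, smooth_family U' Q,
        forall u, U' u -> B u = B 0 + u 0 0 *: Q u & Q 0 = pderiv 0 B 0].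
Proof.
move=> oU sB U0.
have : \forall u \near (0 : 'rV[R]_1), U u by exact: open_nbhs_nbhs.
move=> /nbhs_ballP[r /= r0 Ur].
pose U' := [set u : 'rV[R]_1 | `|u 0 0| < r].
have U'U : U' `<=` U.
  move=> u ur; apply: Ur; split=> // i j; rewrite !ord1 /ball /= !mxE sub0r normrN.
  exact: ur.
have oU' : open U'.
  have -> : U' = (fun u : 'rV[R]_1 => u 0 0) @^-1` ball (0 : R) r.
    by apply/seteqP; split=> u /=; rewrite /U' /ball /= sub0r normrN.
  apply: open_comp; last exact: ball_open.
  by move=> u _; exact: coord_continuous.
have U'0 : U' 0 by rewrite /U' /= mxE normr0.
pose Q (u : 'rV[R]_1) : tensor M :=
  if u 0 0 == 0 then pderiv 0 B 0 else (u 0 0)^-1 *: (B u - B 0).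
have sB' := smooth_family_sub U'U sB.
exists U', Q; split=> [//|//|||]; last by rewrite /Q mxE eqxx.
  split=> [u Uu|i j l].
    rewrite /Q; case: ifP => _; first exact: S2_pderiv sB U0.
    by apply: S2Z; apply: S2B; apply: family_S2 sB _ => //; exact: U'U.
  have star (t : R) (w : 'rV[R]_(1 + n)) : 0 <= t <= 1 -> fdom U' i w ->
      fdom U' i (row_mx (t *: lsubmx w) (rsubmx w)).
    move=> /andP[t0 t1] [Uw iw]; split; last by rewrite row_mxKr.
    rewrite row_mxKl /U' /= mxE normrM ger0_norm //; apply: le_lt_trans Uw.
    by rewrite ler_piMl.
  have sf := family_smooth sB' i j l.
  apply: (smooth_eq (fdom_open i oU')) (smooth_hadamard (fdom_open i oU') sf star).
  move=> w Dw; have HE := hadamardE sf star Dw.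
  have H0 := hadamard0 (joint B i j l) (D := fdom U' i) (x := rsubmx w).
  rewrite /Q; case: eqP => [w0|/eqP w0].
    have lw : lsubmx w = 0 by apply/rowP => a; rewrite ord1 w0 mxE.
    have Ew : w = row_mx 0 (rsubmx w) by rewrite -lw hsubmxK.
    by rewrite {1}Ew H0 -?Ew // Ew -joint_pderiv joint_row row_mxKr.
  rewrite /component tensorZE tensorDE tensorNE !mxE.
  have -> : B (lsubmx w) i (chart_inv (atlas i) (rsubmx w)) j l = joint B i j l w by [].
  have -> : B 0 i (chart_inv (atlas i) (rsubmx w)) j l =
    joint B i j l (row_mx 0 (rsubmx w)) by rewrite joint_row.
  have -> : w 0 (lshift n 0) = lsubmx w 0 0 by rewrite mxE.
  by rewrite HE [_ + _ - _]addrC addKr mulKf.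
move=> u Uu; rewrite /Q; case: eqP => [u0|/eqP u0].
  have -> : u = 0 by apply/rowP => a; rewrite ord1 u0 mxE.
  by rewrite mxE scale0r addr0.
by rewrite scalerA mulfV // scale1r addrC subrK.
Qed.

Section Direction.
Variables (c : field M) (g : tensor M).
Hypotheses (sc : smooth_field c) (mg : metric g).

Lemma dirZ (r : R) v : S2 v -> dir_deriv c (r *: v) g = r *: dir_deriv c v g.
Proof.
move=> Sv; apply: tensorP => i p.
apply: mx_deriv_uniq (dir_mx mg (S2Z r Sv) i p sc) _ => j l.
rewrite tensorZE mxE.
have -> : (fun t => c (g + t *: (r *: v)) i p j l) =
    (fun t => (fun s => c (g + s *: v) i p j l) (t * r)).
  by apply/funext => t; rewrite scalerA.
by apply: (@has_deriv_scale _ (fun s => c (g + s *: v) i p j l)); exact: dir_mx.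
Qed.

(** Reduces facts on two directions to facts on partial derivatives. *)
Lemma plane_family v w : S2 v -> S2 w ->
  exists (D : set 'rV[R]_2) (E : 'rV[R]_2 -> tensor M),
    [/\ open D, smooth_family D (c \o E), D 0 & forall t s : R,
        E (0 + t *: delta_mx 0 0 + s *: delta_mx 0 1) = g + t *: v + s *: w].
Proof.
move=> Sv Sw; pose E (u : 'rV[R]_2) := g + u 0 0 *: v + u 0 1 *: w.
have sE : smooth_family setT E.
  have sZ j (x : tensor M) : S2 x -> smooth_family setT (fun u : 'rV[R]_2 => u 0 j *: x).
    by move=> Sx; exact: (smooth_familyZ openT (smooth_coord j openT) (const_family openT Sx)).
  have sg := @const_family _ _ _ 2 setT g openT (metric_S2 mg).
  exact: (smooth_familyD openT (smooth_familyD openT sg (sZ _ _ Sv)) (sZ _ _ Sw)).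
have oD := metric_family_open openT sE; set D := [set u | _] in oD.
have sD : smooth_family D E by apply: smooth_family_sub sE.
exists D, E; split=> [//|||t s].
- exact: (sc oD sD (fun _ => @proj2 _ _)).
- by split=> //; rewrite /E !mxE !scale0r !addr0.
- by rewrite /E !mxE /= !mulr1 !mulr0 !add0r addr0.
Qed.

(** Both directions are parameters of one smooth family, whose derivative along
    the diagonal is the sum of the partial derivatives. *)
Lemma dirD v w : S2 v -> S2 w ->
  dir_deriv c (v + w) g = dir_deriv c v g + dir_deriv c w g.
Proof.
move=> Sv Sw; have [D [E [oD sE D0 EE]]] := plane_family Sv Sw.
have Pv : dir_deriv c v g = pderiv 0 (c \o E) 0.
  apply: (curve_deriv_family oD sE D0); near=> t.
  by rewrite /= [0 + t]add0r; have := EE t 0; rewrite !scale0r !addr0 => ->.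
have Pw : dir_deriv c w g = pderiv 1 (c \o E) 0.
  apply: (curve_deriv_family oD sE D0); near=> t.
  by rewrite /= [0 + t]add0r; have := EE 0 t; rewrite !scale0r !addr0 => ->.
apply: tensorP => i p.
apply: mx_deriv_uniq (dir_mx mg (S2D Sv Sw) i p sc) _.
rewrite tensorDE Pv Pw; apply: (mx_deriv_near _ (family_diag 0 1 i p oD sE D0)).
by near=> t; rewrite /= EE scalerDr addrA.
Unshelve. all: by end_near. Qed.

Lemma dirB v v' : S2 v -> S2 v' ->
  dir_deriv c (v - v') g = dir_deriv c v g - dir_deriv c v' g.
Proof.
move=> Sv Sv'; rewrite -[- v']scaleN1r (dirD Sv (S2Z (-1) Sv')) (dirZ _ Sv').
by rewrite scaleN1r.
Qed.

(** Linearity of d c in the direction turns B u = B 0 + u Q u into the same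
    relation between the directional derivatives, so the derivative at zero can
    be read off from the smooth family Q. *)
Lemma dir_curve (U : set 'rV[R]_1) (B : 'rV[R]_1 -> tensor M) i p :
  open U -> smooth_family U B -> U 0 ->
  mx_deriv (fun t => dir_deriv c (B (t *: delta_mx 0 0)) g i p) 0
    (dir_deriv c (pderiv 0 B 0) g i p).
Proof.
move=> oU sB U0; have [U' [Q [oU' U'0 sQ BQ Q0]]] := family_hadamard oU sB U0.
have nU' : \forall t \near (0 : R), U' (t *: delta_mx 0 0).
  have nU : \forall u \near (0 : 'rV[R]_1), U' u by exact: open_nbhs_nbhs.
  by have := along_near 0 nU; apply: filterS => t; rewrite add0r.
have S0 : S2 (B 0) by exact: family_S2 sB U0.
pose dQ := fun u : 'rV[R]_1 => dir_deriv c (Q u) g.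
have sdQ : smooth_family U' dQ.
  exact: (smooth_dir oU' (const_family oU' (metric_S2 mg)) sQ sc (fun _ _ => mg)).
apply: (mx_deriv_near (A := fun t => dir_deriv c (B 0) g i p + t *: dQ (0 + t *: delta_mx 0 0) i p)).
  apply: filterS nU' => t Ut; rewrite (BQ _ Ut) (dirD S0 (S2Z _ (family_S2 sQ Ut))) (dirZ _ (family_S2 sQ Ut)).
  by rewrite add0r !mxE eqxx mulr1.
have D0 : mx_deriv (fun t => dQ (0 + t *: delta_mx 0 0) i p) 0 (pderiv 0 dQ 0 i p).
  by move=> j l; exact: (family_deriv 0 i p j l oU' sdQ U'0).
have := mx_derivD (mx_deriv_cst 0 (dir_deriv c (B 0) g i p)) (mx_derivZ (has_deriv_id 0) D0).
by rewrite !scale0r !addr0 scale1r add0r /dQ Q0.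
Qed.

End Direction.

Section Commutator.
Variables (c : field M) (g : tensor M).
Hypothesis sc : smooth_field c.
Hypothesis mg : metric g.

Lemma field_S2 (f : field M) : smooth_field f -> S2 (f g).
Proof.
move=> sf; have /S2_family sg := metric_S2 mg.
exact: (family_S2 (sf _ _ _ openT sg (fun _ _ => mg)) (u := 0)).
Qed.

Definition second_dir v w : tensor M := dir_deriv (fun h => dir_deriv c w h) v g.

(** Both sides are mixed parameter derivatives on a plane through g. *)
Lemma second_dirC v w : S2 v -> S2 w -> second_dir v w = second_dir w v.
Proof.
move=> Sv Sw; have [D [E [oD sE D0 EE]]] := plane_family sc mg Sv Sw.
have nD (j : 'I_2) : \forall t \near (0 : R), D (0 + t *: delta_mx 0 j).
  by apply: along_near; exact: open_nbhs_nbhs.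
have Pv : second_dir v w = pderiv 0 (pderiv 1 (c \o E)) 0.
  apply: (curve_deriv_family oD (smooth_family_pderiv 1 oD sE) D0).
  apply: filterS (nD 0) => t Dt; rewrite [0 + t]add0r.
  by apply: (curve_deriv_family oD sE Dt); near=> s; rewrite /= EE [0 + s]add0r.
have Pw : second_dir w v = pderiv 1 (pderiv 0 (c \o E)) 0.
  apply: (curve_deriv_family oD (smooth_family_pderiv 0 oD sE) D0).
  apply: filterS (nD 1) => t Dt; rewrite [0 + t]add0r.
  by apply: (curve_deriv_family oD sE Dt); near=> s; rewrite /= [0 + s]add0r [0 + _ + _]addrAC EE addrAC.
exact: (etrans Pv (etrans (pderivC 0 1 oD sE D0) (esym Pw))).
Unshelve. all: by end_near. Qed.

End Commutator.

(** Chain rule for the derivative of c along a moving direction: in the family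
    (t, s) |-> d_(b (g + s a)) c (g + t a), the diagonal t = s is differentiated. *)
Lemma dir_dir (a : tensor M) (b c : field M) (g : tensor M) :
  S2 a -> smooth_field b -> smooth_field c -> metric g ->
  dir_deriv (fun h => dir_deriv c (b h) h) a g =
  second_dir c g a (b g) + dir_deriv c (dir_deriv b a g) g.
Proof.
move=> Sa sb sc mg; have /S2_family sg1 := metric_S2 mg.
have /S2_family sa1 := Sa.
pose L := push (fun _ : 'rV[R]_0 => g) (fun=> a).
pose D1 := push_dom setT (fun _ : 'rV[R]_0 => g) (fun=> a).
have o1 : open D1 by exact: push_dom_open openT sg1 sa1.
have sL : smooth_family D1 L by exact: smooth_push_metric openT sg1 sa1.
have mL u : D1 u -> metric (L u) by case.
(* The left half of a parameter moves the base point, the right half the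
   direction. *)
pose U := [set w : 'rV[R]_((1 + 0) + (1 + 0)) | D1 (lsubmx w) /\ D1 (rsubmx w)].
have oU : open U by exact: open_rows.
have sF : smooth_family U (L \o lsubmx).
  apply: (smooth_family_sub _ (smooth_family_comp o1 (@coord_map_lsub R (1+0) (1+0)) sL)).
  by move=> w [].
have sV : smooth_family U ((b \o L) \o rsubmx).
  apply: (smooth_family_sub _ (smooth_family_comp o1 (@coord_map_rsub R (1+0) (1+0)) (sb _ _ _ o1 sL mL))).
  by move=> w [].
have sY := smooth_dir oU sF sV sc (fun u (Uu : U u) => mL _ Uu.1).
pose z0 := row_mx 0 0 : 'rV[R]_(1 + 0).
have D10 : D1 z0 by exact: push_dom0.
pose u := row_mx z0 z0 : 'rV[R]_((1 + 0) + (1 + 0)).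
have Uu : U u by rewrite /U /= /u row_mxKl row_mxKr.
pose e0 := lshift 0 0 : 'I_(1 + 0).
pose i1 := lshift (1 + 0) e0; pose i2 := rshift (1 + 0) e0.
have Ll (t : R) : L (z0 + t *: delta_mx 0 e0) = g + t *: a by rewrite /L push_line.
have L0 : L z0 = g by rewrite /L push0.
pose Y := fun u : 'rV[R]_((1 + 0) + (1 + 0)) =>
  dir_deriv c (((b \o L) \o rsubmx) u) ((L \o lsubmx) u).
have sY' : smooth_family U Y by exact: sY.
have Yts (t s : R) : Y (u + t *: delta_mx 0 i1 + s *: delta_mx 0 i2) =
    dir_deriv c (b (g + s *: a)) (g + t *: a).
  by rewrite /u /i1 /i2 -row_moveL -row_moveR /Y /= row_mxKl row_mxKr !Ll.
have P1 : second_dir c g a (b g) = pderiv i1 Y u.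
  apply: (curve_deriv_family oU sY' Uu); near=> t.
  by rewrite add0r -[u + _]addr0 -(scale0r (delta_mx 0 i2)) Yts scale0r addr0.
have P2 : dir_deriv c (dir_deriv b a g) g = pderiv i2 Y u.
  apply: tensorP => i p.
  have sbL : smooth_family D1 (b \o L) by exact: sb.
  pose B (x : 'rV[R]_1) := b (L (row_mx x 0)).
  have Brow : coord_map (fun x : 'rV[R]_1 => row_mx x (0 : 'rV[R]_0)).
    split=> [x|j]; first by apply: row_cvg; [exact: cvg_id|exact: cvg_cst].
    by left; exists (lshift 0 j) => x t; rewrite row_moveL.
  have sB := smooth_family_comp o1 Brow sbL.
  have oB := coord_map_open o1 Brow.
  have dB := dir_curve sc mg i p oB sB D10.
  have EB : pderiv 0 ((b \o L) \o (fun x : 'rV[R]_1 => row_mx x (0 : 'rV[R]_0))) 0 = dir_deriv b a g.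
    apply/esym; apply: (curve_deriv_family oB sB D10); near=> t.
    by rewrite /= add0r row_moveL Ll.
  rewrite EB in dB.
  apply: mx_deriv_uniq dB _.
  apply: (mx_deriv_near (A := fun t => Y (u + t *: delta_mx 0 i2) i p)); last first.
    by move=> j l; exact: (family_deriv i2 i p j l oU sY' Uu).
  near=> t; rewrite -{1}[u]addr0 -(scale0r (delta_mx 0 i1)) Yts scale0r addr0 /=.
  by rewrite -[t *: delta_mx 0 0]add0r row_moveL Ll.
apply: tensorP => i p.
have sdir : smooth_field (fun h => dir_deriv c (b h) h).
  by move=> k U2 F oU2 sF2 mF2; exact: (smooth_dir oU2 sF2 (sb _ _ _ oU2 sF2 mF2) sc mF2).
apply: mx_deriv_uniq (dir_mx mg Sa i p sdir) _.
rewrite tensorDE P1 P2; apply: (mx_deriv_near _ (family_diag i1 i2 i p oU sY' Uu)).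
by near=> t; rewrite Yts.
Unshelve. all: by end_near. Qed.

(** The second derivatives along constant directions are symmetric, which leaves
    the first order terms of the chain rule. *)
Lemma dir_commutator (a b c : field M) (g : tensor M) :
  smooth_field a -> smooth_field b -> smooth_field c -> metric g ->
  dir_deriv (fun h => dir_deriv c (b h) h) (a g) g
  - dir_deriv (fun h => dir_deriv c (a h) h) (b g) g
  = dir_deriv c (bracket a b g) g.
Proof.
move=> sa sb sc mg; have Sa := field_S2 mg sa; have Sb := field_S2 mg sb.
apply: (etrans (congr2 (fun x y => x - y) (dir_dir Sa sb sc mg) (dir_dir Sb sa sc mg))).
rewrite (second_dirC sc mg Sb Sa); apply: etrans (esym (dirB sc mg (S2_curve _ _) (S2_curve _ _))).
by rewrite opprD addrACA subrr add0r.
Qed.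

End SecondDerivatives.

(** * Iterated integrals of continuous functions with bounded support *)

Section EuclideanIntegral.
Variable R : realType.
Notation mu := (@lebesgue_measure R).

(** The bound L on the support is explicit because the limits below need one box
    for all the integrands. *)
Definition boxed (L : R) (n : nat) (f : 'rV[R]_n -> R) : Prop :=
  [/\ 0 <= L, forall x : 'rV[R]_n, f y @[y --> x] --> f x
    & forall (x : 'rV[R]_n) (j : 'I_n), L < `|x 0 j| -> f x = 0].

Lemma integral_segment (L : R) (F : R -> R) :
  (forall t, L < `|t| -> F t = 0) ->
  Rintegral mu setT F = segment_int (- L) L F.
Proof.
move=> F0; rewrite /segment_int [RHS]Rintegral_mkcond.
have -> : (fun t => F t) \_ `[- L, L] = F; last by [].
apply/funext => t; rewrite patchE; case: ifPn => // /negP tn.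
apply/esym/F0; rewrite ltNge ler_norml; apply/negP => tL; apply: tn.
by rewrite inE /= in_itv.
Qed.

Lemma boxedD L n (f g : 'rV[R]_n -> R) : boxed L f -> boxed L g ->
  boxed L (fun x => f x + g x).
Proof.
move=> [L0 cf f0] [_ cg g0]; split=> // [x|x j Lx].
  by apply: cvgD; [exact: cf|exact: cg].
by rewrite (f0 x j Lx) (g0 x j Lx) addr0.
Qed.

Lemma boxedZ L n (f : 'rV[R]_n -> R) c : boxed L f -> boxed L (fun x => c * f x).
Proof.
move=> [L0 cf f0]; split=> // [x|x j Lx].
  by apply: cvgM; [exact: cvg_cst|exact: cf].
by rewrite (f0 x j Lx) mulr0.
Qed.

Lemma boxed_slice L n (f : 'rV[R]_(1 + n) -> R) (t : R) :
  boxed L f -> boxed L (fun v : 'rV[R]_n => f (row_mx t%:M v)).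
Proof.
move=> [L0 cf f0]; split=> // [x|x j Lx].
  apply: (cvg_comp (fun v : 'rV[R]_n => row_mx t%:M v) f _ (cf _)).
  by apply: row_cvg; [exact: cvg_cst|exact: cvg_id].
by apply: (f0 _ (rshift 1 j)); rewrite row_mxEr.
Qed.

Definition slice_integral n (f : 'rV[R]_(1 + n) -> R) (t : R) : R :=
  euclidean_integral (fun v : 'rV[R]_n => f (row_mx t%:M v)).

Lemma euclidean_integralS n (f : 'rV[R]_(1 + n) -> R) :
  euclidean_integral (f : 'rV[R]_n.+1 -> R) = Rintegral mu setT (slice_integral f).
Proof. by []. Qed.

Lemma slice_integral0 L n (f : 'rV[R]_(1 + n) -> R) (t : R) :
  (forall L (f : 'rV[R]_n -> R) (e : R), boxed L f -> (forall x, `|f x| <= e) ->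
    `|euclidean_integral f| <= e * (2 * L) ^+ n) ->
  boxed L f -> L < `|t| -> slice_integral f t = 0.
Proof.
move=> bnd bf Lt; apply/eqP; rewrite -normr_le0.
have := bnd L _ 0 (boxed_slice t bf); rewrite mul0r; apply => x.
have [_ _ f0] := bf; rewrite (f0 _ (lshift n 0)) ?normr0 // row_mxEl mxE mulr1n.
exact: Lt.
Qed.

(** The four basic facts go together by induction on the dimension: the
    integral over the first coordinate needs the continuity of the integral
    over the other ones, hence their linearity and their bound. *)
Lemma euclidean_integral_basic n :
  [/\ forall L (f g : 'rV[R]_n -> R) c d, boxed L f -> boxed L g ->
        euclidean_integral (fun x => c * f x + d * g x) =
        c * euclidean_integral f + d * euclidean_integral g,
      forall L (f : 'rV[R]_n -> R) (e : R), boxed L f -> (forall x, `|f x| <= e) ->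
        `|euclidean_integral f| <= e * (2 * L) ^+ n,
      forall L (f : 'rV[R]_n -> R), boxed L f -> (forall x, 0 <= f x) ->
        0 <= euclidean_integral f
    & forall L (f : 'rV[R]_n -> R) x, boxed L f -> (forall x, 0 <= f x) ->
        0 < f x -> 0 < euclidean_integral f].
Proof.
elim: n => [|n [IHlin IHb IHge IHgt]].
  split=> [//|L f e _ fe|L f _ f0|L f x _ _ fx] /=.
  - by rewrite expr0 mulr1.
  - exact: f0.
  - by have <- : x = 0 by apply/rowP => -[].
rewrite -[n.+1]/(1 + n)%N.
have cS L (f : 'rV[R]_(1 + n) -> R) : boxed L f -> forall t : R,
    slice_integral f s @[s --> t] --> slice_integral f t.
  move=> bf t; apply/cvgrPdist_le => /= e e0; have [L0 cf f0] := bf.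
  pose d := e / ((2 * L) ^+ n + 1).
  have p0 : 0 < (2 * L) ^+ n + 1 by rewrite ltr_wpDl // exprn_ge0 // mulr_ge0.
  have d0 : 0 < d by rewrite divr_gt0.
  pose K := [set v : 'rV[R]_n | forall j, `[- L, L]%classic (v 0 j)].
  have cK : compact K by exact: (@rV_compact R n (fun=> `[- L, L]%classic) (fun=> @segment_compact _ _ _)).
  have := @unif_near R R 'rV[R]_n K (fun s v => f (row_mx s%:M v)) t cK.
  have ch x : K x -> (fun z : R * 'rV[R]_n => f (row_mx z.1%:M z.2)) z @[z --> (t, x)]
      --> f (row_mx t%:M x).
    move=> _; apply: (cvg_comp (fun z : R * 'rV[R]_n => row_mx z.1%:M z.2) f _ (cf _)).
    by apply: row_cvg; [apply: scalar_cvg; exact: cvg_fst|exact: cvg_snd].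
  move=> /(_ ch d d0); apply: filterS => s Hs.
  have E : slice_integral f t - slice_integral f s = euclidean_integral (fun v : 'rV[R]_n =>
      1 * f (row_mx t%:M v) + -1 * f (row_mx s%:M v)).
    by rewrite (IHlin L) ?mul1r ?mulN1r //; exact: boxed_slice.
  rewrite E; apply: (le_trans (IHb L _ d _ _)).
  - by apply: boxedD; apply: boxedZ; exact: boxed_slice.
  - move=> v; rewrite mul1r mulN1r distrC; have [vK|] := pselect (K v); first exact: Hs.
    move=> /existsNP[j] /negP vj.
    have Lj : L < `|v 0 j|.
      rewrite ltNge ler_norml; apply/negP => vL; move/negP: vj; apply.
      by rewrite /= in_itv.
    by rewrite !(f0 _ (rshift 1 j)) ?row_mxEr // subrr normr0 ltW.
  - by rewrite /d mulrAC ler_pdivrMr // ler_pM2l // lerDl.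
have sc L (f : 'rV[R]_(1 + n) -> R) : boxed L f -> segment_cont (- L) L (slice_integral f).
  by move=> bf t _; exact: cS bf t.
have S0 L (f : 'rV[R]_(1 + n) -> R) t : boxed L f -> L < `|t| -> slice_integral f t = 0.
  exact: slice_integral0 IHb.
have Es L (f : 'rV[R]_(1 + n) -> R) : boxed L f ->
    euclidean_integral (f : 'rV[R]_n.+1 -> R) = segment_int (- L) L (slice_integral f).
  by move=> bf; rewrite euclidean_integralS (@integral_segment L) // => t; exact: S0.
have LL (L : R) : 0 <= L -> - L <= L by move=> L0; rewrite -subr_ge0 opprK addr_ge0.
split=> [L f g c d bf bg|L f e bf fe|L f bf f0|L f x bf f0 fx].
- rewrite (Es L); last by apply: boxedD; exact: boxedZ.
  rewrite (Es L f bf) (Es L g bg) -(segment_int_lin c d (sc _ _ bf) (sc _ _ bg)).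
  apply: eq_segment_int => t _.
  exact: (IHlin L _ _ c d (boxed_slice t bf) (boxed_slice t bg)).
- have [L0 _ _] := bf; rewrite (Es L f bf).
  apply: le_trans (segment_int_bound (e := e * (2 * L) ^+ n) (LL L L0) (sc _ _ bf) _) _.
    by move=> t _; apply: (IHb L _ e (boxed_slice t bf)) => v; exact: fe.
  have -> : L - - L = 2 * L by ring.
  by rewrite -mulrA -exprSr.
- have [L0 _ _] := bf; rewrite (Es L f bf).
  apply: Rintegral_ge0 => t _; apply: (IHge L _ (boxed_slice t bf)) => v; exact: f0.
- have [L0 _ _] := bf.
  pose t0 := lsubmx x 0 0; have Ex : x = row_mx t0%:M (rsubmx x).
    by rewrite -[LHS]hsubmxK; congr row_mx; rewrite [LHS]mx11_scalar.
  have Sge t : 0 <= slice_integral f t.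
    by apply: (IHge L _ (boxed_slice t bf)) => v; exact: f0.
  have St0 : 0 < slice_integral f t0.
    by apply: (IHgt L _ (rsubmx x) (boxed_slice t0 bf)) => [v|]; [exact: f0|rewrite -Ex].
  pose h := slice_integral f t0 / 2.
  have h0 : 0 < h by rewrite divr_gt0.
  have := cS L f bf t0; move/cvgrPdist_le => /(_ h h0) /nbhs_ballP[d /= d0 Hd].
  pose r := d / 2; have r0 : 0 < r by rewrite divr_gt0.
  have rd : r < d by rewrite /r ltr_pdivrMr // ltr_pMr // ltr1n.
  have low t : t \in `[t0 - r, t0 + r] -> h <= slice_integral f t.
    rewrite in_itv /= -ler_distl => tr; have : `|slice_integral f t0 - slice_integral f t| <= h.
      by apply: Hd; rewrite /ball /= distrC; apply: le_lt_trans rd.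
    by rewrite ler_norml => /andP[_]; rewrite /h; lra.
  (* A larger box, so that it contains the segment on which f is bounded below. *)
  pose A := Num.max L (`|t0| + r).
  have bA : boxed A f.
    have [_ cf ff] := bf; split=> [|//|y j Ay]; first by rewrite le_max L0.
    by apply: (ff y j); apply: le_lt_trans Ay; rewrite le_max lexx.
  suff : 0 < segment_int (- A) A (slice_integral f) by rewrite -(Es A f bA).
  have iS := segment_integrable (sc _ _ bA).
  have SA : `[t0 - r, t0 + r]%classic `<=` `[- A, A]%classic.
    move=> t; rewrite /= !in_itv /= -ler_distl -ler_norml => tr.
    rewrite /A le_max; apply/orP; right.
    by rewrite -[t](subrK t0) addrC; apply: le_trans (ler_normD _ _) _; rewrite lerD2l.
  have cr : segment_cont (t0 - r) (t0 + r) (slice_integral f) by move=> t _; exact: cS bf t.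
  have : segment_int (t0 - r) (t0 + r) (fun=> h) <= segment_int (t0 - r) (t0 + r) (slice_integral f).
    have ch : segment_cont (t0 - r) (t0 + r) (fun=> h) by move=> t _; exact: cvg_cst.
    by apply: (le_segment_int ch cr) => t tr; apply: low; rewrite in_itv.
  rewrite segment_int_cst; last by rewrite lerD2l ge0_cp // ltW.
  have : segment_int (t0 - r) (t0 + r) (slice_integral f) <= segment_int (- A) A (slice_integral f).
    rewrite /segment_int /Rintegral; apply: fine_le.
    - by apply: integrable_fin_num => //; exact: segment_integrable.
    - by apply: integrable_fin_num.
    - apply: ge0_subset_integral => //; last by move=> t _; rewrite lee_fin.
      by case/integrableP: iS.
  have : 0 < h * (t0 + r - (t0 - r)) by rewrite mulr_gt0 //; lra.
  by lra.
Qed.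

Lemma euclidean_integral_lin n L (f g : 'rV[R]_n -> R) c d : boxed L f -> boxed L g ->
  euclidean_integral (fun x => c * f x + d * g x) =
  c * euclidean_integral f + d * euclidean_integral g.
Proof. by have [H _ _ _] := euclidean_integral_basic n; exact: H. Qed.

Lemma euclidean_integral_bound n L (f : 'rV[R]_n -> R) (e : R) :
  boxed L f -> (forall x, `|f x| <= e) -> `|euclidean_integral f| <= e * (2 * L) ^+ n.
Proof. by have [_ H _ _] := euclidean_integral_basic n; exact: H. Qed.

Lemma euclidean_integral_ge0 n L (f : 'rV[R]_n -> R) :
  boxed L f -> (forall x, 0 <= f x) -> 0 <= euclidean_integral f.
Proof. by have [_ _ H _] := euclidean_integral_basic n; exact: H. Qed.

Lemma euclidean_integral_gt0 n L (f : 'rV[R]_n -> R) x :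
  boxed L f -> (forall x, 0 <= f x) -> 0 < f x -> 0 < euclidean_integral f.
Proof. by have [_ _ _ H] := euclidean_integral_basic n; exact: H. Qed.

(** Uniform convergence of difference quotients suffices since all the
    integrands are supported in one box. *)
Lemma has_deriv_euclidean_integral n L (f : R -> 'rV[R]_n -> R) (f' : 'rV[R]_n -> R) :
  (\forall t \near (0 : R), boxed L (f t)) -> boxed L f' ->
  (forall e, 0 < e -> \forall t \near 0^', forall x, `|t^-1 * (f t x - f 0 x) - f' x| <= e) ->
  has_deriv (fun t => euclidean_integral (f t)) 0 (euclidean_integral f').
Proof.
move=> bf bf' uf; have bf0 : boxed L (f 0) by exact: nbhs_singleton bf.
apply/has_derivP; apply/cvgrPdist_le => /= e e0; have [L0 _ _] := bf'.
have p0 : 0 < (2 * L) ^+ n + 1 by rewrite ltr_wpDl // exprn_ge0 // mulr_ge0.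
pose d := e / ((2 * L) ^+ n + 1); have d0 : 0 < d by rewrite divr_gt0.
apply: filterS (punctI (near_punct bf) (uf d d0)) => t [bft Ht].
rewrite add0r distrC.
have -> : t^-1 * (euclidean_integral (f t) - euclidean_integral (f 0)) - euclidean_integral f' =
    euclidean_integral (fun x => 1 * (t^-1 * f t x + - t^-1 * f 0 x) + -1 * f' x).
  rewrite (euclidean_integral_lin _ _ (L := L)) //; last by apply: boxedD; exact: boxedZ.
  by rewrite (euclidean_integral_lin _ _ (L := L)) // mul1r mulN1r mulNr mulrBr.
apply: le_trans (euclidean_integral_bound (L := L) (e := d) _ _) _.
- by apply: boxedD; apply: boxedZ => //; apply: boxedD; exact: boxedZ.
- by move=> x; have := Ht x; rewrite mul1r mulN1r mulNr mulrBr.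
- by rewrite /d mulrAC ler_pdivrMr // ler_pM2l // lerDl.
Qed.

End EuclideanIntegral.

(** * The Christoffel form at a point of M *)

Section ChristoffelMatrix.
Variables (R : realType) (n : nat).
Implicit Types (g a b c : 'M[R]_n).

(** The difference between the covariant derivative and the derivative in
    the vector space of symmetric forms, at one point of M. *)
Definition christoffel g0 g a b : 'M[R]_n :=
  4^-1 *: (\tr (invmx g *m a) *: b + \tr (invmx g *m b) *: a)
  - (4^-1 * \tr (invmx g0 *m a *m (invmx g0 *m b))) *: (g0 *m (invmx g *m g0)).

Lemma christoffelC g0 g a b : christoffel g0 g a b = christoffel g0 g b a.
Proof.
by rewrite /christoffel [X in _ * X]mxtrace_mulC [X in _ *: X - _]addrC.
Qed.

Lemma christoffelDr g0 g a b b' :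
  christoffel g0 g a (b + b') = christoffel g0 g a b + christoffel g0 g a b'.
Proof.
rewrite /christoffel !mulmxDr !mxtraceD.
by apply/matrixP => i j; rewrite !mxE; ring.
Qed.

Lemma christoffelZr g0 g a (k : R) b :
  christoffel g0 g a (k *: b) = k *: christoffel g0 g a b.
Proof.
rewrite /christoffel -!scalemxAr !mxtraceZ.
by apply/matrixP => i j; rewrite !mxE; ring.
Qed.

Lemma christoffelBr g0 g a b b' :
  christoffel g0 g a (b - b') = christoffel g0 g a b - christoffel g0 g a b'.
Proof. by rewrite -scaleN1r christoffelDr christoffelZr scaleN1r. Qed.

Lemma christoffelBl g0 g a a' b :
  christoffel g0 g (a - a') b = christoffel g0 g a b - christoffel g0 g a' b.
Proof. by rewrite christoffelC christoffelBr !(christoffelC _ _ b). Qed.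

Lemma christoffel_tr g0 g a b : g0^T = g0 -> g^T = g -> a^T = a -> b^T = b ->
  (christoffel g0 g a b)^T = christoffel g0 g a b.
Proof.
move=> s0 s sa sb; rewrite /christoffel linearB /= !linearZ /= linearD /= !linearZ /= sa sb.
by rewrite !trmx_mul trmx_inv s s0 -!mulmxA.
Qed.

Lemma invmx_congr (J A : 'M[R]_n) : J \in unitmx -> A \in unitmx ->
  invmx (J^T *m A *m J) = invmx J *m invmx A *m invmx J^T.
Proof.
move=> uJ uA; have uJT : J^T \in unitmx by rewrite unitmx_tr.
have uB : J^T *m A *m J \in unitmx by rewrite !unitmx_mul uJT uA.
apply: (can_inj (mulKmx uB)); rewrite mulmxV // !mulmxA.
by rewrite (mulmxK uJ) (mulmxK uA) mulmxV.
Qed.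

Lemma christoffel_congr g0 g a b (J : 'M[R]_n) :
  J \in unitmx -> g0 \in unitmx -> g \in unitmx ->
  christoffel (J^T *m g0 *m J) (J^T *m g *m J) (J^T *m a *m J) (J^T *m b *m J) =
  J^T *m christoffel g0 g a b *m J.
Proof.
move=> uJ u0 u; have uJT : J^T \in unitmx by rewrite unitmx_tr.
have E A x : A \in unitmx -> invmx (J^T *m A *m J) *m (J^T *m x *m J) =
    invmx J *m (invmx A *m x) *m J.
  by move=> uA; rewrite invmx_congr // -!mulmxA (mulKmx uJT).
rewrite /christoffel !E // mulmx_conj // !mxtrace_conj //.
rewrite !mulmxBr !mulmxBl -!scalemxAr -!scalemxAl !mulmxDr !mulmxDl -!scalemxAr -!scalemxAl.
by congr (_ - _ *: _); rewrite -!mulmxA (mulKVmx uJ).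
Qed.

(** The last term of the Christoffel form is dual to c |-> tr (g^-1 c). *)
Lemma christoffel_pair g0 g a b c : g0 \in unitmx ->
  \tr (invmx g0 *m christoffel g0 g a b *m (invmx g0 *m c)) =
  4^-1 * (\tr (invmx g *m a) * \tr (invmx g0 *m b *m (invmx g0 *m c))
          + \tr (invmx g *m b) * \tr (invmx g0 *m a *m (invmx g0 *m c)))
  - 4^-1 * \tr (invmx g0 *m a *m (invmx g0 *m b)) * \tr (invmx g *m c).
Proof.
move=> u0; rewrite /christoffel !mulmxBr !mulmxBl -!scalemxAr -!scalemxAl.
rewrite !mulmxDr !mulmxDl -!scalemxAr -!scalemxAl.
rewrite raddfB /= !mxtraceZ mxtraceD !mxtraceZ.
by congr (_ - _ * \tr _); rewrite (mulKmx u0) -mulmxA (mulKVmx u0).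
Qed.

(** The terms with tr (g^-1 b) and tr (g^-1 c) cancel; what is left is the
    logarithmic derivative of the volume density in direction a. *)
Lemma christoffel_metric g0 g a b c : g0 \in unitmx ->
  \tr (invmx g0 *m christoffel g0 g a b *m (invmx g0 *m c))
  + \tr (invmx g0 *m b *m (invmx g0 *m christoffel g0 g a c)) =
  2^-1 * \tr (invmx g *m a) * \tr (invmx g0 *m b *m (invmx g0 *m c)).
Proof.
move=> u0; rewrite [X in _ + X]mxtrace_mulC !christoffel_pair //.
rewrite ![\tr (invmx g0 *m c *m (invmx g0 *m _))]mxtrace_mulC.
by field.
Qed.

(** The derivative of the Christoffel form in the base point g, in direction a. *)
Definition christoffel' g0 g a b c : 'M[R]_n :=
  4^-1 *: (- \tr (invmx g *m a *m (invmx g *m b)) *: c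
           - \tr (invmx g *m a *m (invmx g *m c)) *: b)
  + (4^-1 * \tr (invmx g0 *m b *m (invmx g0 *m c)))
      *: (g0 *m (invmx g *m a) *m (invmx g *m g0)).

Lemma mx_deriv_christoffel g0 (g b c : R -> 'M[R]_n) (a b' c' : 'M[R]_n) (t : R) :
  (\forall s \near t, g s \in unitmx) -> mx_deriv g t a ->
  mx_deriv b t b' -> mx_deriv c t c' ->
  mx_deriv (fun s => christoffel g0 (g s) (b s) (c s)) t
    (christoffel' g0 (g t) a (b t) (c t) + christoffel g0 (g t) b' (c t)
     + christoffel g0 (g t) (b t) c').
Proof.
move=> ug dg db dc; have di := mx_deriv_inv ug dg.
have dtr (x : R -> 'M[R]_n) x' : mx_deriv x t x' ->
    has_deriv (fun s => \tr (invmx (g s) *m x s)) t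
      (- \tr (invmx (g t) *m a *m (invmx (g t) *m x t)) + \tr (invmx (g t) *m x')).
  move=> dx; have := mx_deriv_tr (mx_derivM di dx).
  by rewrite mxtraceD mulNmx raddfN /= !mulmxA.
have d0 (x : R -> 'M[R]_n) x' : mx_deriv x t x' ->
    mx_deriv (fun s => invmx g0 *m x s) t (invmx g0 *m x').
  exact: mx_derivMl.
have D1 := mx_derivZ (has_deriv_cst 4^-1 t)
  (mx_derivD (mx_derivZ (dtr _ _ db) dc) (mx_derivZ (dtr _ _ dc) db)).
have D2 := mx_derivZ (has_derivZ 4^-1 (mx_deriv_tr (mx_derivM (d0 _ _ db) (d0 _ _ dc))))
  (mx_derivMl g0 (mx_derivMr g0 di)).
have D := mx_derivB D1 D2.
move=> i j; have := D i j; rewrite /christoffel /christoffel'.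
congr has_deriv.
rewrite !mulNmx !mulmxN !mulmxA mxtraceD.
rewrite !mxE.
move: (\tr _) (\tr _) (\tr _) (\tr _) (\tr _) (\tr _) (\tr _) (\tr _) => x1 x2 x3 x4 x5 x6 x7 x8.
move: (\sum_(_ < _) _) (\sum_(_ < _) _) => y1 y2.
by ring.
Qed.

(** Paired with a, the form H = g0 g^-1 g0 gives a multiple of a: the term
    tr (g^-1 a) H cancels against the last one. *)
Lemma christoffel_square g0 g a b c : g0 \in unitmx ->
  christoffel g0 g a (christoffel g0 g b c) =
  4^-1 *: (\tr (invmx g *m b) *: christoffel g0 g a c
           + \tr (invmx g *m c) *: christoffel g0 g a b)
  - (16^-1 * \tr (invmx g0 *m b *m (invmx g0 *m c))
     * \tr (invmx g *m g0 *m (invmx g *m g0))) *: a.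
Proof.
move=> u0; set H := g0 *m (invmx g *m g0).
have aH : christoffel g0 g a H = (4^-1 * \tr (invmx g *m g0 *m (invmx g *m g0))) *: a.
  rewrite {1}/christoffel.
  have -> : \tr (invmx g0 *m a *m (invmx g0 *m H)) = \tr (invmx g *m a).
    by rewrite /H (mulKmx u0) mxtrace_mulC -!mulmxA (mulKVmx u0).
  have -> : \tr (invmx g *m H) = \tr (invmx g *m g0 *m (invmx g *m g0)).
    by rewrite /H !mulmxA.
  by rewrite -/H; apply/matrixP => i j; rewrite !mxE; ring.
rewrite {2}/christoffel -/H christoffelBr !christoffelZr christoffelDr !christoffelZr aH.
by apply/matrixP => i j; rewrite !mxE; field.
Qed.

Definition curvature_form g0 g a b c : 'M[R]_n :=
  let A := invmx g *m a in let B := invmx g *m b in let C := invmx g *m c in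
  let A0 := invmx g0 *m a in let B0 := invmx g0 *m b in
  let C0 := invmx g0 *m c in let G := invmx g *m g0 in
  - 16^-1 *: ((4 * \tr (A *m C) + \tr A * \tr C) *: b
              - (4 * \tr (B *m C) + \tr B * \tr C) *: a)
  - (16^-1 * \tr (A0 *m C0)) *: (g0 *m (4 *: B + (\tr B)%:M) *m G)
  + (16^-1 * \tr (B0 *m C0)) *: (g0 *m (4 *: A + (\tr A)%:M) *m G)
  + (16^-1 * \tr (G *m G)) *: (\tr (A0 *m C0) *: b - \tr (B0 *m C0) *: a).

Lemma christoffel_curvature g0 g a b c : g0 \in unitmx ->
  christoffel' g0 g a b c - christoffel' g0 g b a c
  + (christoffel g0 g a (christoffel g0 g b c)
     - christoffel g0 g b (christoffel g0 g a c)) = curvature_form g0 g a b c.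
Proof.
move=> u0; rewrite /curvature_form; set A := invmx g *m a; set B := invmx g *m b.
set C := invmx g *m c; set A0 := invmx g0 *m a; set B0 := invmx g0 *m b.
set C0 := invmx g0 *m c; set G := invmx g *m g0; rewrite !christoffel_square //.
rewrite /christoffel' -/A -/B -/C -/A0 -/B0 -/C0 -/G.
rewrite /christoffel -/A -/B -/C -/A0 -/B0 -/C0 -/G.
rewrite (mxtrace_mulC B A) (mxtrace_mulC B0 A0).
have E X x : g0 *m (4 *: X + x%:M) *m G = 4 *: (g0 *m X *m G) + x *: (g0 *m G).
  by rewrite mulmxDr mulmxDl -scalemxAr -scalemxAl mul_mx_scalar -scalemxAl.
rewrite !E; move: (g0 *m B *m G) (g0 *m A *m G) (g0 *m G) => gB gA gG.
move: (\tr (A *m B)) (\tr (A *m C)) (\tr (B *m C)) (\tr A) (\tr B) (\tr C) => tAB tAC tBC tA tB tC.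
move: (\tr (A0 *m B0)) (\tr (A0 *m C0)) (\tr (B0 *m C0)) (\tr (G *m G)) => sAB sAC sBC tG.
apply/matrixP => i j; rewrite !mxE.
by field.
Qed.

End ChristoffelMatrix.

(** * The connection defined by the Christoffel form, and its curvature *)

(** In the application k and k' come from the derivative of the Christoffel form
    in the base point, s and s' from its square, and the other terms contain
    derivatives of the fields. *)
Lemma curvature_cancel (R : realType) (n : nat) (x x' k k' y y' z z' s s' : 'M[R]_n) :
  x + (k + y + z) + (z' + s) - (x' + (k' + y' + z') + (z + s')) - (x - x' + (y - y')) =
  k - k' + (s - s').
Proof. by apply/matrixP => i j; rewrite !mxE; ring. Qed.

Section LeviCivita.
Variables (R : realType) (n : nat) (M : closed_manifold R n) (g0 : tensor M).
Hypothesis mg0 : metric g0.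
Implicit Types (g v : tensor M) (i : chart_index M) (p : M) (f : field M).

Definition Gamma g v w : tensor M :=
  fun i p => christoffel (g0 i p) (g i p) (v i p) (w i p).

Lemma smooth_christoffel k (D : set 'rV[R]_k) (h0 h a b : 'rV[R]_k -> 'M[R]_n) :
  open D -> (forall x, D x -> h0 x \in unitmx) -> (forall x, D x -> h x \in unitmx) ->
  smooth_mx D h0 -> smooth_mx D h -> smooth_mx D a -> smooth_mx D b ->
  smooth_mx D (fun x => christoffel (h0 x) (h x) (a x) (b x)).
Proof.
move=> oD u0 u s0 sh sa sb.
have si := smooth_inv oD u sh; have si0 := smooth_inv oD u0 s0.
have sc := smooth_cst (4^-1 : R) oD.
have tA := smooth_tr oD (smooth_mxM oD si sa).
have tB := smooth_tr oD (smooth_mxM oD si sb).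
have tAB := smooth_tr oD (smooth_mxM oD (smooth_mxM oD si0 sa) (smooth_mxM oD si0 sb)).
apply: (smooth_mxD oD).
  apply: (smooth_mxZ oD sc).
  exact: (smooth_mxD oD (smooth_mxZ oD tA sb) (smooth_mxZ oD tB sa)).
apply: (smooth_mxN oD); apply: (smooth_mxZ oD (smoothM oD sc tAB)).
exact: (smooth_mxM oD s0 (smooth_mxM oD si s0)).
Qed.

Lemma smooth_Gamma k (U : set 'rV[R]_k) (F V W : 'rV[R]_k -> tensor M) :
  open U -> smooth_family U F -> (forall u, U u -> metric (F u)) ->
  smooth_family U V -> smooth_family U W ->
  smooth_family U (fun u => Gamma (F u) (V u) (W u)).
Proof.
move=> oU sF mF sV sW; have s0 := const_family oU (metric_S2 mg0).
apply: mk_family => // [u Uu i p np|u Uu i p|u Uu i j p di dj J|i].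
- rewrite /Gamma (S2_off (metric_S2 mg0) np) (S2_off (family_S2 sV Uu) np).
  rewrite (S2_off (family_S2 sW Uu) np) /christoffel !mulmx0 !mxtrace0.
  by rewrite !scale0r addr0 !scaler0 subrr.
- apply: christoffel_tr; first exact: (S2_sym (metric_S2 mg0)).
  + exact: (S2_sym (family_S2 sF Uu)).
  + exact: (S2_sym (family_S2 sV Uu)).
  + exact: (S2_sym (family_S2 sW Uu)).
- rewrite /Gamma (S2_transform (metric_S2 mg0) di dj) (S2_transform (family_S2 sF Uu) di dj).
  rewrite (S2_transform (family_S2 sV Uu) di dj) (S2_transform (family_S2 sW Uu) di dj).
  apply: christoffel_congr; first exact: jac_unit mg0 di dj.
    exact: metric_unit mg0 dj.
  exact: metric_unit (mF u Uu) dj.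
- apply: (smooth_christoffel (fdom_open i oU) (h0 := jmx (fun=> g0) i) (h := jmx F i)
    (a := jmx V i) (b := jmx W i)).
  + by move=> w Dw; apply: metric_unit mg0 (fdom_dom Dw).
  + by move=> w Dw; apply: metric_unit (mF _ Dw.1) (fdom_dom Dw).
  + exact: (family_mx s0 i).
  + exact: (family_mx sF i).
  + exact: (family_mx sV i).
  + exact: (family_mx sW i).
Qed.

Lemma S2_Gamma g v w : metric g -> S2 v -> S2 w -> S2 (Gamma g v w).
Proof.
move=> mg /S2_family sv /S2_family sw; have /S2_family sg := metric_S2 mg.
by apply/S2_family; exact: (smooth_Gamma openT sg (fun _ _ => mg) sv sw).
Qed.

Definition levi_civita (a b : field M) : field M :=
  fun g => dir_deriv b (a g) g + Gamma g (a g) (b g).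

Section Fields.
Variables a b : field M.
Hypotheses (sa : smooth_field a) (sb : smooth_field b).

Lemma smooth_dir_field : smooth_field (fun g => dir_deriv b (a g) g).
Proof. by move=> k U F oU sF mF; exact: (smooth_dir oU sF (sa oU sF mF) sb mF). Qed.

Lemma smooth_levi_civita : smooth_field (levi_civita a b).
Proof.
move=> k U F oU sF mF; apply: (smooth_familyD oU).
  exact: (smooth_dir_field oU sF mF).
exact: (smooth_Gamma oU sF mF (sa oU sF mF) (sb oU sF mF)).
Qed.

Lemma smooth_fieldD : smooth_field (fun h => a h + b h).
Proof.
by move=> k U F oU sF mF; exact: (smooth_familyD oU (sa oU sF mF) (sb oU sF mF)).
Qed.

Lemma smooth_fieldZ (phi : tensor M -> R) : smooth_scalar phi ->
  smooth_field (fun h => phi h *: a h).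
Proof.
by move=> sp k U F oU sF mF; exact: (smooth_familyZ oU (sp _ _ _ oU sF mF) (sa oU sF mF)).
Qed.

Lemma smooth_bracket : smooth_field (bracket a b).
Proof.
move=> k U F oU sF mF; rewrite /bracket.
have s1 := smooth_dir oU sF (sa oU sF mF) sb mF.
have s2 := smooth_dir oU sF (sb oU sF mF) sa mF.
have := smooth_familyD oU s1 (smooth_familyZ oU (smooth_cst (-1) oU) s2).
by apply: smooth_family_eq => // u _; rewrite scaleN1r.
Qed.

End Fields.

Lemma smooth_const_field v : S2 v -> smooth_field (cst v).
Proof. by move=> Sv k U F oU sF mF; exact: (const_family oU Sv). Qed.

Lemma dir_addr (b b' : field M) g v : smooth_field b -> smooth_field b' ->
  metric g -> S2 v ->
  dir_deriv (fun h => b h + b' h) v g = dir_deriv b v g + dir_deriv b' v g.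
Proof.
move=> sb sb' mg Sv; apply: tensorP => i p.
apply: (mx_deriv_uniq (dir_mx mg Sv i p (smooth_fieldD sb sb'))).
exact: (mx_derivD (dir_mx mg Sv i p sb) (dir_mx mg Sv i p sb')).
Qed.

Lemma dir_leibniz (phi : tensor M -> R) (b : field M) g v : smooth_scalar phi ->
  smooth_field b -> metric g -> S2 v ->
  dir_deriv (fun h => phi h *: b h) v g =
  derive1 (fun t : R => phi (g + t *: v)) 0 *: b g + phi g *: dir_deriv b v g.
Proof.
move=> sp sb mg Sv; apply: tensorP => i p.
apply: (mx_deriv_uniq (dir_mx mg Sv i p (smooth_fieldZ sb sp))).
have := mx_derivZ (dir_scalar mg Sv sp) (dir_mx mg Sv i p sb).
by rewrite scale0r addr0.
Qed.

Lemma dir_eq (b b' : field M) g v : smooth_field b -> smooth_field b' ->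
  (forall h, metric h -> b h = b' h) -> metric g -> S2 v ->
  dir_deriv b v g = dir_deriv b' v g.
Proof.
move=> sb sb' bb' mg Sv; apply: tensorP => i p.
apply: (mx_deriv_uniq (dir_mx mg Sv i p sb)).
apply: mx_deriv_near (dir_mx mg Sv i p sb').
by apply: filterS (metric_line mg Sv) => t /bb' ->.
Qed.

Lemma dir_Gamma (b c : field M) g v i p : smooth_field b -> smooth_field c ->
  metric g -> S2 v -> dom i p ->
  mx_deriv (fun t => Gamma (g + t *: v) (b (g + t *: v)) (c (g + t *: v)) i p) 0
    (christoffel' (g0 i p) (g i p) (v i p) (b g i p) (c g i p)
     + Gamma g (dir_deriv b v g) (c g) i p + Gamma g (b g) (dir_deriv c v g) i p).
Proof.
move=> sb sc mg Sv dp.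
have ug : \forall t \near (0 : R), (g + t *: v) i p \in unitmx.
  by apply: filterS (metric_line mg Sv) => t mt; exact: metric_unit mt dp.
have dg : mx_deriv (fun t => (g + t *: v) i p) 0 (v i p).
  have := mx_derivD (mx_deriv_cst 0 (g i p)) (mx_derivZ (has_deriv_id 0) (mx_deriv_cst 0 (v i p))).
  by rewrite scaler0 addr0 scale1r add0r.
have := mx_deriv_christoffel (g0 i p) ug dg (dir_mx mg Sv i p sb) (dir_mx mg Sv i p sc).
by rewrite /Gamma scale0r addr0.
Qed.

(** The terms with second derivatives cancel in the curvature, and what is
    left is the curvature of the Christoffel form at a point. *)
Lemma levi_civita_curvature (a b c : field M) g i p :
  smooth_field a -> smooth_field b -> smooth_field c -> metric g -> dom i p ->
  curvature levi_civita a b c g i p =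
  christoffel' (g0 i p) (g i p) (a g i p) (b g i p) (c g i p)
  - christoffel' (g0 i p) (g i p) (b g i p) (a g i p) (c g i p)
  + (Gamma g (a g) (Gamma g (b g) (c g)) i p - Gamma g (b g) (Gamma g (a g) (c g)) i p).
Proof.
move=> sa sb sc mg dp.
have Sa := field_S2 mg sa; have Sb := field_S2 mg sb.
have D x y : smooth_field x -> smooth_field y ->
   dir_deriv (levi_civita y c) (x g) g i p =
   dir_deriv (fun h => dir_deriv c (y h) h) (x g) g i p +
   (christoffel' (g0 i p) (g i p) (x g i p) (y g i p) (c g i p)
     + Gamma g (dir_deriv y (x g) g) (c g) i p + Gamma g (y g) (dir_deriv c (x g) g) i p).
  move=> sx sy; have Sx := field_S2 mg sx.
  apply: (mx_deriv_uniq (dir_mx mg Sx i p (smooth_levi_civita sy sc))).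
  exact: (mx_derivD (dir_mx mg Sx i p (smooth_dir_field sy sc)) (dir_Gamma sy sc mg Sx dp)).
have C : dir_deriv (fun h => dir_deriv c (b h) h) (a g) g i p -
   dir_deriv (fun h => dir_deriv c (a h) h) (b g) g i p = dir_deriv c (bracket a b g) g i p.
  by rewrite -(dir_commutator sa sb sc mg).
have E x y : smooth_field x -> smooth_field y ->
  levi_civita x (levi_civita y c) g i p =
   dir_deriv (fun h => dir_deriv c (y h) h) (x g) g i p +
   (christoffel' (g0 i p) (g i p) (x g i p) (y g i p) (c g i p)
     + Gamma g (dir_deriv y (x g) g) (c g) i p + Gamma g (y g) (dir_deriv c (x g) g) i p)
   + (Gamma g (x g) (dir_deriv c (y g) g) i p + Gamma g (x g) (Gamma g (y g) (c g)) i p).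
  move=> sx sy; rewrite {1}/levi_civita tensorDE (D x y sx sy); congr (_ + _).
  exact: christoffelDr.
have E' : levi_civita (bracket a b) c g i p =
    (dir_deriv (fun h => dir_deriv c (b h) h) (a g) g i p -
     dir_deriv (fun h => dir_deriv c (a h) h) (b g) g i p) +
    (Gamma g (dir_deriv b (a g) g) (c g) i p - Gamma g (dir_deriv a (b g) g) (c g) i p).
  rewrite /levi_civita tensorDE -C; congr (_ + _); exact: christoffelBl.
apply: (etrans (y := levi_civita a (levi_civita b c) g i p
  - levi_civita b (levi_civita a c) g i p - levi_civita (bracket a b) c g i p)); first by [].
rewrite (E a b sa sb) (E b a sb sa) E'.
exact: curvature_cancel.
Qed.

End LeviCivita.

(** * Integration over M and the inner product *)

Lemma row_hausdorff (R : realType) (n : nat) : hausdorff_space 'rV[R]_n.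
Proof.
move=> x y xy; apply/rowP => j; apply: Rhausdorff => A B xA yB.
have [z [zA zB]] := xy _ _ (coord_continuous (i := 0) (j := j) xA)
  (coord_continuous (i := 0) (j := j) yB).
by exists (z 0 j).
Qed.

Section Cutoff.
Variables (R : realType) (n : nat) (M : closed_manifold R n) (P : partition_of_unity M).
Implicit Types (m : 'I_(pu_size P)) (h : 'rV[R]_n -> R).

(** The integrands of integral_vol have this form. *)
Definition cutoff m h : 'rV[R]_n -> R :=
  (fun x => pu_fun m (chart_inv (atlas (pu_chart m)) x) * h x) \_ (img (pu_chart m)).

Lemma cutoff_in m h x : img (pu_chart m) x ->
  cutoff m h x = pu_fun m (chart_inv (atlas (pu_chart m)) x) * h x.
Proof. by move=> ix; rewrite /cutoff patchE mem_set. Qed.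

Lemma cutoff_out m h x : ~ img (pu_chart m) x -> cutoff m h x = 0.
Proof. by move=> ix; rewrite /cutoff patchE memNset. Qed.

Lemma pu_le1 m (p : M) : pu_fun m p <= 1.
Proof.
rewrite -(pu_sum P p) (bigD1 m) //= lerDl; apply: sumr_ge0 => j _; exact: pu_ge0.
Qed.

Definition support_image m : set 'rV[R]_n :=
  chart_map (atlas (pu_chart m)) @` closure [set p | pu_fun m p != 0].

Lemma support_image_compact m : compact (support_image m).
Proof.
apply: continuous_compact; last first.
  apply: subclosed_compact (@points_compact R n M) _; [exact: closed_closure|by []].
apply: continuous_in_subspaceT => p /set_mem pp.
by apply: (@chart_map_cont _ _ _ (atlas (pu_chart m))); exact: mem_set (pu_supp pp).
Qed.

Lemma support_image_sub m : support_image m `<=` img (pu_chart m).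
Proof. by move=> x [p pp <-]; exists p => //; exact: pu_supp pp. Qed.

Lemma cutoff_support m h x : ~ support_image m x -> cutoff m h x = 0.
Proof.
move=> nx; have [ix|/(cutoff_out h) //] := pselect (img (pu_chart m) x).
rewrite cutoff_in //; have [_ mx] := img_inv ix.
have [->|p0] := eqVneq (pu_fun m (chart_inv (atlas (pu_chart m)) x)) 0; first by rewrite mul0r.
case: nx; exists (chart_inv (atlas (pu_chart m)) x) => //.
exact: subset_closure.
Qed.

Lemma support_image_box m : exists L : R, 0 <= L /\
  forall x, support_image m x -> forall j, `|x 0 j| <= L.
Proof.
have B j : exists L : R, forall x, support_image m x -> `|x 0 j| <= L.
  have : compact ((fun x : 'rV[R]_n => x 0 j) @` support_image m).
    have C : {within support_image m, continuous (fun x : 'rV[R]_n => x 0 j)}.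
      by apply: continuous_subspaceT => x; exact: coord_continuous.
    exact: (continuous_compact C (@support_image_compact m)).
  move=> /compact_bounded [L [_ HL]]; exists (L + 1) => x sx.
  by apply: HL; [rewrite ltrDl|exists x].
have [L HL] := choice B.
exists (\sum_j `|L j|); split=> [|x sx j]; first exact: sumr_ge0.
apply: le_trans (HL j x sx) _; apply: le_trans (ler_norm _) _.
by rewrite (bigD1 j) //= lerDl; exact: sumr_ge0.
Qed.

(** The cutoff of a function that is continuous on the chart is continuous
    everywhere, because the support is compact, hence closed. *)
Lemma cutoff_boxed m : exists L : R, forall h,
  (forall x, img (pu_chart m) x -> {for x, continuous h}) -> boxed L (cutoff m h).
Proof.
have [L [L0 HL]] := support_image_box m; exists L => h ch; split=> // [x|x j Lx]; last first.
  by apply: cutoff_support => sx; have := HL x sx j; rewrite leNgt Lx.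
have [ix|nix] := pselect (img (pu_chart m) x).
  have N : \forall y \near x, pu_fun m (chart_inv (atlas (pu_chart m)) y) * h y = cutoff m h y.
    have : \forall y \near x, img (pu_chart m) y by apply: open_nbhs_nbhs; split=> //; exact: img_open.
    by apply: filterS => y iy; rewrite cutoff_in.
  rewrite cutoff_in //; apply: cvg_trans; first by apply: near_eq_cvg; exact: N.
  have C : {for x, continuous (pu_fun m \o chart_inv (atlas (pu_chart m)))}.
    exact: (smooth_cont (@pu_smooth _ _ _ P m (pu_chart m)) ix).
  by apply: cvgM; [exact: C|exact: ch].
have nx : ~ support_image m x by move=> /support_image_sub.
have cl := compact_closed (@row_hausdorff R n) (@support_image_compact m).
have : \forall y \near x, ~ support_image m y.
  by apply: open_nbhs_nbhs; split=> //; exact: closed_openC.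
rewrite (cutoff_support h nx) => N.
apply: cvg_trans (@cvg_cst _ (0 : R) _ _ (nbhs_filter x)).
by apply: near_eq_cvg; apply: filterS N => y /(cutoff_support h) ->.
Qed.

Definition chart_integral m h : R := euclidean_integral (cutoff m h).

Lemma integral_volE g (f : M -> R) : integral_vol P g f =
  \sum_m chart_integral m (fun x => let p := chart_inv (atlas (pu_chart m)) x in
    f p * vol_density g (pu_chart m) p).
Proof.
apply: eq_bigr => m _; rewrite /chart_integral /cutoff; congr euclidean_integral.
by congr patch; apply/funext => x /=; rewrite mulrA.
Qed.

Lemma eq_chart_integral m h h' : (forall x, img (pu_chart m) x -> h x = h' x) ->
  chart_integral m h = chart_integral m h'.
Proof.
move=> hh'; congr euclidean_integral; apply/funext => x.
have [ix|ix] := pselect (img (pu_chart m) x); first by rewrite !cutoff_in // hh'.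
by rewrite !cutoff_out.
Qed.

Lemma chart_integral_lin m h h' c d :
  (forall x, img (pu_chart m) x -> {for x, continuous h}) ->
  (forall x, img (pu_chart m) x -> {for x, continuous h'}) ->
  chart_integral m (fun x => c * h x + d * h' x) =
  c * chart_integral m h + d * chart_integral m h'.
Proof.
move=> ch ch'; have [L HL] := cutoff_boxed m.
rewrite /chart_integral -(euclidean_integral_lin c d (HL h ch) (HL h' ch')).
congr euclidean_integral; apply/funext => x.
have [ix|ix] := pselect (img (pu_chart m) x); first by rewrite !cutoff_in //; ring.
by rewrite !cutoff_out // !mulr0 addr0.
Qed.

Lemma chart_integral_ge0 m h :
  (forall x, img (pu_chart m) x -> {for x, continuous h}) ->
  (forall x, img (pu_chart m) x -> 0 <= h x) -> 0 <= chart_integral m h.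
Proof.
move=> ch h0; have [L HL] := cutoff_boxed m; apply: (euclidean_integral_ge0 (HL h ch)) => x.
have [ix|ix] := pselect (img (pu_chart m) x); last by rewrite cutoff_out.
by rewrite cutoff_in // mulr_ge0 ?pu_ge0 ?h0.
Qed.

Lemma chart_integral_gt0 m h p :
  (forall x, img (pu_chart m) x -> {for x, continuous h}) ->
  (forall x, img (pu_chart m) x -> 0 <= h x) ->
  0 < pu_fun m p -> 0 < h (chart_map (atlas (pu_chart m)) p) -> 0 < chart_integral m h.
Proof.
move=> ch h0 pp hp; have [L HL] := cutoff_boxed m.
have dp : dom (pu_chart m) p by apply: pu_supp; apply: subset_closure; rewrite /= gt_eqF.
have [ix invx] := dom_img dp.
apply: (euclidean_integral_gt0 (x := chart_map (atlas (pu_chart m)) p) (HL h ch)) => [x|].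
  have [ix'|ix'] := pselect (img (pu_chart m) x); last by rewrite cutoff_out.
  by rewrite cutoff_in // mulr_ge0 ?pu_ge0 ?h0.
by rewrite cutoff_in // invx mulr_gt0.
Qed.

(** Uniform convergence on compact subsets of the chart is enough because the
    support of the cutoff is one of them. *)
Lemma has_deriv_chart_integral m (h : R -> 'rV[R]_n -> R) h' :
  (\forall t \near (0 : R), forall x, img (pu_chart m) x -> {for x, continuous (h t)}) ->
  (forall x, img (pu_chart m) x -> {for x, continuous h'}) ->
  (forall K : set 'rV[R]_n, compact K -> K `<=` img (pu_chart m) -> forall e : R, 0 < e ->
    \forall t \near 0^', forall x, K x -> `|t^-1 * (h t x - h 0 x) - h' x| <= e) ->
  has_deriv (fun t => chart_integral m (h t)) 0 (chart_integral m h').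
Proof.
move=> ch ch' uh; have [L HL] := cutoff_boxed m.
apply: (has_deriv_euclidean_integral (f := fun t => cutoff m (h t)) (L := L)).
- by apply: filterS ch => t /HL.
- exact: HL.
- move=> e e0; have := uh _ (@support_image_compact m) (@support_image_sub m) e e0.
  apply: filterS => t Ht x; have [sx|sx] := pselect (support_image m x); last first.
    by rewrite !(cutoff_support _ sx) subrr mulr0 subrr normr0 ltW.
  have ix := support_image_sub sx; rewrite !cutoff_in //.
  set w := pu_fun m _.
  have -> : t^-1 * (w * h t x - w * h 0 x) - w * h' x =
     w * (t^-1 * (h t x - h 0 x) - h' x) by ring.
  rewrite normrM ger0_norm ?pu_ge0 //; apply: le_trans (Ht x sx).
  by rewrite ler_piMl // pu_le1.
Qed.

End Cutoff.

Section InnerProduct.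
Variables (R : realType) (n : nat) (M : closed_manifold R n) (P : partition_of_unity M).
Variables (g0 : tensor M).
Hypothesis mg0 : metric g0.
Implicit Types (g v : tensor M) (i : chart_index M) (p : M).

(** The trace tr0 is computed in the preferred chart of each point, which may
    vary without continuity; in a fixed chart the integrand is smooth. *)
Definition density g v w i p : R :=
  \tr (raise g0 v i p *m raise g0 w i p) * vol_density g i p.

Lemma smooth_density_mx k (D : set 'rV[R]_k) (h0 h a b : 'rV[R]_k -> 'M[R]_n) :
  open D -> (forall x, D x -> h0 x \in unitmx) -> (forall x, D x -> posdef (h x)) ->
  smooth_mx D h0 -> smooth_mx D h -> smooth_mx D a -> smooth_mx D b ->
  smooth_on D (fun x => \tr (invmx (h0 x) *m a x *m (invmx (h0 x) *m b x))
     * Num.sqrt (\det (h x))).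
Proof.
move=> oD u0 ph s0 sh sa sb; have si := smooth_inv oD u0 s0.
apply: (smoothM oD).
  exact: (smooth_tr oD (smooth_mxM oD (smooth_mxM oD si sa) (smooth_mxM oD si sb))).
by apply: (smooth_sqrt oD _ (smooth_det oD sh)) => x Dx; apply: posdef_det; exact: ph.
Qed.

Lemma density_cont g v w i x : metric g -> S2 v -> S2 w -> img i x ->
  {for x, continuous (fun x => density g v w i (chart_inv (atlas i) x))}.
Proof.
move=> mg Sv Sw ix; apply: smooth_cont ix.
apply: (smooth_density_mx (img_open i) (h0 := fun x => g0 i (chart_inv (atlas i) x))
  (h := fun x => g i (chart_inv (atlas i) x)) (a := fun x => v i (chart_inv (atlas i) x))
  (b := fun x => w i (chart_inv (atlas i) x))).
- by move=> y /img_inv[dy _]; exact: metric_unit mg0 dy.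
- by move=> y /img_inv[dy _]; exact: metric_posdef mg dy.
- by case: (metric_S2 mg0) => _ _ _ /(_ i).
- by case: (metric_S2 mg) => _ _ _ /(_ i).
- by case: Sv => _ _ _ /(_ i).
- by case: Sw => _ _ _ /(_ i).
Qed.

Lemma inner_chart g v w : S2 v -> S2 w -> inner P g0 g v w =
  \sum_(m < pu_size P) chart_integral m (fun x =>
    density g v w (pu_chart m) (chart_inv (atlas (pu_chart m)) x)).
Proof.
move=> Sv Sw; rewrite /inner integral_volE; apply: eq_bigr => m _.
apply: eq_chart_integral => x /img_inv[dx _]; rewrite /= /tr0 /density.
by rewrite (tr_raise2_chart mg0 Sv Sw (chart_atP _) dx).
Qed.

Lemma innerC g v w : inner P g0 g v w = inner P g0 g w v.
Proof.
by congr integral_vol; apply/funext => p; rewrite /tr0 mxtrace_mulC.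
Qed.

Lemma densityDl g v v' w i p (c d : R) :
  density g (c *: v + d *: v') w i p = c * density g v w i p + d * density g v' w i p.
Proof.
rewrite /density /raise tensorDE !tensorZE mulmxDr -!scalemxAr mulmxDl -!scalemxAl.
by rewrite mxtraceD !mxtraceZ; ring.
Qed.

Lemma inner_lin g v v' w (c d : R) : metric g -> S2 v -> S2 v' -> S2 w ->
  inner P g0 g (c *: v + d *: v') w = c * inner P g0 g v w + d * inner P g0 g v' w.
Proof.
move=> mg Sv Sv' Sw; have Sc := S2D (S2Z c Sv) (S2Z d Sv').
rewrite !inner_chart // !mulr_sumr -big_split /=; apply: eq_bigr => m _.
rewrite -(chart_integral_lin (m := m) c d (fun x ix => density_cont mg Sv Sw ix)
  (fun x ix => density_cont mg Sv' Sw ix)).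
by apply: eq_chart_integral => x _; exact: densityDl.
Qed.

(** A nonzero value of v at a point gives a positive integrand in a chart of the
    partition of unity that does not vanish there. *)
Lemma inner_pos g v : metric g -> S2 v -> inner P g0 g v v = 0 -> v = 0.
Proof.
move=> mg Sv; rewrite inner_chart // => s0.
have C m x := @density_cont g v v (pu_chart (p0 := P) m) x mg Sv Sv.
have tr_ge0 i p : dom i p -> 0 <= \tr (raise g0 v i p *m raise g0 v i p)
    ?= iff (v i p == 0).
  by move=> dp; exact: (posdef_tr (metric_posdef mg0 dp) (S2_sym Sv i p)).
have D m x : img (pu_chart (p0 := P) m) x ->
   0 <= density g v v (pu_chart m) (chart_inv (atlas (pu_chart m)) x).
  move=> /img_inv[dx _]; apply: mulr_ge0; first exact: (tr_ge0 _ _ dx).1.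
  by apply: ltW; exact: vol_density_gt0.
apply: tensorP => i p; rewrite [RHS]/=.
have [dp|ndp] := pselect (dom i p); last exact: (S2_off Sv).
have [m pm] : exists m, 0 < pu_fun (p0 := P) m p.
  apply/not_existsP => H; have := pu_sum P p; rewrite big1 => [/eqP|m _].
    by rewrite eq_sym oner_eq0.
  by apply/eqP; rewrite eq_le pu_ge0 andbT leNgt; apply/negP; exact: H.
have dm : dom (pu_chart m) p by apply: pu_supp; apply: subset_closure; rewrite /= gt_eqF.
apply/eqP; apply: contraT => vp.
have vm : v (pu_chart m) p != 0.
  apply: contraNneq vp => vm; rewrite (S2_transform Sv dp dm) vm mulmx0 mul0mx.
  by [].
have : 0 < \sum_(m < pu_size P) chart_integral m (fun x =>
    density g v v (pu_chart m) (chart_inv (atlas (pu_chart m)) x)).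
  rewrite (bigD1 m) //= ltr_wpDr //.
    by apply: sumr_ge0 => m' _; apply: chart_integral_ge0; [exact: C|exact: D].
  apply: (chart_integral_gt0 (p := p)) => //; first exact: C.
    exact: D.
  rewrite (dom_img dm).2 mulr_gt0 ?vol_density_gt0 //.
  by have [t0 t1] := tr_ge0 _ _ dm; rewrite lt_neqAle t0 andbT t1.
by rewrite s0 ltxx.
Qed.

(** Half the trace of the direction is the logarithmic derivative of the volume
    density, and it is what the Christoffel terms contribute. *)
Lemma has_deriv_density (b c : field M) g v i p : smooth_field b -> smooth_field c ->
  metric g -> S2 v -> dom i p ->
  has_deriv (fun t => density (g + t *: v) (b (g + t *: v)) (c (g + t *: v)) i p) 0
    (density g (dir_deriv b v g + Gamma g0 g v (b g)) (c g) i p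
     + density g (b g) (dir_deriv c v g + Gamma g0 g v (c g)) i p).
Proof.
move=> sb sc mg Sv dp.
have gi : (g + (0 : R) *: v) = g by rewrite scale0r addr0.
have dg : mx_deriv (fun t => (g + t *: v) i p) 0 (v i p).
  have := mx_derivD (mx_deriv_cst 0 (g i p)) (mx_derivZ (has_deriv_id 0) (mx_deriv_cst 0 (v i p))).
  by rewrite scaler0 addr0 scale1r add0r.
have pg : 0 < \det ((g + (0 : R) *: v) i p) by rewrite gi; apply: posdef_det; exact: metric_posdef.
have dv := has_deriv_sqrt_det pg dg.
have db := mx_derivMl (invmx (g0 i p)) (dir_mx mg Sv i p sb).
have dc := mx_derivMl (invmx (g0 i p)) (dir_mx mg Sv i p sc).
have D := has_derivM (mx_deriv_tr (mx_derivM db dc)) dv.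
move: D; rewrite gi; congr has_deriv.
have := christoffel_metric (g i p) (v i p) (b g i p) (c g i p) (metric_unit mg0 dp).
rewrite /density /raise !tensorDE /Gamma -/(vol_density g i p).
move: (christoffel _ _ _ (b g i p)) (christoffel _ _ _ (c g i p)) => y1 y2.
rewrite !mulmxDr !mulmxDl !mxtraceD.
set x := \tr (_ *m y1 *m _); set y := \tr (_ *m (_ *m y2)) => H.
move: (\tr (_ *m dir_deriv b v g i p *m _)) (\tr (_ *m (_ *m dir_deriv c v g i p))) => t1 t2.
have -> : (t1 + x) * vol_density g i p + (t2 + y) * vol_density g i p =
  (t1 + t2) * vol_density g i p + (x + y) * vol_density g i p by ring.
by rewrite H; ring.
Qed.

(** Compatibility with the inner product: differentiate under the integral sign
    and apply the identity at each point. *)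
Lemma has_deriv_inner (b c : field M) g v : smooth_field b -> smooth_field c ->
  metric g -> S2 v ->
  has_deriv (fun t => inner P g0 (g + t *: v) (b (g + t *: v)) (c (g + t *: v))) 0
    (inner P g0 g (dir_deriv b v g + Gamma g0 g v (b g)) (c g)
     + inner P g0 g (b g) (dir_deriv c v g + Gamma g0 g v (c g))).
Proof.
move=> sb sc mg Sv; have Sb := field_S2 mg sb; have Sc := field_S2 mg sc.
have Lb : S2 (dir_deriv b v g + Gamma g0 g v (b g)).
  by apply: S2D; [exact: S2_curve|exact: (S2_Gamma mg0)].
have Lc : S2 (dir_deriv c v g + Gamma g0 g v (c g)).
  by apply: S2D; [exact: S2_curve|exact: (S2_Gamma mg0)].
pose h (t : R) i x := density (g + t *: v) (b (g + t *: v)) (c (g + t *: v)) i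
  (chart_inv (atlas i) x).
apply: (has_deriv_near (f := fun t => \sum_m chart_integral m (h t (pu_chart (p0 := P) m)))).
  apply: filterS (metric_line mg Sv) => t mt.
  by rewrite (inner_chart _ (field_S2 mt sb) (field_S2 mt sc)).
rewrite !inner_chart // -big_split /=; apply: has_deriv_sum => m.
set i := pu_chart m.
have C1 x (ix : img i x) := density_cont mg Lb Sc ix.
have C2 x (ix : img i x) := density_cont mg Sb Lc ix.
have := chart_integral_lin (m := m) 1 1 C1 C2; rewrite !mul1r => <-.
apply: has_deriv_chart_integral.
- apply: filterS (metric_line mg Sv) => t mt x ix.
  exact: (density_cont mt (field_S2 mt sb) (field_S2 mt sc) ix).
- move=> x ix; apply: cvgD; apply: cvgM; try exact: cvg_cst.
    exact: C1.
  exact: C2.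
move=> K cK Ki e e0.
have /S2_family sg := metric_S2 mg; have /S2_family sv := Sv.
have oU := push_dom_open openT sg sv; have sF := smooth_push_metric openT sg sv.
set U := push_dom _ _ _ in oU sF; set F := push _ _ in sF.
have mF u : U u -> metric (F u) by case.
have sB := sb _ _ _ oU sF mF; have sC := sc _ _ _ oU sF mF.
have s0 := const_family oU (metric_S2 mg0).
pose f (w : 'rV[R]_((1 + 0) + n)) := density (F (lsubmx w)) (b (F (lsubmx w)))
  (c (F (lsubmx w))) i (chart_inv (atlas i) (rsubmx w)).
have sf : smooth_on (fdom U i) f.
  apply: (smooth_density_mx (fdom_open i oU) (h0 := jmx (fun=> g0) i) (h := jmx F i)
    (a := jmx (b \o F) i) (b := jmx (c \o F) i)).
  + by move=> w Dw; exact: metric_unit mg0 (fdom_dom Dw).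
  + by move=> w Dw; exact: metric_posdef (mF _ Dw.1) (fdom_dom Dw).
  + exact: (family_mx s0 i).
  + exact: (family_mx sF i).
  + exact: (family_mx sB i).
  + exact: (family_mx sC i).
have U0 : U (row_mx 0 0) by exact: push_dom0.
have fE t x : f (row_mx (row_mx 0 0 + t *: delta_mx 0 (lshift 0 0)) x) = h t i x.
  by rewrite /f row_mxKl row_mxKr /F push_line.
have fE0 x : f (row_mx (row_mx 0 0) x) = h 0 i x.
  by rewrite -fE scale0r addr0.
have Q := quotient_unif (lshift 0 0) oU sf U0 cK Ki e0.
apply: filterS Q => t Qt x Kx; have := Qt x Kx; rewrite fE fE0.
have [dx _] := img_inv (Ki x Kx).
have -> // : partial (lshift n (lshift 0 0)) f (row_mx (row_mx 0 0) x) =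
   1 * density g (dir_deriv b v g + Gamma g0 g v (b g)) (c g) i (chart_inv (atlas i) x)
   + 1 * density g (b g) (dir_deriv c v g + Gamma g0 g v (c g)) i (chart_inv (atlas i) x).
rewrite !mul1r; apply: has_deriv_uniq (has_deriv_density sb sc mg Sv dx).
have := along_deriv0 (lshift n (lshift 0 0)) sf (fdom_row U0 (Ki x Kx)).
suff -> : along f (row_mx (row_mx 0 0) x) (lshift n (lshift 0 0)) = (fun t => h t i x) by [].
by apply/funext => s; rewrite /along -row_moveL fE.
Qed.

End InnerProduct.

(** * Existence and uniqueness of the connection, and the curvature formula *)

(** Going around the three arguments changes the sign. *)
Lemma skew_symmetric_eq0 (R : realType) (X : Type) (S : X -> Prop) (phi : X -> X -> X -> R) :
  (forall x y z, S x -> S y -> S z -> phi x y z = phi y x z) ->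
  (forall x y z, S x -> S y -> S z -> phi x y z = - phi x z y) ->
  forall x y z, S x -> S y -> S z -> phi x y z = 0.
Proof.
move=> sym skew x y z Sx Sy Sz.
have : phi x y z = - phi x y z.
  rewrite {1}skew // sym // skew // opprK sym // skew // sym //.
by lra.
Qed.

Section Connection.
Variables (R : realType) (n : nat) (M : closed_manifold R n) (P : partition_of_unity M).
Variables (g0 : tensor M).
Hypothesis mg0 : metric g0.
Implicit Types (g v : tensor M) (i : chart_index M) (p : M) (a b c : field M).
Implicit Type D : field M -> field M -> field M.

Lemma GammaC g v w : Gamma g0 g v w = Gamma g0 g w v.
Proof. by apply: tensorP => i p; exact: christoffelC. Qed.

Lemma GammaDr g v w w' : Gamma g0 g v (w + w') = Gamma g0 g v w + Gamma g0 g v w'.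
Proof. by apply: tensorP => i p; exact: christoffelDr. Qed.

Lemma GammaZr g v (x : R) w : Gamma g0 g v (x *: w) = x *: Gamma g0 g v w.
Proof. by apply: tensorP => i p; exact: christoffelZr. Qed.

Lemma riemannian_of_levi_civita D :
  (forall a b g, smooth_field a -> smooth_field b -> metric g ->
    D a b g = levi_civita g0 a b g) -> riemannian_connection P g0 D.
Proof.
move=> E; split.
- move=> a b sa sb k U F oU sF mF.
  apply: (smooth_family_eq oU _ (smooth_levi_civita mg0 sa sb oU sF mF)) => u Uu /=.
  by rewrite E //; exact: mF.
- move=> a a' b g sa sa' sb mg; have saa := smooth_fieldD sa sa'.
  have Sa := field_S2 mg sa; have Sa' := field_S2 mg sa'.
  rewrite (E _ b g saa sb mg) (E _ b g sa sb mg) (E _ b g sa' sb mg) /levi_civita.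
  by rewrite (dirD sb mg Sa Sa') GammaC GammaDr !(GammaC _ (b g)) addrACA.
- move=> phi a b g sphi sa sb mg; have spa := smooth_fieldZ sa sphi.
  rewrite (E _ b g spa sb mg) (E _ b g sa sb mg) /levi_civita (dirZ sb mg _ (field_S2 mg sa)).
  by rewrite GammaC GammaZr (GammaC _ (b g)) -scalerDr.
- move=> a b b' g sa sb sb' mg; have sbb := smooth_fieldD sb sb'.
  rewrite (E a _ g sa sbb mg) (E a _ g sa sb mg) (E a _ g sa sb' mg) /levi_civita.
  by rewrite (dir_addr sb sb' mg (field_S2 mg sa)) GammaDr addrACA.
- move=> phi a b g sphi sa sb mg; have spb := smooth_fieldZ sb sphi.
  rewrite (E a _ g sa spb mg) (E a _ g sa sb mg) /levi_civita.
  by rewrite (dir_leibniz sphi sb mg (field_S2 mg sa)) GammaZr -addrA -scalerDr.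
- move=> a b g sa sb mg; rewrite (E a b g sa sb mg) (E b a g sb sa mg) /levi_civita (GammaC _ (b g)).
  have H (V : zmodType) (x y z : V) : x + z - (y + z) = x - y by rewrite opprD addrACA subrr addr0.
  exact: H.
- move=> a b c g sa sb sc mg; rewrite (E a b g sa sb mg) (E a c g sa sc mg).
  exact: (has_deriv_inner P mg0 sb sc mg (field_S2 mg sa)).
Qed.

(** The classical uniqueness argument: the difference to another connection is
    symmetric in its two arguments and skew with respect to the inner product,
    hence zero. *)
Lemma riemannian_levi_civita D a b g : riemannian_connection P g0 D ->
  smooth_field a -> smooth_field b -> metric g -> D a b g = levi_civita g0 a b g.
Proof.
move=> rD sa sb mg; have rL := riemannian_of_levi_civita (fun a b g _ _ _ => erefl).
have [T TE] : exists T : field M -> field M -> tensor M,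
    forall x y, T x y = D x y g - levi_civita g0 x y g by exists (fun x y => D x y g - levi_civita g0 x y g).
have ST x y : smooth_field x -> smooth_field y -> S2 (T x y).
  move=> sx sy; rewrite TE.
  exact: (S2B (field_S2 mg (conn_smooth rD sx sy)) (field_S2 mg (conn_smooth rL sx sy))).
have TC x y : smooth_field x -> smooth_field y -> T x y = T y x.
  move=> sx sy; have := conn_torsion_free rD sx sy mg.
  rewrite -(conn_torsion_free rL sx sy mg) !TE => /eqP; rewrite subr_eq => /eqP ->.
  have H (V : zmodType) (x1 x2 x3 : V) : x1 - x2 + x3 - x1 = x3 - x2.
    by rewrite addrAC (addrAC x1) subrr add0r addrC.
  exact: H.
have IT x y z : smooth_field x -> smooth_field y -> smooth_field z ->
    inner P g0 g (T x y) (z g) = inner P g0 g (D x y g) (z g) - inner P g0 g (levi_civita g0 x y g) (z g).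
  move=> sx sy sz; have := inner_lin P mg0 1 (-1) mg (field_S2 mg (conn_smooth rD sx sy))
    (field_S2 mg (conn_smooth rL sx sy)) (field_S2 mg sz).
  by rewrite scale1r scaleN1r mul1r mulN1r -TE.
have TS x y z : smooth_field x -> smooth_field y -> smooth_field z ->
    inner P g0 g (T x y) (z g) = - inner P g0 g (T x z) (y g).
  move=> sx sy sz; rewrite (IT x y z sx sy sz) (IT x z y sx sz sy).
  have := has_deriv_uniq (conn_metric rD sx sy sz mg) (conn_metric rL sx sy sz mg).
  rewrite ![inner P g0 g (y g) _]innerC; lra.
suff : T a b = 0 by rewrite TE => /eqP; rewrite subr_eq0 => /eqP.
apply: (inner_pos (P := P) mg0 mg (ST _ _ sa sb)).
(* The third field is the constant one with value T a b. *)
have sc := smooth_const_field (ST _ _ sa sb).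
have sym x y z : smooth_field x -> smooth_field y -> smooth_field z ->
    inner P g0 g (T x y) (z g) = inner P g0 g (T y x) (z g) by move=> sx sy _; rewrite TC.
exact: (skew_symmetric_eq0 (phi := fun x y z => inner P g0 g (T x y) (z g)) sym TS sa sb sc).
Qed.

Lemma levi_civitaE a b g i p :
  let A := raise g (a g) i p in let B := raise g (b g) i p in
  let A0 := raise g0 (a g) i p in let B0 := raise g0 (b g) i p in
  let G := raise g g0 i p in
  levi_civita g0 a b g i p =
    dir_deriv b (a g) g i p
    + 4^-1 *: (\tr A *: b g i p + \tr B *: a g i p)
    - (4^-1 * \tr (A0 *m B0)) *: (g0 i p *m G).
Proof. by move=> A B A0 B0 G; rewrite -addrA. Qed.

Lemma curvature_levi_civita D a b c g : riemannian_connection P g0 D ->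
  smooth_field a -> smooth_field b -> smooth_field c -> metric g ->
  curvature D a b c g = curvature (levi_civita g0) a b c g.
Proof.
move=> rD sa sb sc mg.
have E x y h : smooth_field x -> smooth_field y -> metric h -> D x y h = levi_civita g0 x y h.
  by move=> sx sy mh; exact: riemannian_levi_civita.
have E2 x y : smooth_field x -> smooth_field y ->
    D x (D y c) g = levi_civita g0 x (levi_civita g0 y c) g.
  move=> sx sy; have s1 := conn_smooth rD sy sc; have s2 := smooth_levi_civita mg0 sy sc.
  rewrite (E _ _ _ sx s1 mg) /levi_civita (E y c g sy sc mg).
  rewrite (dir_eq s1 s2 (fun h mh => E y c h sy sc mh) mg (field_S2 mg sx)).
  by [].
have sab := smooth_bracket sa sb.
by rewrite /curvature (E2 a b sa sb) (E2 b a sb sa) (E _ c g sab sc mg).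
Qed.

Lemma curvature_formula D a b c g i p : riemannian_connection P g0 D ->
  smooth_field a -> smooth_field b -> smooth_field c -> metric g ->
  curvature D a b c g i p =
  curvature_form (g0 i p) (g i p) (a g i p) (b g i p) (c g i p).
Proof.
move=> rD sa sb sc mg; have [dp|ndp] := pselect (dom i p).
  rewrite (curvature_levi_civita rD sa sb sc mg) (levi_civita_curvature mg0 sa sb sc mg dp).
  exact: (christoffel_curvature (g i p) (a g i p) (b g i p) (c g i p) (metric_unit mg0 dp)).
have SD x y : smooth_field x -> smooth_field y -> D x y g i p = 0.
  by move=> sx sy; exact: (S2_off (field_S2 mg (conn_smooth rD sx sy)) ndp).
have -> : curvature D a b c g i p = 0.
  change (D a (D b c) g i p - D b (D a c) g i p - D (bracket a b) c g i p = 0).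
  rewrite (SD _ _ sa (conn_smooth rD sb sc)) (SD _ _ sb (conn_smooth rD sa sc)).
  by rewrite (SD _ _ (smooth_bracket sa sb) sc) !subrr.
rewrite /curvature_form (S2_off (metric_S2 mg0) ndp) (S2_off (field_S2 mg sa) ndp).
rewrite (S2_off (field_S2 mg sb) ndp).
by rewrite !mul0mx !scaler0 subrr !scaler0 !subr0 !addr0.
Qed.

End Connection.

(** * Sectional curvature *)

Section Sectional.
Variables (R : realType) (n : nat) (M : closed_manifold R n) (P : partition_of_unity M).
Variables (g0 : tensor M).
Hypothesis mg0 : metric g0.
Variable D : field M -> field M -> field M.
Hypothesis rD : riemannian_connection P g0 D.
Implicit Types (g v : tensor M) (i : chart_index M) (p : M) (a b c : field M).

Lemma raise_scale h (alpha : M -> R) v i p :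
  raise h (scale_by alpha v) i p = alpha p *: raise h v i p.
Proof. by rewrite /raise /scale_by scalemxAr. Qed.

(** Both tensors are multiples of g at each point, so the terms with a in the
    curvature form cancel those with b. *)
Lemma curvature_scalar a b g (alpha beta : M -> R) :
  smooth_field a -> smooth_field b -> metric g ->
  a g = scale_by alpha g -> b g = scale_by beta g -> curvature D a b b g = 0.
Proof.
move=> sa sb mg ag bg; apply: tensorP => i p; rewrite [RHS]/=.
rewrite (curvature_formula mg0 i p rD sa sb sb mg) /curvature_form -!/(raise _ _ _ _).
rewrite ag bg !raise_scale.
rewrite /scale_by; move: (raise g g i p) (raise g0 g i p) (raise g g0 i p) => X Y G.
have E (x : R) : g0 i p *m (4 *: (x *: X) + (x * \tr X)%:M) = x *: (g0 i p *m (4 *: X + (\tr X)%:M)).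
  by rewrite scalemxAr scalerDr scale_scalar_mx !scalerA (mulrC 4).
rewrite !mxtraceZ !E -!scalemxAr -!scalemxAl !mxtraceZ.
move: (\tr _) (\tr _) (\tr _) (\tr _) (g0 i p *m _ *m _) => t1 t2 t3 t4 Z.
by apply/matrixP => j l; rewrite !mxE; ring.
Qed.

Lemma inner0 g v : metric g -> S2 v -> inner P g0 g 0 v = 0.
Proof.
move=> mg Sv; have := inner_lin P mg0 0 0 mg Sv Sv Sv.
by rewrite !scale0r addr0 !mul0r addr0.
Qed.

Lemma sectional_unit a b g : inner P g0 g (a g) (a g) = 1 -> inner P g0 g (b g) (b g) = 1 ->
  inner P g0 g (a g) (b g) = 0 ->
  sectional P g0 D a b g = inner P g0 g (curvature D a b b g) (a g).
Proof. by move=> aa bb ab; rewrite /sectional aa bb ab expr0n subr0 mulr1 divr1. Qed.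

Lemma sectional_traceless a b g p :
  smooth_field a -> smooth_field b -> metric g ->
  let i := chart_at p in
  let A := raise g (a g) i p in
  let B := raise g (b g) i p in
  let A0 := raise g0 (a g) i p in
  let B0 := raise g0 (b g) i p in
  let G := raise g g0 i p in
  \tr A = 0 -> \tr B = 0 ->
  tr0 g0 (curvature D a b b g) (a g) p =
    - 2^-1 * (\tr (A *m B) * \tr (A0 *m B0))
    + 4^-1 * (\tr (A *m A) * \tr (B0 *m B0) + \tr (B *m B) * \tr (A0 *m A0))
    - 16^-1 * (\tr (G *m G)
        * (\tr (A0 *m A0) * \tr (B0 *m B0) - \tr (A0 *m B0) ^+ 2)).
Proof.
move=> sa sb mg i A B A0 B0 G tA tB.
have dp : dom i p by exact: chart_atP.
have u0 := metric_unit mg0 dp.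
have GA : G *m A0 = A by rewrite /G /A0 /raise -mulmxA (mulKVmx u0).
pose f X := \tr (invmx (g0 i p) *m X *m A0).
have fD X Y : f (X + Y) = f X + f Y by rewrite /f mulmxDr mulmxDl mxtraceD.
have fZ x X : f (x *: X) = x * f X by rewrite /f -scalemxAr -scalemxAl mxtraceZ.
have fN X : f (- X) = - f X by rewrite -scaleN1r fZ mulN1r.
have fG X : f (g0 i p *m (4 *: X + (0 : R)%:M) *m G) = 4 * \tr (X *m A).
  have -> : (0 : R)%:M = 0 :> 'M[R]_n by exact: raddf0.
  rewrite addr0 -scalemxAr -scalemxAl fZ /f -!mulmxA (mulKmx u0).
  have -> : invmx (g i p) *m (g0 i p *m A0) = A by rewrite -GA mulmxA.
  by [].
have -> : tr0 g0 (curvature D a b b g) (a g) p = f (curvature D a b b g i p) by [].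
rewrite (curvature_formula mg0 i p rD sa sb sb mg) /curvature_form.
rewrite -/(raise _ _ _ _) -/A -/B -/A0 -/B0 -/G tA tB.
rewrite !(fD, fN, fZ) !fG.
have -> : f (a g i p) = \tr (A0 *m A0) by [].
have -> : f (b g i p) = \tr (A0 *m B0) by rewrite mxtrace_mulC.
rewrite (mxtrace_mulC B A).
by field.
Qed.

End Sectional.

(** * Smooth curves of metrics *)

Section Curves.
Variables (R : realType) (n : nat) (M : closed_manifold R n).
Variable J : set R.
Hypothesis oJ : open J.
Implicit Types (G : R -> tensor M) (i : chart_index M) (p : M).

Definition line_dom : set 'rV[R]_1 := [set u | J (u 0 0)].

Lemma line_dom_open : open line_dom.
Proof. by apply: open_comp => // x _; exact: coord_continuous. Qed.

Lemma curve_pderiv G t : smooth_curve J G -> J t ->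
  curve_deriv G t = pderiv 0 (fun u : 'rV[R]_1 => G (u 0 0)) (const_mx t).
Proof.
move=> sG Jt; apply: (curve_deriv_family line_dom_open sG); first by rewrite /line_dom /= mxE.
by near=> s; rewrite !mxE mulr1.
Unshelve. all: by end_near. Qed.

Lemma curve_mx_deriv G t i p : smooth_curve J G -> J t ->
  mx_deriv (fun s => G s i p) t (curve_deriv G t i p).
Proof.
move=> sG Jt j l; rewrite curve_pderiv //; apply/has_deriv_shift.
have Ut : line_dom (const_mx t) by rewrite /line_dom /= mxE.
have := family_deriv 0 i p j l line_dom_open sG Ut.
suff -> : (fun s => G ((const_mx t + s *: delta_mx 0 0 : 'rV[R]_1) 0 0) i p j l) =
  (fun s => G (t + s) i p j l) by [].
by apply/funext => s; rewrite !mxE mulr1.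
Qed.

Lemma smooth_curve_deriv G : smooth_curve J G -> smooth_curve J (curve_deriv G).
Proof.
move=> sG; apply: (smooth_family_eq line_dom_open _
  (smooth_family_pderiv 0 line_dom_open sG)) => u Uu.
by rewrite curve_pderiv //; congr pderiv; apply/rowP => j; rewrite mxE ord1.
Qed.

Lemma smooth_rho_curve g0 G : metric g0 -> smooth_curve J G ->
  (forall t, J t -> metric (G t)) ->
  smooth_sfamily line_dom (fun u => rho g0 (G (u 0 0))).
Proof.
move=> mg0 sG mG i; have oD := fdom_open i line_dom_open.
pose F (u : 'rV[R]_1) := G (u 0 0); have sF : smooth_family line_dom F by exact: sG.
have s0 := const_family line_dom_open (metric_S2 mg0).
have vs (H : 'rV[R]_1 -> tensor M) : smooth_family line_dom H ->
    (forall u, line_dom u -> metric (H u)) ->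
    smooth_on (fdom line_dom i) (fun w => Num.sqrt (\det (jmx H i w))).
  move=> sH mH; apply: (smooth_sqrt oD _ (smooth_det oD (family_mx sH i))) => w Dw.
  by apply: posdef_det; exact: metric_posdef (mH _ Dw.1) (fdom_dom Dw).
have V := smoothV oD _ (vs _ s0 (fun _ _ => mg0)).
apply: (smooth_eq oD _ (smoothM oD (vs F sF (fun u Uu => mG _ Uu)) (V _))) => [w Dw|w Dw].
  by rewrite (rho_chart mg0 (mG _ Dw.1) (fdom_dom Dw)).
by rewrite gt_eqF // (vol_density_gt0 mg0 (fdom_dom Dw)).
Qed.

Lemma has_deriv_rho g0 G t i p : metric g0 -> smooth_curve J G ->
  (forall t, J t -> metric (G t)) -> J t -> dom i p ->
  has_deriv (fun s => rho g0 (G s) p) t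
    (2^-1 * \tr (raise (G t) (curve_deriv G t) i p) * rho g0 (G t) p).
Proof.
move=> mg0 sG mG Jt dp.
have N : \forall s \near t, J s by exact: open_nbhs_nbhs.
apply: (has_deriv_near (f := fun s => (vol_density g0 i p)^-1 * vol_density (G s) i p)).
  by apply: filterS N => s Js; rewrite (rho_chart mg0 (mG s Js) dp) mulrC.
rewrite (rho_chart mg0 (mG t Jt) dp) [vol_density _ _ _ / _]mulrC mulrCA.
apply: has_derivZ; apply: has_deriv_sqrt_det (curve_mx_deriv i p sG Jt).
by apply: posdef_det; exact: metric_posdef (mG t Jt) dp.
Qed.

Lemma has_deriv0_cst (f : R -> R) : is_interval J -> (forall t, J t -> has_deriv f t 0) ->
  forall s t, J s -> J t -> f s = f t.
Proof.
move=> iJ df; have H s t : J s -> J t -> s <= t -> f s = f t.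
  move=> Js Jt st; have sJ x : x \in `[s, t] -> J x.
    by rewrite in_itv /= => xst; exact: (iJ s t).
  have [||c _] := @MVT_segment R f (fun=> 0) s t st.
  - by move=> x /subset_itv_oo_cc xst; exact: df (sJ x xst).
  - apply: continuous_in_subspaceT => x /set_mem /= xst.
    exact: has_deriv_cont (df _ (sJ x xst)).
  - by rewrite mul0r => /eqP; rewrite subr_eq0 => /eqP.
by move=> s t Js Jt; have [/(H s t Js Jt)|/ltW /(H t s Jt Js)] := leP s t.
Qed.

End Curves.

(** * Geodesics *)

Section GeodesicMatrix.
Variables (R : realType) (n : nat) (g0 g v v' : 'M[R]_n) (r : R).

Lemma momentum_matrix :
  (2^-1 * \tr (invmx g *m v) * r) *: v + r *: v' =
  r *: (v' + christoffel g0 g v v)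
  + (4^-1 * (\tr (invmx g0 *m v *m (invmx g0 *m v)) * r)) *: (g0 *m (invmx g *m g0)).
Proof.
rewrite /christoffel; move: (\tr _) (\tr _) (g0 *m _) => t1 t2 H.
by apply/matrixP => j l; rewrite !mxE; field.
Qed.

Lemma energy_matrix : g0 \in unitmx ->
  4^-1 * (\tr (invmx g0 *m v' *m (invmx g0 *m v) + invmx g0 *m v *m (invmx g0 *m v')) * r
    + \tr (invmx g0 *m v *m (invmx g0 *m v)) * (2^-1 * \tr (invmx g *m v) * r)) =
  2^-1 * r * \tr (invmx g0 *m v *m (invmx g0 *m (v' + christoffel g0 g v v))).
Proof.
move=> u0; have := christoffel_pair g v v v u0.
rewrite mxtrace_mulC !mulmxDr !mxtraceD => ->.
rewrite (mxtrace_mulC (invmx g0 *m v')).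
move: (\tr _) (\tr _) (\tr _) => t1 t2 t3.
by field.
Qed.

(** The right-hand side of the geodesic equation is dual to the trace. *)
Lemma power_matrix (c : R) (w : 'M[R]_n) : g0 \in unitmx ->
  r *: w = c *: (g0 *m (invmx g *m g0)) ->
  2^-1 * r * \tr (invmx g0 *m v *m (invmx g0 *m w)) = 2^-1 * c * \tr (invmx g *m v).
Proof.
move=> u0 rw; rewrite -!mulrA; congr (_ * _); rewrite -mxtraceZ !scalemxAr rw.
rewrite -!scalemxAr mxtraceZ (mulKmx u0); congr (_ * _).
by rewrite mxtrace_mulC -mulmxA (mulKVmx u0).
Qed.

End GeodesicMatrix.

Section Geodesics.
Variables (R : realType) (n : nat) (M : closed_manifold R n) (P : partition_of_unity M).
Variables (g0 : tensor M).
Hypothesis mg0 : metric g0.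
Variable D : field M -> field M -> field M.
Hypothesis rD : riemannian_connection P g0 D.
Variables (J : set R) (g : R -> tensor M).
Hypotheses (oJ : open J) (sg : smooth_curve J g) (mg : forall t, J t -> metric (g t)).
Implicit Types (i : chart_index M) (p : M).

Let v := curve_deriv g.
Let W := covariant_deriv D g v.
Let kappa t := geodesic_factor g0 (g t) (v t).
Let sv : smooth_curve J v := smooth_curve_deriv oJ sg.

Lemma acceleration t : J t -> W t = curve_deriv v t + Gamma g0 (g t) (v t) (v t).
Proof.
move=> Jt; have mt := mg Jt; have St : S2 (v t) := S2_curve g t.
have sc := smooth_const_field St.
rewrite /W /covariant_deriv (riemannian_levi_civita mg0 rD sc sc mt); congr (_ + _).
rewrite /levi_civita; have -> : dir_deriv (cst (v t)) (cst (v t) (g t)) (g t) = 0.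
  apply: tensorP => i p.
  exact: (mx_deriv_uniq (dir_mx mt St i p sc) (mx_deriv_cst 0 (v t i p))).
exact: add0r.
Qed.

Lemma S2_acceleration t : J t -> S2 (W t).
Proof.
move=> Jt; rewrite acceleration //; apply: S2D; first exact: S2_curve.
by apply: (S2_Gamma mg0 (mg Jt)); exact: S2_curve.
Qed.

(** The factor rho absorbs the linear terms of the covariant derivative and
    leaves the quadratic one. *)
Lemma momentum_deriv t i p : J t ->
  curve_deriv (fun s => scale_by (rho g0 (g s)) (v s)) t i p =
  rho g0 (g t) p *: W t i p + kappa t p *: (g0 i p *m raise (g t) g0 i p).
Proof.
move=> Jt; have [dp|ndp] := pselect (dom i p); last first.
  rewrite (S2_off (S2_curve _ _) ndp) (S2_off (S2_acceleration Jt) ndp).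
  by rewrite (S2_off (metric_S2 mg0) ndp) mul0mx !scaler0 addr0.
have sm : smooth_curve J (fun s => scale_by (rho g0 (g s)) (v s)).
  exact: (smooth_family_scale (line_dom_open oJ) (smooth_rho_curve oJ mg0 sg mg) sv).
have d1 := curve_mx_deriv oJ i p sm Jt.
have d2 := mx_derivZ (has_deriv_rho oJ mg0 sg mg Jt dp) (curve_mx_deriv oJ i p sv Jt).
rewrite (mx_deriv_uniq d1 d2) (acceleration Jt).
have Sv : S2 (v t) := S2_curve g t.
have -> : kappa t p = 4^-1 * (\tr (raise g0 (v t) i p *m raise g0 (v t) i p) * rho g0 (g t) p).
  by rewrite (tr_raise2_chart mg0 Sv Sv dp (chart_atP p)).
exact: momentum_matrix.
Qed.

(** The energy density kappa changes at the rate of the pairing of velocity and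
    acceleration, because the pointwise connection is compatible. *)
Lemma has_deriv_energy t p : J t -> let i := chart_at p in
  has_deriv (fun s => kappa s p) t
    (2^-1 * rho g0 (g t) p * \tr (raise g0 (v t) i p *m raise g0 (W t) i p)).
Proof.
move=> Jt i; have dp : dom i p by exact: chart_atP.
have dv := mx_derivMl (invmx (g0 i p)) (curve_mx_deriv oJ i p sv Jt).
have dk := has_derivZ 4^-1 (has_derivM (mx_deriv_tr (mx_derivM dv dv))
  (has_deriv_rho oJ mg0 sg mg Jt dp)).
rewrite (acceleration Jt).
have := energy_matrix (g t i p) (v t i p) (curve_deriv v t i p) (rho g0 (g t) p)
  (metric_unit mg0 dp).
by move=> E; rewrite E in dk.
Qed.

(** By momentum_deriv the equation says rho W = (k - kappa) g0 g^-1 g0, so both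
    directions amount to kappa = k on J. *)
Lemma geodesic_momentum : is_interval J -> J 0 ->
  let k := geodesic_factor g0 (g 0) (v 0) in
  geodesic D J g <->
  forall t, J t -> curve_deriv (fun s => scale_by (rho g0 (g s)) (v s)) t
    = scale_by k (fun i p => g0 i p *m raise (g t) g0 i p).
Proof.
move=> iJ J0 k; have r0 t p : J t -> rho g0 (g t) p != 0.
  by move=> Jt; rewrite gt_eqF // (rho_gt0 p mg0 (mg Jt)).
split=> [geo t Jt|eq t Jt].
  have kc p : kappa t p = k p.
    apply: (has_deriv0_cst (f := fun s => kappa s p) iJ _ Jt J0) => s Js.
    have := has_deriv_energy p Js; have -> : W s = 0 by exact: geo.
    by rewrite /= {2}/raise mulmx0 mulmx0 mxtrace0 mulr0.
  apply: tensorP => i p; rewrite momentum_deriv //.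
  have -> : W t = 0 by exact: geo.
  by rewrite kc scaler0 add0r.
have rW s i p : J s -> rho g0 (g s) p *: W s i p =
    (k p - kappa s p) *: (g0 i p *m raise (g s) g0 i p).
  move=> Js; have H (V : lmodType R) (r x y : R) (w h : V) : y *: h = r *: w + x *: h -> r *: w = (y - x) *: h.
    by move=> E; rewrite scalerBl E addrK.
  by apply: H; rewrite -(momentum_deriv i p Js) (eq s Js).
(* The linear equation for kappa - k has the integrating factor rho. *)
have kc p s : J s -> kappa s p = k p.
  move=> Js; have dp : dom (chart_at p) p by exact: chart_atP.
  have : rho g0 (g s) p * (kappa s p - k p) = rho g0 (g 0) p * (kappa 0 p - k p).
    apply: (has_deriv0_cst (f := fun s => rho g0 (g s) p * (kappa s p - k p)) iJ _ Js J0).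
    move=> x Jx; have d := has_derivM (has_deriv_rho oJ mg0 sg mg Jx dp)
      (has_derivB (has_deriv_energy p Jx) (has_deriv_cst (k p) x)).
    move: d; congr has_deriv; rewrite subr0.
    have := power_matrix (v x (chart_at p) p) (metric_unit mg0 dp) (rW x (chart_at p) p Jx).
    rewrite /raise -/(v x) => ->.
    by ring.
  have -> : kappa 0 p - k p = 0 by exact: subrr.
  rewrite mulr0 => /eqP; rewrite mulf_eq0 (negPf (r0 _ _ Js)) /=.
  by rewrite subr_eq0 => /eqP.
apply: tensorP => i p; have := rW t i p Jt.
rewrite kc // subrr scale0r => /eqP; rewrite scaler_eq0 (negPf (r0 _ _ Jt)) /=.
by move/eqP.
Qed.

Lemma geodesic_factor_ge0 t p : J t ->
  0 <= geodesic_factor g0 (g t) (v t) p ?= iff (v t (chart_at p) p == 0).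
Proof.
move=> Jt; have dp : dom (chart_at p) p by exact: chart_atP.
have [t0 t1] := posdef_tr (metric_posdef mg0 dp) (S2_sym (S2_curve g t) (chart_at p) p).
have r0 := rho_gt0 p mg0 (mg Jt).
split; first by rewrite mulr_ge0 // mulr_ge0 // ltW.
rewrite -t1 /geodesic_factor /inner_at /tr0 /raise.
by rewrite [RHS]eq_sym eq_sym mulf_eq0 mulf_eq0 invr_eq0 pnatr_eq0 /= (gt_eqF r0) orbF.
Qed.

End Geodesics.

Theorem theorem2p1 (R : realType) (n : nat) (M : closed_manifold R n)
    (orientableM : orientable M) (P : partition_of_unity M)
    (g0 : tensor M) (metric_g0 : metric g0) :
  [/\ (* covariant derivative: existence, uniqueness, formula *)
      forall D : field M -> field M -> field M,
        riemannian_connection P g0 D <->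
        forall (a b : field M) (g : tensor M),
          smooth_field a -> smooth_field b -> metric g ->
          forall (i : chart_index M) (p : M),
          let A := raise g (a g) i p in
          let B := raise g (b g) i p in
          let A0 := raise g0 (a g) i p in
          let B0 := raise g0 (b g) i p in
          let G := raise g g0 i p in
          D a b g i p =
            dir_deriv b (a g) g i p
            + 4^-1 *: (\tr A *: b g i p + \tr B *: a g i p)
            - (4^-1 * \tr (A0 *m B0)) *: (g0 i p *m G),
      (* curvature tensor *)
      forall D : field M -> field M -> field M,
        riemannian_connection P g0 D ->
        forall (a b c : field M) (g : tensor M),
          smooth_field a -> smooth_field b -> smooth_field c -> metric g ->
          forall (i : chart_index M) (p : M),
          let A := raise g (a g) i p in
          let B := raise g (b g) i p in
          let C := raise g (c g) i p in
          let A0 := raise g0 (a g) i p in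
          let B0 := raise g0 (b g) i p in
          let C0 := raise g0 (c g) i p in
          let G := raise g g0 i p in
          curvature D a b c g i p =
            - 16^-1 *: ((4 * \tr (A *m C) + \tr A * \tr C) *: b g i p
                        - (4 * \tr (B *m C) + \tr B * \tr C) *: a g i p)
            - (16^-1 * \tr (A0 *m C0))
                *: (g0 i p *m (4 *: B + (\tr B)%:M) *m G)
            + (16^-1 * \tr (B0 *m C0))
                *: (g0 i p *m (4 *: A + (\tr A)%:M) *m G)
            + (16^-1 * \tr (G *m G))
                *: (\tr (A0 *m C0) *: b g i p - \tr (B0 *m C0) *: a g i p),
      (* sectional curvature *)
      forall D : field M -> field M -> field M,
        riemannian_connection P g0 D ->
        forall (a b : field M) (g : tensor M),
          smooth_field a -> smooth_field b -> metric g ->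
          inner P g0 g (a g) (a g) = 1 ->
          inner P g0 g (b g) (b g) = 1 ->
          inner P g0 g (a g) (b g) = 0 ->
          ((exists alpha beta : M -> R,
              a g = scale_by alpha g /\ b g = scale_by beta g) ->
             sectional P g0 D a b g = 0) /\
          ((forall i p, dom i p -> \tr (raise g (a g) i p) = 0) ->
           (forall i p, dom i p -> \tr (raise g (b g) i p) = 0) ->
             sectional P g0 D a b g =
             integral_vol P g (fun p =>
               let i := chart_at p in
               let A := raise g (a g) i p in
               let B := raise g (b g) i p in
               let A0 := raise g0 (a g) i p in
               let B0 := raise g0 (b g) i p in
               let G := raise g g0 i p in
               - 2^-1 * (\tr (A *m B) * \tr (A0 *m B0))
               + 4^-1 * (\tr (A *m A) * \tr (B0 *m B0)
                         + \tr (B *m B) * \tr (A0 *m A0))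
               - 16^-1 * (\tr (G *m G)
                   * (\tr (A0 *m A0) * \tr (B0 *m B0)
                      - \tr (A0 *m B0) ^+ 2))))
    & (* geodesics *)
      forall D : field M -> field M -> field M,
        riemannian_connection P g0 D ->
        forall (J : set R) (g : R -> tensor M),
          open J -> is_interval J -> J 0 ->
          smooth_curve J g -> (forall t, J t -> metric (g t)) ->
          let v := curve_deriv g 0 in
          let k := geodesic_factor g0 (g 0) v in
          (geodesic D J g <->
           forall t, J t ->
             curve_deriv (fun s => scale_by (rho g0 (g s)) (curve_deriv g s)) t
             = scale_by k (fun i p => g0 i p *m raise (g t) g0 i p)) /\
          (forall p, 0 <= k p) /\
          (forall p, v (chart_at p) p != 0 -> 0 < k p)].
Proof.
split.
- move=> D; split=> [rD a b g sa sb mg i p A B A0 B0 G|E].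
    by rewrite (riemannian_levi_civita metric_g0 rD sa sb mg) levi_civitaE.
  apply: (riemannian_of_levi_civita P metric_g0) => a b g sa sb mg.
  apply: tensorP => i p.
  by rewrite levi_civitaE (E a b g sa sb mg i p).
- move=> D rD a b c g sa sb sc mg i p.
  exact: (curvature_formula metric_g0 i p rD sa sb sc mg).
- move=> D rD a b g sa sb mg aa bb ab.
  rewrite (sectional_unit D aa bb ab); split=> [[alpha [beta [ag bg]]]|ta tb].
    rewrite (curvature_scalar metric_g0 rD sa sb mg ag bg).
    exact: (inner0 P metric_g0 mg (field_S2 mg sa)).
  rewrite /inner; congr integral_vol; apply/funext => p.
  have dp : dom (chart_at p) p by exact: chart_atP.
  exact: (sectional_traceless metric_g0 rD sa sb mg (ta _ _ dp) (tb _ _ dp)).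
- move=> D rD J g oJ iJ J0 sg mg v k.
  have kP p := geodesic_factor_ge0 metric_g0 mg p J0.
  split; first exact: (geodesic_momentum metric_g0 rD oJ sg mg iJ J0).
  split=> p; first exact: (kP p).1.
  by move=> vp; rewrite lt_neqAle (kP p).1 andbT (kP p).2.
Qed.
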